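(* (Bianchi identities.) Let $H$ be a triangular Hopf algebra and $A$ a braided commutative left $H$-module algebra such that $\mathfrak X(A)$ and $\Omega(A)$ are finitely generated and projective as $A$-modules. Let $\{e_i\in\mathfrak X(A),\omega^i\in\Omega(A):i=1,\dots,n\}$ be a pair of dual bases of $\mathfrak X(A)$ and $\nabla:\mathfrak X(A)\to\Omega(A)\otimes_A\mathfrak X(A)$ a left connection, with connection one-forms $\omega_k{}^l=\langle e_k,{}^*\nabla\omega^l\rangle$, curvature two-forms $\mathsf R_k{}^l$ and torsion two-forms $\mathsf T^l$. Then (sums over repeated indices understood), for every $l$, $$\omega^k\otimes_A\big(\mathrm d\mathsf R_k{}^l+\omega_k{}^j\wedge\mathsf R_j{}^l-\mathsf R_k{}^j\wedge\omega_j{}^l\big)=0,$$ $$\mathrm d\mathsf T^l-\mathsf T^j\wedge\omega_j{}^l=\omega^j\wedge\mathsf R_j{}^l.$$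
   Context: $\Bbbk$ is a field of characteristic zero, or the ring of formal power series over such a field; $\otimes$ is over $\Bbbk$; algebras are associative and unital; Hopf algebras have invertible antipode $S$; $\Delta(h)=h_{(1)}\otimes h_{(2)}$. $H$ is triangular with universal R-matrix $\mathcal R$ ($\Delta^{cop}(h)=\mathcal R\Delta(h)\mathcal R^{-1}$, $(\Delta\otimes\mathrm{id})\mathcal R=\mathcal R_{13}\mathcal R_{23}$, $(\mathrm{id}\otimes\Delta)\mathcal R=\mathcal R_{13}\mathcal R_{12}$, $\mathcal R_{21}=\mathcal R^{-1}$); write $\mathcal R^{-1}=\bar R^\alpha\otimes\bar R_\alpha$, summation understood. $A$ is a left $H$-module algebra, braided commutative: $ab=(\bar R^\alpha\triangleright b)(\bar R_\alpha\triangleright a)$. Tensor products carry the diagonal $H$-action; the braiding is $\tau(v\otimes_A w)=\bar R^\alpha\triangleright w\otimes_A\bar R_\alpha\triangleright v$. Vector fields. $\mathfrak X(A)$ is the set of braided derivations: $\Bbbk$-linear $u:A\to A$ with $u(ab)=u(a)b+(\bar R^\alpha\triangleright a)(\bar R_\alpha\triangleright u)(b)$, where $(h\triangleright u)(a)=h_{(1)}\triangleright(u(S(h_{(2)})\triangleright a))$; $A$-bimodule structure $(au)(b)=a\,u(b)$, $ua=(\bar R^\alpha\triangleright a)(\bar R_\alpha\triangleright u)$; bracket $[u,v]=u\circ v-(\bar R^\alpha\triangleright v)\circ(\bar R_\alpha\triangleright u)$. Forms. ${}^*\mathfrak X(A)$ is the module of left $A$-linear maps $\mathfrak X(A)\to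 A$, $\langle u,\omega\rangle:=\omega(u)$, with $(\omega a)(u)=\omega(u)a$, $(a\omega)(u)=\omega(ua)$, $(h\triangleright\omega)(u)=h_{(2)}\triangleright\omega(S^{-1}(h_{(1)})\triangleright u)$. $\mathrm d:A\to{}^*\mathfrak X(A)$, $\langle u,\mathrm da\rangle=u(a)$; $\Omega(A):=A\,\mathrm dA$ (under the projectivity assumption $\Omega(A)={}^*\mathfrak X(A)$). A pair of dual bases satisfies $u=\langle u,\omega^i\rangle e_i$ for all $u\in\mathfrak X(A)$ (the $e_i$ need only generate). $\Omega^r(A)\subset\Omega(A)^{\otimes_Ar}$ is the image of $A_r=\frac1{r!}\sum_\wp\mathrm{sign}(\wp)\Pi_\wp$, with $\Pi$ the representation of the permutation group generated by $\tau$ on adjacent factors; $\theta\wedge\theta'=\frac{(r+r')!}{r!r'!}A_{r+r'}(\theta\otimes_A\theta')$ for $\theta\in\Omega^r(A),\theta'\in\Omega^{r'}(A)$; $\mathrm d$ extends uniquely to an $H$-equivariant degree-one map on $\Omega^\bullet(A)$ with $\mathrm d^2=0$ and the graded Leibniz rule. Connections. A left connection on $\mathfrak X(A)$ is a $\Bbbk$-linear $\nabla:\mathfrak X(A)\to\Omega(A)\otimes_A\mathfrak X(A)$ with $\nabla(av)=\mathrm da\otimes_Av+a\nabla(v)$. Put $\nabla_uv=\mathrm i_u(\nabla v)$ with $\mathrm i_u(\theta\otimes_Av)=\langle u,\theta\rangle v$; curvature $R_\nabla(u,v,z)=\nabla_u\nabla_vz-\nabla_{\bar R^\alpha\triangleright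 v}\nabla_{\bar R_\alpha\triangleright u}z-\nabla_{[u,v]}z$; torsion $T_\nabla(u,v)=\nabla_uv-\nabla_{\bar R^\alpha\triangleright v}(\bar R_\alpha\triangleright u)-[u,v]$. The dual right connection ${}^*\nabla:\Omega(A)\to\Omega(A)\otimes_A\Omega(A)$ is defined by $\mathrm d\langle v,\theta\rangle=\langle\nabla v,\theta\rangle+\langle v,{}^*\nabla\theta\rangle$, where $\langle\eta\otimes_Av,\theta\rangle=\eta\langle v,\theta\rangle$ and $\langle v,\theta\otimes_A\eta\rangle=\langle v,\theta\rangle\eta$. Coefficients. $R_{ijk}{}^l:=\langle R_\nabla(e_i,e_j,e_k),\omega^l\rangle$, $T_{ij}{}^l:=\langle T_\nabla(e_i,e_j),\omega^l\rangle$, $\mathsf R_k{}^l:=-\frac12\omega^j\wedge\omega^iR_{ijk}{}^l$, $\mathsf T^l:=-\frac12\omega^j\wedge\omega^iT_{ij}{}^l$. *)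

(* Defs.v *)
From HB Require Import structures.
From mathcomp Require Import all_boot all_order all_fingroup all_algebra.
From mathcomp Require Import boolp functions.

Set Implicit Arguments.
Unset Strict Implicit.
Unset Printing Implicit Defensive.

Import GRing.Theory.
Local Open Scope ring_scope.
Local Open Scope quotient_scope.

Section Tensor.
Variables (A : Type) (M N : zmodType) (ra : M -> A -> M) (la : A -> N -> N).

(* A list of pairs stands for the sum of the corresponding elementary         *)
(* tensors; the relations below present M (x)_A N as a commutative monoid,    *)
(* in which (- m) (x) n is opposite to m (x) n.                               *)
Inductive tens_eq : seq (M * N) -> seq (M * N) -> Prop :=
| TensRefl s : tens_eq s s
| TensSym s t : tens_eq s t -> tens_eq t s
| TensTrans t s u : tens_eq s t -> tens_eq t u -> tens_eq s u
| TensCat s s' t t' :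
    tens_eq s s' -> tens_eq t t' -> tens_eq (s ++ t) (s' ++ t')
| TensC s t : tens_eq (s ++ t) (t ++ s)
| Tens0 n : tens_eq [:: (0, n)] [::]
| TensDl m m' n : tens_eq [:: (m + m', n)] [:: (m, n); (m', n)]
| TensDr m n n' : tens_eq [:: (m, n + n')] [:: (m, n); (m, n')]
| TensBal m a n : tens_eq [:: (ra m a, n)] [:: (m, la a n)].

Definition tens_eqb (s t : seq (M * N)) : bool := `[< tens_eq s t >].

Lemma tens_eqb_refl : reflexive tens_eqb.
Proof. by move=> s; apply/asboolP; exact: TensRefl. Qed.
Lemma tens_eqb_sym : symmetric tens_eqb.
Proof. by move=> s t; apply/asboolP/asboolP; exact: TensSym. Qed.
Lemma tens_eqb_trans : transitive tens_eqb.
Proof.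
move=> t s u /asboolP st /asboolP tu; apply/asboolP; exact: TensTrans st tu.
Qed.

Definition tens_equiv :=
  EquivRel tens_eqb tens_eqb_refl tens_eqb_sym tens_eqb_trans.

Definition tens := {eq_quot tens_equiv}.
HB.instance Definition _ := Choice.on tens.
HB.instance Definition _ := EqQuotient.on tens.

(* A chosen expression of t as a sum of elementary tensors: summing F x y     *)
(* over the pairs (x, y) of [tseq t] is the value at t of the map induced by  *)
(* F on the tensor product, whenever F is biadditive and balanced.            *)
Definition tseq (t : tens) : seq (M * N) := generic_quotient.repr t.

Definition tpi (s : seq (M * N)) : tens := \pi_tens s.

Definition tmk (m : M) (n : N) : tens := tpi [:: (m, n)].

Lemma tpiP s t : tpi s = tpi t <-> tens_eq s t.
Proof.
rewrite /tpi; split=> [/eqP|st]; first by rewrite piE => /asboolP.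
by apply/eqP; rewrite piE; apply/asboolP.
Qed.

Lemma tseqK t : tpi (tseq t) = t.
Proof. exact: reprK. Qed.

Lemma tseq_tpi s : tens_eq (tseq (tpi s)) s.
Proof. by apply/tpiP; rewrite tseqK. Qed.

Definition tadd (s t : tens) := tpi (tseq s ++ tseq t).
Definition tzero := tpi [::].
Definition sopp (s : seq (M * N)) := [seq (- p.1, p.2) | p <- s].
Definition topp (t : tens) := tpi (sopp (tseq t)).

Lemma tpi_cat s t : tpi (s ++ t) = tadd (tpi s) (tpi t).
Proof. by apply/tpiP; apply: TensCat; apply: TensSym; apply: tseq_tpi. Qed.

Lemma taddA : associative tadd.
Proof.
by move=> s t u; rewrite -(tseqK s) -(tseqK t) -(tseqK u) -!tpi_cat catA.
Qed.

Lemma taddC : commutative tadd.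
Proof.
by move=> s t; rewrite -(tseqK s) -(tseqK t) -!tpi_cat; apply/tpiP; exact: TensC.
Qed.

Lemma tadd0 : left_id tzero tadd.
Proof. by move=> t; rewrite -(tseqK t) -tpi_cat. Qed.

Lemma taddN : left_inverse tzero topp tadd.
Proof.
move=> t; rewrite -{2}(tseqK t) /topp -tpi_cat; apply/tpiP.
elim: (tseq t) => [|[m n] s IH] /=; first exact: TensRefl.
rewrite -cat1s -(cat1s (m, n)).
apply: (@TensTrans (([:: (- m, n)] ++ [:: (m, n)]) ++ (sopp s ++ s))).
  rewrite -!catA; apply: TensCat; first exact: TensRefl.
  by rewrite !catA; apply: TensCat; [exact: TensC | exact: TensRefl].
rewrite -(cat0s [::]); apply: TensCat => //.
apply: (TensTrans (TensSym (TensDl _ _ _))); rewrite addNr; exact: Tens0.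
Qed.

HB.instance Definition _ :=
  GRing.isZmodule.Build tens taddA taddC tadd0 taddN.

Lemma tpiD s t : tpi (s ++ t) = tpi s + tpi t.
Proof. exact: tpi_cat. Qed.

Lemma tpi0 : tpi [::] = 0.
Proof. by []. Qed.

Lemma tpiE s : tpi s = \sum_(p <- s) tmk p.1 p.2.
Proof.
elim: s => [|[m n] s IH]; first by rewrite big_nil.
by rewrite big_cons -IH -tpiD.
Qed.

Lemma tmkE t : t = \sum_(p <- tseq t) tmk p.1 p.2.
Proof. by rewrite -tpiE tseqK. Qed.

Lemma tmkDl m m' n : tmk (m + m') n = tmk m n + tmk m' n.
Proof. by rewrite -tpiD; apply/tpiP; exact: TensDl. Qed.
Lemma tmkDr m n n' : tmk m (n + n') = tmk m n + tmk m n'.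
Proof. by rewrite -tpiD; apply/tpiP; exact: TensDr. Qed.
Lemma tmk_bal m a n : tmk (ra m a) n = tmk m (la a n).
Proof. by apply/tpiP; exact: TensBal. Qed.

Definition balanced (Z : zmodType) (F : M -> N -> Z) :=
  [/\ forall m m' n, F (m + m') n = F m n + F m' n,
      forall m n n', F m (n + n') = F m n + F m n'
    & forall m a n, F (ra m a) n = F m (la a n)].

Lemma tens_eq_sum (Z : zmodType) (F : M -> N -> Z) s t :
  balanced F -> tens_eq s t ->
  \sum_(p <- s) F p.1 p.2 = \sum_(p <- t) F p.1 p.2.
Proof.
case=> FDl FDr Fb; elim=> {s t} //=.
- by move=> t s u _ -> _ ->.
- by move=> s s' t t' _ e1 _ e2; rewrite !big_cat /= e1 e2.
- by move=> s t; rewrite !big_cat /= addrC.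
- move=> n; rewrite big_seq1 big_nil /=; apply: (addrI (F 0 n)).
  by rewrite -FDl !addr0.
- by move=> m m' n; rewrite !big_cons !big_nil /= !addr0 FDl.
- by move=> m n n'; rewrite !big_cons !big_nil /= !addr0 FDr.
- by move=> m a n; rewrite !big_cons !big_nil /= Fb.
Qed.

Lemma tseq_sum (Z : zmodType) (F : M -> N -> Z) (I : Type) (r : seq I)
    (x : I -> M) (y : I -> N) : balanced F ->
  \sum_(p <- tseq (\sum_(i <- r) tmk (x i) (y i))) F p.1 p.2
  = \sum_(i <- r) F (x i) (y i).
Proof.
move=> bF; have -> : \sum_(i <- r) tmk (x i) (y i)
    = tpi [seq (x i, y i) | i <- r] by rewrite tpiE big_map.
by rewrite (tens_eq_sum bF (tseq_tpi _)) big_map.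
Qed.

Lemma tseqD (Z : zmodType) (F : M -> N -> Z) (s t : tens) : balanced F ->
  \sum_(p <- tseq (s + t)) F p.1 p.2
  = \sum_(p <- tseq s) F p.1 p.2 + \sum_(p <- tseq t) F p.1 p.2.
Proof.
move=> bF; rewrite -{1}(tseqK s) -{1}(tseqK t) -tpiD.
by rewrite (tens_eq_sum bF (tseq_tpi _)) big_cat.
Qed.

End Tensor.

Section KTensor.
Variables (k : comUnitRingType) (V W : lmodType k).

Definition ktens := tens (fun (v : V) (c : k) => c *: v) (fun c (w : W) => c *: w).
HB.instance Definition _ := GRing.Zmodule.on ktens.

Definition kt (v : V) (w : W) : ktens := tmk _ _ v w.

Definition kscale (c : k) (t : ktens) : ktens :=
  \sum_(p <- tseq t) kt (c *: p.1) p.2.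

Lemma ktZ c v w : kt (c *: v) w = kt v (c *: w).
Proof. exact: tmk_bal. Qed.

Lemma kscale_bal c : balanced (fun (v : V) (c : k) => c *: v)
  (fun c (w : W) => c *: w) (fun v w => kt (c *: v) w).
Proof.
split=> [v v' w|v w w'|v a w]; first by rewrite scalerDr /kt tmkDl.
  by rewrite /kt tmkDr.
by rewrite !ktZ !scalerA mulrC.
Qed.

Lemma kscaleE c (I : Type) (r : seq I) x y :
  kscale c (\sum_(i <- r) kt (x i) (y i)) = \sum_(i <- r) kt (c *: x i) (y i).
Proof. by rewrite /kscale; apply: (tseq_sum _ _ _ (kscale_bal c)). Qed.

Lemma kscaleA a b t : kscale a (kscale b t) = kscale (a * b) t.
Proof.
by rewrite {2}/kscale kscaleE; apply: eq_bigr => p _; rewrite scalerA.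
Qed.
Lemma kscale1 : left_id 1 kscale.
Proof.
by move=> t; rewrite [RHS]tmkE; apply: eq_bigr => p _; rewrite scale1r.
Qed.
Lemma kscaleDr : right_distributive kscale +%R.
Proof. by move=> a s t; apply: (tseqD _ _ (kscale_bal a)). Qed.
Lemma kscaleDl t : {morph kscale^~ t : a b / a + b}.
Proof.
move=> a b; rewrite -big_split /=; apply: eq_bigr => p _.
by rewrite scalerDl /kt tmkDl.
Qed.

HB.instance Definition _ := GRing.Zmodule_isLmodule.Build k ktens
  kscaleA kscale1 kscaleDr kscaleDl.

End KTensor.

Section TensorSquare.
Variables (k : comUnitRingType) (H : algType k).

Definition tmul (s t : ktens H H) : ktens H H :=
  \sum_(p <- tseq s) \sum_(q <- tseq t) kt (p.1 * q.1) (p.2 * q.2).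

Definition tflip (t : ktens H H) : ktens H H := \sum_(p <- tseq t) kt p.2 p.1.

End TensorSquare.

(* Sums over [tseq (coprod h)] are Sweedler sums: p.1 and p.2 are h_(1) and   *)
(* h_(2). Coassociativity is an equality in H (x) (H (x) H).                  *)
Record hopfAlgebra (k : comUnitRingType) := HopfAlgebra {
  hopf_alg :> algType k;
  coprod : {linear hopf_alg -> ktens hopf_alg hopf_alg};
  counit : {scalar hopf_alg};
  antipode : {linear hopf_alg -> hopf_alg};
  antipode_inv : hopf_alg -> hopf_alg;
  coprodM : forall g h, coprod (g * h) = tmul (coprod g) (coprod h);
  coprod1 : coprod 1 = kt 1 1;
  counitM : forall g h, counit (g * h) = counit g * counit h;
  counit1 : counit 1 = 1;
  coprodA : forall h,
    \sum_(p <- tseq (coprod h)) \sum_(q <- tseq (coprod p.1))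
      kt q.1 (kt q.2 p.2)
    = \sum_(p <- tseq (coprod h)) kt p.1 (coprod p.2);
  counit_coprodl : forall h, \sum_(p <- tseq (coprod h)) counit p.1 *: p.2 = h;
  counit_coprodr : forall h, \sum_(p <- tseq (coprod h)) counit p.2 *: p.1 = h;
  antipodel : forall h,
    \sum_(p <- tseq (coprod h)) antipode p.1 * p.2 = (counit h)%:A;
  antipoder : forall h,
    \sum_(p <- tseq (coprod h)) p.1 * antipode p.2 = (counit h)%:A;
  antipodeK : cancel antipode antipode_inv;
  antipode_invK : cancel antipode_inv antipode
}.

Arguments coprod {k} {_}.
Arguments counit {k} {_}.
Arguments antipode {k} {_}.
Arguments antipode_inv {k} {_}.

(* [rmat_coprodl] and [rmat_coprodr] are (Delta (x) id) R = R_13 R_23 and     *)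
(* (id (x) Delta) R = R_13 R_12, with the products in H (x) H (x) H expanded. *)
Record triangularHopfAlgebra (k : comUnitRingType) := TriangularHopfAlgebra {
  tri_hopf :> hopfAlgebra k;
  rmat : ktens tri_hopf tri_hopf;
  rmat_inv : ktens tri_hopf tri_hopf;
  rmatV : tmul rmat rmat_inv = kt 1 1;
  rmatVl : tmul rmat_inv rmat = kt 1 1;
  coprod_op : forall h : tri_hopf,
    tflip (coprod h) = tmul (tmul rmat (coprod h)) rmat_inv;
  rmat_coprodl :
    \sum_(p <- tseq rmat) \sum_(q <- tseq (coprod p.1)) kt q.1 (kt q.2 p.2)
    = \sum_(p <- tseq rmat) \sum_(q <- tseq rmat)
        kt p.1 (kt q.1 (p.2 * q.2));
  rmat_coprodr :
    \sum_(p <- tseq rmat) kt p.1 (coprod p.2)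
    = \sum_(p <- tseq rmat) \sum_(q <- tseq rmat)
        kt (p.1 * q.1) (kt q.2 p.2);
  rmat_triangular : tflip rmat = rmat_inv
}.

Arguments rmat {k}.
Arguments rmat_inv {k}.

Section LinearPredicate.
Variable k : comUnitRingType.
Implicit Types U V W Z : lmodType k.

Lemma lin_id V : linear (fun x : V => x).
Proof. by []. Qed.
Lemma lin_sum V W (I : Type) (r : seq I) (f : I -> V -> W) :
  (forall i, linear (f i)) -> linear (fun x => \sum_(i <- r) f i x).
Proof.
move=> lf c x y; rewrite scaler_sumr -big_split; apply: eq_bigr => i _.
exact: lf.
Qed.
Lemma lin_comp U V W (g : {linear V -> W}) (f : U -> V) :
  linear f -> linear (fun x => g (f x)).
Proof. by move=> lf c x y; rewrite lf linearP. Qed.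
Lemma lin_mull V (B : algType k) (f : V -> B) b :
  linear f -> linear (fun x => f x * b).
Proof. by move=> lf c x y; rewrite lf mulrDl scalerAl. Qed.
Lemma lin_mulr V (B : algType k) (f : V -> B) b :
  linear f -> linear (fun x => b * f x).
Proof. by move=> lf c x y; rewrite lf mulrDr scalerAr. Qed.
Lemma lin_scale V W (f : V -> W) c : linear f -> linear (fun x => c *: f x).
Proof. by move=> lf d x y; rewrite lf scalerDr !scalerA mulrC. Qed.
Lemma lin_scalar V W (f : {scalar V}) (w : W) : linear (fun x => f x *: w).
Proof. by move=> d x y; rewrite linearP scalerDl scalerA. Qed.
Lemma scale_kt V W c (v : V) (w : W) : c *: kt v w = kt (c *: v) w.
Proof.
have -> : kt v w = \sum_(i <- [:: tt]) kt v w by rewrite big_seq1.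
by rewrite [LHS](kscaleE c _ (fun=> v) (fun=> w)) big_seq1.
Qed.
Lemma lin_ktl U V W (f : U -> V) (w : W) :
  linear f -> linear (fun x => kt (f x) w).
Proof. by move=> lf c x y; rewrite lf /kt tmkDl scale_kt. Qed.
Lemma lin_ktr U V W (f : U -> W) (v : V) :
  linear f -> linear (fun x => kt v (f x)).
Proof. by move=> lf c x y; rewrite lf {1}/kt tmkDr scale_kt ktZ. Qed.

Definition bilin U V W (F : U * V -> W) :=
  (forall y, linear (fun x => F (x, y))) /\ (forall x, linear (fun y => F (x, y))).

Lemma bilin_bal U V W (F : U * V -> W) : bilin F ->
  balanced (fun (v : U) (c : k) => c *: v) (fun c (w : V) => c *: w)
    (fun x y => F (x, y)).
Proof.
have lZ (f : U -> W) : linear f -> forall c x, f (c *: x) = c *: f x.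
  move=> lf c x; have f0 : f 0 = 0.
    by apply: (addrI (f 0)); have := lf 1 0 0; rewrite !scale1r !addr0.
  by have := lf c x 0; rewrite !addr0 f0 addr0.
have lZ' (f : V -> W) : linear f -> forall c x, f (c *: x) = c *: f x.
  move=> lf c x; have f0 : f 0 = 0.
    by apply: (addrI (f 0)); have := lf 1 0 0; rewrite !scale1r !addr0.
  by have := lf c x 0; rewrite !addr0 f0 addr0.
case=> Fl Fr; split=> [x x' y|x y y'|x c y].
- by have := Fl y 1 x x'; rewrite !scale1r.
- by have := Fr x 1 y y'; rewrite !scale1r.
- by rewrite (lZ _ (Fl y)) (lZ' _ (Fr x)).
Qed.

Lemma ksum_pair U V W (F : U * V -> W) (t : seq (U * V)) :
  \sum_(p <- t) F p = \sum_(p <- t) F (p.1, p.2).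
Proof. by apply: eq_bigr => -[]. Qed.

Lemma ksum_sum U V W (F : U * V -> W) (I : Type) (r : seq I) x y :
  bilin F ->
  \sum_(p <- tseq (\sum_(i <- r) kt (x i) (y i) : ktens U V)) F p
  = \sum_(i <- r) F (x i, y i).
Proof. by move=> bF; rewrite ksum_pair (tseq_sum _ _ _ (bilin_bal bF)). Qed.

Lemma ksum_kt U V W (F : U * V -> W) x y : bilin F ->
  \sum_(p <- tseq (kt x y : ktens U V)) F p = F (x, y).
Proof.
move=> bF; have -> : kt x y = \sum_(i <- [:: tt]) kt x y by rewrite big_seq1.
by rewrite (ksum_sum _ (fun=> x) (fun=> y) bF) big_seq1.
Qed.

Lemma ktE U V (t : ktens U V) : t = \sum_(p <- tseq t) kt p.1 p.2.
Proof. exact: tmkE. Qed.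

Lemma lin_ksum U V W Z (f : Z -> ktens U V) (F : U * V -> W) :
  linear f -> bilin F -> linear (fun x => \sum_(p <- tseq (f x)) F p).
Proof.
move=> lf bF c x y; rewrite lf ksum_pair (tseqD _ _ (bilin_bal bF)).
congr (_ + _); last by rewrite -ksum_pair.
have -> : c *: f x = \sum_(p <- tseq (f x)) kt (c *: p.1) p.2.
  by rewrite {1}(ktE (f x)) scaler_sumr; apply: eq_bigr => p _; rewrite scale_kt.
rewrite scaler_sumr -ksum_pair.
rewrite (ksum_sum _ _ _ bF); apply: eq_bigr => p _.
case: bF => Fl _; have := Fl p.2 c p.1 0.
have F0 : F (0, p.2) = 0.
  by apply: (addrI (F (0, p.2))); have := Fl p.2 1 0 0; rewrite !scale1r !addr0.
by rewrite !addr0 F0 addr0 -surjective_pairing.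
Qed.

Definition trilin U V W Z (F : U -> V -> W -> Z) :=
  [/\ forall y z, linear (fun x => F x y z), forall x z, linear (fun y => F x y z)
    & forall x y, linear (fun z => F x y z)].

Definition tsum3 U V W Z (F : U -> V -> W -> Z) (t : ktens U (ktens V W)) :=
  \sum_(p <- tseq t) \sum_(q <- tseq p.2) F p.1 q.1 q.2.

Lemma tsum3_bilin U V W Z (F : U -> V -> W -> Z) : trilin F ->
  bilin (fun p : U * ktens V W => \sum_(q <- tseq p.2) F p.1 q.1 q.2).
Proof.
case=> F1 F2 F3; split=> [s|x] /=; first exact: lin_sum.
apply: (lin_ksum (f := fun t : ktens V W => t) (F := fun q => F x q.1 q.2)).
  exact: lin_id.
by split=> y /=; [exact: F2 | exact: F3].
Qed.

Lemma tsum3_lin U V W Z (F : U -> V -> W -> Z) : trilin F -> linear (tsum3 F).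
Proof.
move=> tF; apply: (lin_ksum (f := fun t : ktens U (ktens V W) => t)).
  exact: lin_id.
exact: tsum3_bilin.
Qed.

Lemma tsum3_sum U V W Z (F : U -> V -> W -> Z) (I : Type) (r : seq I) g :
  trilin F -> tsum3 F (\sum_(i <- r) g i) = \sum_(i <- r) tsum3 F (g i).
Proof.
move=> /tsum3_lin lF; apply: big_morph => [s t|].
  by have := lF 1 s t; rewrite !scale1r.
by apply: (addrI (tsum3 F 0)); have := lF 1 0 0; rewrite !scale1r !addr0.
Qed.

Lemma tsum3_kt U V W Z (F : U -> V -> W -> Z) x t : trilin F ->
  tsum3 F (kt x t) = \sum_(q <- tseq t) F x q.1 q.2.
Proof.
move=> tF; rewrite /tsum3.
by rewrite (ksum_kt x t (tsum3_bilin tF)).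
Qed.

Lemma tsum3_kkt U V W Z (F : U -> V -> W -> Z) x y z : trilin F ->
  tsum3 F (kt x (kt y z)) = F x y z.
Proof.
move=> tF; rewrite tsum3_kt // (ksum_kt (F := fun q => F x q.1 q.2)) //.
by case: tF => _ F2 F3; split=> t /=; [exact: F2 | exact: F3].
Qed.

End LinearPredicate.

Lemma lin_comp' (k : comUnitRingType) (U V W : lmodType k) (g : V -> W)
  (f : U -> V) : linear g -> linear f -> linear (fun x => g (f x)).
Proof. by move=> lg lf c x y; rewrite lf lg. Qed.

Ltac lin := first
  [ exact: lin_id
  | done
  | apply: lin_sum => ?; lin
  | apply: lin_mull; lin
  | apply: lin_mulr; lin
  | apply: lin_scale; lin
  | apply: lin_scalar
  | apply: lin_ktl; lin
  | apply: lin_ktr; lin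
  | apply: lin_ksum; [lin | split=> ? /=; lin]
  | apply: lin_comp; lin
  | match goal with F : forall a b, linear _ |- _ =>
      solve [apply: (lin_comp' (F _ _)); lin] end
  | match goal with F : forall a, linear _ |- _ =>
      solve [apply: (lin_comp' (F _)); lin] end ].

Ltac bil := split=> ? /=; lin.
Ltac tril := split=> ? ? /=; lin.

Section LinearMaps.
Variables (k : comUnitRingType) (V W : lmodType k) (f : V -> W).
Hypothesis lf : linear f.

Lemma linD x y : f (x + y) = f x + f y.
Proof. by have := lf 1 x y; rewrite !scale1r. Qed.
Lemma lin0 : f 0 = 0.
Proof. by apply: (addrI (f 0)); rewrite -linD !addr0. Qed.
Lemma linZ c x : f (c *: x) = c *: f x.
Proof. by have := lf c x 0; rewrite !addr0 lin0 addr0. Qed.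
Lemma linB x y : f (x - y) = f x - f y.
Proof. by rewrite linD -scaleN1r linZ scaleN1r. Qed.
Lemma lin_sumE (I : Type) (r : seq I) g :
  f (\sum_(i <- r) g i) = \sum_(i <- r) f (g i).
Proof. by apply: big_morph; [exact: linD | exact: lin0]. Qed.
End LinearMaps.

Section TensorSquareTheory.
Variables (k : comUnitRingType) (H : algType k).
Implicit Types s t u : ktens H H.

Lemma tmul_linl t : linear (fun s => tmul s t).
Proof. by apply: lin_ksum; [lin | bil]. Qed.
Lemma tmul_linr s : linear (fun t => tmul s t).
Proof. by apply: lin_sum => p; apply: lin_ksum; [lin | bil]. Qed.
Lemma tmul_kt a b c d : tmul (kt a b) (kt c d) = kt (a * c) (b * d) :> ktens H H.
Proof.
rewrite /tmul (ksum_kt (F := fun p => \sum_(q <- tseq (kt c d)) _)) /=; last by bil.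
by rewrite (ksum_kt (F := fun q => kt (a * q.1) (b * q.2))) //=; bil.
Qed.
Lemma tmulA s t u : tmul s (tmul t u) = tmul (tmul s t) u.
Proof.
rewrite (ktE s) [RHS](lin_sumE (f := fun s => tmul (tmul s t) u)); last first.
  by move=> c x y; rewrite tmul_linl tmul_linl.
rewrite (lin_sumE (tmul_linl _)); apply: eq_bigr => p _.
rewrite (ktE t) [RHS](lin_sumE (f := fun t => tmul (tmul _ t) u)); last first.
  by move=> c x y; rewrite tmul_linr tmul_linl.
rewrite [LHS](lin_sumE (f := fun t => tmul _ (tmul t u))); last first.
  by move=> c x y; rewrite tmul_linl tmul_linr.
apply: eq_bigr => q _.
rewrite (ktE u) [RHS](lin_sumE (tmul_linr _)).
rewrite [LHS](lin_sumE (f := fun u => tmul _ (tmul _ u))); last first.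
  by move=> c x y; rewrite tmul_linr tmul_linr.
by apply: eq_bigr => r _; rewrite !tmul_kt !mulrA.
Qed.
Lemma tmul1 s : tmul s (kt 1 1) = s.
Proof.
rewrite [in LHS](ktE s) (lin_sumE (tmul_linl _)) [RHS]ktE.
by apply: eq_bigr => p _; rewrite tmul_kt !mulr1.
Qed.
Lemma tmul1l s : tmul (kt 1 1) s = s.
Proof.
rewrite [in LHS](ktE s) (lin_sumE (tmul_linr _)) [RHS]ktE.
by apply: eq_bigr => p _; rewrite tmul_kt !mul1r.
Qed.
Lemma tmul_sum (W : lmodType k) (F : H * H -> W) s t : bilin F ->
  \sum_(p <- tseq (tmul s t)) F p
  = \sum_(p <- tseq s) \sum_(q <- tseq t) F (p.1 * q.1, p.2 * q.2).
Proof.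
move=> bF; have lF := lin_ksum (@lin_id k (ktens H H)) bF.
rewrite (lin_sumE lF); apply: eq_bigr => p _.
by rewrite (lin_sumE lF); apply: eq_bigr => q _; rewrite ksum_kt.
Qed.
Lemma tflip_sum (W : lmodType k) (F : H * H -> W) t : bilin F ->
  \sum_(p <- tseq (tflip t)) F p = \sum_(p <- tseq t) F (p.2, p.1).
Proof. by move=> bF; rewrite /tflip (ksum_sum _ _ _ bF). Qed.
End TensorSquareTheory.

Section HopfTheory.
Variables (k : comUnitRingType) (H : hopfAlgebra k) (V : lmodType k).
Local Notation "'Δ' h" := (tseq (coprod h)) (at level 10).
Local Notation S := (@antipode k H).

Lemma coassoc (F : H -> H -> H -> V) h : trilin F ->
  \sum_(p <- Δ h) \sum_(q <- Δ p.1) F q.1 q.2 p.2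
  = \sum_(p <- Δ h) \sum_(q <- Δ p.2) F p.1 q.1 q.2.
Proof.
move=> tF; have := congr1 (tsum3 F) (coprodA h); rewrite !tsum3_sum //.
under eq_bigr do rewrite tsum3_sum //.
under eq_bigr do under eq_bigr do rewrite tsum3_kkt //.
by under [X in _ = X -> _]eq_bigr do rewrite tsum3_kt //.
Qed.

Lemma counitl (f : H -> V) h : linear f ->
  \sum_(p <- Δ h) counit p.1 *: f p.2 = f h.
Proof.
move=> lf; rewrite -[in RHS](counit_coprodl h) (lin_sumE lf).
by apply: eq_bigr => p _; rewrite (linZ lf).
Qed.
Lemma counitr (f : H -> V) h : linear f ->
  \sum_(p <- Δ h) counit p.2 *: f p.1 = f h.
Proof.
move=> lf; rewrite -[in RHS](counit_coprodr h) (lin_sumE lf).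
by apply: eq_bigr => p _; rewrite (linZ lf).
Qed.
Lemma antipl (f : H -> V) h : linear f ->
  \sum_(p <- Δ h) f (S p.1 * p.2) = counit h *: f 1.
Proof. by move=> lf; rewrite -(linZ lf) -antipodel (lin_sumE lf). Qed.
Lemma antipr (f : H -> V) h : linear f ->
  \sum_(p <- Δ h) f (p.1 * S p.2) = counit h *: f 1.
Proof. by move=> lf; rewrite -(linZ lf) -antipoder (lin_sumE lf). Qed.

Definition quadlin (F : H -> H -> H -> H -> V) :=
  [/\ forall y z w, linear (fun x => F x y z w),
      forall x z w, linear (fun y => F x y z w),
      forall x y w, linear (fun z => F x y z w)
    & forall x y z, linear (fun w => F x y z w)].

Lemma coassoc4 (F : H -> H -> H -> H -> V) h : quadlin F ->
  \sum_(p <- Δ h) \sum_(r <- Δ p.1) \sum_(q <- Δ p.2) F r.1 r.2 q.1 q.2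
  = \sum_(p <- Δ h) \sum_(q <- Δ p.2) \sum_(r <- Δ q.1) F p.1 r.1 r.2 q.2.
Proof.
case=> F1 F2 F3 F4.
rewrite (coassoc (F := fun x y z => \sum_(q <- Δ z) F x y q.1 q.2)); last by tril.
by apply: eq_bigr => p _; rewrite (coassoc (F := fun y z w => F p.1 y z w)).
Qed.

Lemma antip4l (G : H -> H -> H -> V) h : trilin G ->
  \sum_(p <- Δ h) \sum_(r <- Δ p.1) \sum_(q <- Δ p.2) G r.1 (S r.2 * q.1) q.2
  = \sum_(p <- Δ h) G p.1 1 p.2.
Proof.
case=> G1 G2 G3; rewrite (coassoc4 (F := fun x y z w => G x (S y * z) w)).
  apply: eq_bigr => p _; rewrite -[RHS](@counitl (G p.1 1)) //.
  by apply: eq_bigr => q _; rewrite (antipl (f := fun m => G p.1 m q.2)).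
split=> * //.
- by apply: (lin_comp' (G2 _ _)); lin.
- by apply: (lin_comp' (G2 _ _)); lin.
Qed.

Lemma antip4r (G : H -> H -> H -> V) h : trilin G ->
  \sum_(p <- Δ h) \sum_(r <- Δ p.1) \sum_(q <- Δ p.2) G r.1 (r.2 * S q.1) q.2
  = \sum_(p <- Δ h) G p.1 1 p.2.
Proof.
case=> G1 G2 G3; rewrite (coassoc4 (F := fun x y z w => G x (y * S z) w)).
  apply: eq_bigr => p _; rewrite -[RHS](@counitl (G p.1 1)) //.
  by apply: eq_bigr => q _; rewrite (antipr (f := fun m => G p.1 m q.2)).
split=> * //.
- by apply: (lin_comp' (G2 _ _)); lin.
- by apply: (lin_comp' (G2 _ _)); lin.
Qed.

Lemma coprod_mul (F : H * H -> V) g h : bilin F ->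
  \sum_(p <- Δ (g * h)) F p
  = \sum_(p <- Δ g) \sum_(q <- Δ h) F (p.1 * q.1, p.2 * q.2).
Proof. by move=> bF; rewrite coprodM tmul_sum. Qed.
End HopfTheory.

Section AntipodeTheory.
Variables (k : comUnitRingType) (H : hopfAlgebra k).
Local Notation "'Δ' h" := (tseq (coprod h)) (at level 10).
Local Notation S := (@antipode k H).

Lemma antipode1 : S 1 = 1.
Proof.
have := antipodel (1 : H); rewrite coprod1.
rewrite (ksum_kt (F := fun p => S p.1 * p.2)) /= ?mulr1; last by bil.
by rewrite counit1 scale1r.
Qed.

Lemma antipodeM g h : S (g * h) = S h * S g.
Proof.
pose T := \sum_(p <- Δ g) \sum_(q <- Δ h) \sum_(r <- Δ p.2) \sum_(s <- Δ q.2)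
  S (p.1 * q.1) * (r.1 * (s.1 * S s.2) * S r.2).
have -> : S (g * h) = T.
  rewrite -[LHS](counitr (f := fun x => S (x * h))); last by lin.
  apply: eq_bigr => p _.
  rewrite -[in LHS](counitr (f := fun x => S (p.1 * x))); last by lin.
  rewrite scaler_sumr; apply: eq_bigr => q _.
  under eq_bigr => r _.
    rewrite (antipr (f := fun x => S (p.1 * q.1) * (r.1 * x * S r.2))); last by lin.
    rewrite mulr1; over.
  rewrite -scaler_sumr (antipr (f := fun x => S (p.1 * q.1) * x)); last by lin.
  by rewrite mulr1 scalerA mulrC -scalerA.
transitivity (\sum_(p <- Δ g) \sum_(q <- Δ h) counit p.1 *: (counit q.1 *:
   (S q.2 * S p.2))); last first.
  rewrite exchange_big /= -[RHS](counitl (f := fun x => S x * S g)); last by lin.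
  apply: eq_bigr => q _; rewrite -[in RHS](counitl (f := fun x => S q.2 * S x)); last by lin.
  by rewrite scaler_sumr; apply: eq_bigr => p _; rewrite !scalerA mulrC.
rewrite /T.
transitivity (\sum_(q <- Δ h) \sum_(s <- Δ q.2) \sum_(p <- Δ g) \sum_(r <- Δ p.2)
  S (p.1 * q.1) * (r.1 * (s.1 * S s.2) * S r.2)).
  rewrite exchange_big; apply: eq_bigr => q _ /=.
  by rewrite [RHS]exchange_big /=; apply: eq_bigr => p _; rewrite exchange_big.
transitivity (\sum_(q <- Δ h) \sum_(s <- Δ q.2) \sum_(p <- Δ g) \sum_(r <- Δ p.1)
  S (r.1 * q.1) * (r.2 * (s.1 * S s.2) * S p.2)).
  apply: eq_bigr => q _; apply: eq_bigr => s _.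
  rewrite (coassoc (F := fun x y z =>
    S (x * q.1) * (y * (s.1 * S s.2) * S z))) //; last by tril.
rewrite -[LHS](coassoc (F := fun x y z => \sum_(p <- Δ g) \sum_(r <- Δ p.1)
    S (r.1 * x) * (r.2 * (y * S z) * S p.2))); last by tril.
rewrite [RHS]exchange_big /=; apply: eq_bigr => q _.
rewrite exchange_big /=; apply: eq_bigr => p _.
transitivity (\sum_(r <- Δ p.1) \sum_(s <- Δ q.1)
   S (r.1 * s.1) * (r.2 * s.2) * (S q.2 * S p.2)).
  rewrite exchange_big; apply: eq_bigr => r _; apply: eq_bigr => s _ /=.
  by rewrite !mulrA.
rewrite -(coprod_mul (F := fun r => S r.1 * r.2 * (S q.2 * S p.2))); last by bil.
rewrite (antipl (f := fun x => x * (S q.2 * S p.2))); last by lin.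
by rewrite mul1r counitM scalerA.
Qed.

Lemma antipode_inv_linear : linear (@antipode_inv k H).
Proof.
by move=> c x y; apply: (can_inj (@antipodeK k H)); rewrite linearP !antipode_invK.
Qed.

Lemma antipode_invM g h :
  antipode_inv (g * h) = antipode_inv h * antipode_inv g :> H.
Proof.
by apply: (can_inj (@antipodeK k H)); rewrite antipodeM !antipode_invK.
Qed.

Lemma antipode_inv1 : antipode_inv 1 = 1 :> H.
Proof. by rewrite -[in LHS]antipode1 antipodeK. Qed.

Definition coprodS (h : H) : ktens H H := \sum_(p <- Δ h) kt (S p.2) (S p.1).

Lemma coprodS_lin : linear coprodS.
Proof. by apply: lin_ksum; [lin | bil]. Qed.

Lemma coprod_antipodeE h : coprod (S h) = coprodS h.
Proof.
have D1 h' : \sum_(p <- Δ h') tmul (coprod p.1) (coprodS p.2)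
    = counit h' *: kt 1 1.
  transitivity (\sum_(p <- Δ h') \sum_(r <- Δ p.1) \sum_(q <- Δ p.2)
     kt (r.1 * S q.2) (r.2 * S q.1)).
    apply: eq_bigr => p _.
    rewrite /coprodS (lin_sumE (tmul_linr _)).
    transitivity (\sum_(q <- Δ p.2) \sum_(r <- Δ p.1)
      kt (r.1 * S q.2) (r.2 * S q.1)); last by rewrite exchange_big.
    apply: eq_bigr => q _; rewrite {1}(ktE (coprod p.1)) (lin_sumE (tmul_linl _)).
    by apply: eq_bigr => r _; rewrite tmul_kt.
  rewrite (antip4r (G := fun x y z => kt (x * S z) y)); last by tril.
  by rewrite (antipr (f := fun x => kt x 1)) //; lin.
have D2 h' : \sum_(p <- Δ h') tmul (coprod (S p.1)) (coprod p.2)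
    = counit h' *: kt 1 1.
  under eq_bigr do rewrite -coprodM.
  by rewrite (antipl (f := fun x => coprod x)) ?coprod1 //; lin.
transitivity (\sum_(p <- Δ h) \sum_(q <- Δ p.2)
    tmul (tmul (coprod (S p.1)) (coprod q.1)) (coprodS q.2)).
  rewrite -[LHS](counitr (f := fun x => coprod (S x))); last by lin.
  apply: eq_bigr => p _.
  under [RHS]eq_bigr do rewrite -tmulA.
  rewrite -(lin_sumE (tmul_linr _)) D1 (linZ (tmul_linr _)); congr (_ *: _).
  by rewrite tmul1.
have lS := coprodS_lin.
rewrite -(coassoc (F := fun x y z =>
    tmul (tmul (coprod (S x)) (coprod y)) (coprodS z))); last first.
  split=> x y /=.
  - by apply: (lin_comp' (tmul_linl _)); apply: (lin_comp' (tmul_linl _)); lin.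
  - by apply: (lin_comp' (tmul_linl _)); apply: (lin_comp' (tmul_linr _)); lin.
  - by apply: (lin_comp' (tmul_linr _)).
rewrite -[RHS](counitl _ coprodS_lin); apply: eq_bigr => p _.
rewrite /= -(lin_sumE (f := fun s => tmul s (coprodS p.2))); last exact: tmul_linl.
by rewrite D2 (linZ (tmul_linl _)) tmul1l.
Qed.

Variable V : lmodType k.

Lemma coprod_antipode (F : H * H -> V) h : bilin F ->
  \sum_(p <- Δ (S h)) F p = \sum_(p <- Δ h) F (S p.2, S p.1).
Proof. by move=> bF; rewrite coprod_antipodeE (ksum_sum _ _ _ bF). Qed.

Lemma coprod_antipode_inv (F : H * H -> V) h : bilin F ->
  \sum_(p <- Δ (antipode_inv h)) F p
  = \sum_(p <- Δ h) F (antipode_inv p.2, antipode_inv p.1).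
Proof.
move=> bF; have li := antipode_inv_linear.
have lF := bF.1; have lF' := bF.2.
rewrite -[in RHS](antipode_invK h).
rewrite (coprod_antipode (F := fun p => F (antipode_inv p.2, antipode_inv p.1))).
  by apply: eq_bigr => p _ /=; rewrite !antipodeK -surjective_pairing.
split=> x /=.
  by apply: (lin_comp' (lF' _)).
by apply: (lin_comp' (lF _)).
Qed.

Lemma antipil (f : H -> V) h : linear f ->
  \sum_(p <- Δ h) f (p.2 * antipode_inv p.1) = counit h *: f 1.
Proof.
move=> lf; rewrite -(linZ lf) -(lin_sumE lf); congr f.
apply: (can_inj (@antipodeK k H)); rewrite linear_sum linearZ /= antipode1.
rewrite -antipoder; apply: eq_bigr => p _.
by rewrite antipodeM antipode_invK.
Qed.

Lemma antipir (f : H -> V) h : linear f ->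
  \sum_(p <- Δ h) f (antipode_inv p.2 * p.1) = counit h *: f 1.
Proof.
move=> lf; rewrite -(linZ lf) -(lin_sumE lf); congr f.
apply: (can_inj (@antipodeK k H)); rewrite linear_sum linearZ /= antipode1.
rewrite -antipodel; apply: eq_bigr => p _.
by rewrite antipodeM antipode_invK.
Qed.
End AntipodeTheory.

Lemma lin_antipode_inv (k : comUnitRingType) (H : hopfAlgebra k) (V : lmodType k)
  (f : V -> H) : linear f -> linear (fun x => antipode_inv (f x)).
Proof. by apply: lin_comp'; exact: antipode_inv_linear. Qed.

Section TriangularTheory.
Variables (k : comUnitRingType) (H : triangularHopfAlgebra k) (V : lmodType k).
Local Notation "'Δ' h" := (tseq (coprod h)) (at level 10).
Local Notation R := (tseq (rmat H)).
Local Notation R' := (tseq (rmat_inv H)).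

Lemma rmat_invE (F : H * H -> V) : bilin F ->
  \sum_(p <- R') F p = \sum_(p <- R) F (p.2, p.1).
Proof. by move=> bF; rewrite -rmat_triangular tflip_sum. Qed.

Lemma hexl (F : H -> H -> H -> V) : trilin F ->
  \sum_(p <- R') \sum_(q <- Δ p.1) F q.1 q.2 p.2
  = \sum_(p <- R') \sum_(q <- R') F p.1 q.1 (q.2 * p.2).
Proof.
case=> F1 F2 F3; have /(congr1 (tsum3 (fun x y z => F y z x))) := rmat_coprodr H.
have tF : trilin (fun x y z => F y z x) by split.
rewrite !tsum3_sum //.
under eq_bigr do rewrite tsum3_kt //.
under [X in _ = X -> _]eq_bigr => p _.
  rewrite tsum3_sum //; under eq_bigr do rewrite tsum3_kkt //; over.
rewrite (rmat_invE (F := fun p => \sum_(q <- Δ p.1) F q.1 q.2 p.2)); last by bil.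
move=> /= ->.
rewrite (rmat_invE (F := fun p => \sum_(q <- R') F p.1 q.1 (q.2 * p.2))).
  rewrite exchange_big; apply: eq_bigr => p _ /=.
  rewrite (rmat_invE (F := fun q => F p.2 q.1 (q.2 * p.1))) //.
  by bil.
by bil.
Qed.

Lemma hexr (F : H -> H -> H -> V) : trilin F ->
  \sum_(p <- R') \sum_(q <- Δ p.2) F p.1 q.1 q.2
  = \sum_(p <- R') \sum_(q <- R') F (p.1 * q.1) p.2 q.2.
Proof.
case=> F1 F2 F3; have /(congr1 (tsum3 (fun x y z => F z x y))) := rmat_coprodl H.
have tF : trilin (fun x y z => F z x y) by split.
rewrite !tsum3_sum //.
under eq_bigr => p _.
  rewrite tsum3_sum //; under eq_bigr do rewrite tsum3_kkt //; over.
under [X in _ = X -> _]eq_bigr => p _.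
  rewrite tsum3_sum //; under eq_bigr do rewrite tsum3_kkt //; over.
rewrite (rmat_invE (F := fun p => \sum_(q <- Δ p.2) F p.1 q.1 q.2)); last by bil.
move=> /= ->.
rewrite (rmat_invE (F := fun p => \sum_(q <- R') F (p.1 * q.1) p.2 q.2)).
  apply: eq_bigr => p _ /=.
  by rewrite (rmat_invE (F := fun q => F (p.2 * q.1) p.1 q.2)) //; bil.
by bil.
Qed.

Lemma quasi_cocom (F : H * H -> V) h : bilin F ->
  \sum_(p <- Δ h) \sum_(q <- R') F (p.1 * q.1, p.2 * q.2)
  = \sum_(p <- Δ h) \sum_(q <- R') F (q.1 * p.2, q.2 * p.1).
Proof.
move=> bF; have E : tmul (coprod h) (rmat_inv H) =
    tmul (rmat_inv H) (tflip (coprod h)).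
  by rewrite coprod_op !tmulA rmatVl tmul1l.
rewrite -(tmul_sum (coprod h) _ bF) E tmul_sum // [RHS]exchange_big /=.
apply: eq_bigr => q _; rewrite tflip_sum //.
case: bF => F1 F2; split=> x /=.
  by apply: (lin_comp' (F1 _)); lin.
by apply: (lin_comp' (F2 _)); lin.
Qed.

Lemma rmat_tri (F : H * H -> V) : bilin F ->
  \sum_(p <- R') \sum_(q <- R') F (p.1 * q.2, p.2 * q.1) = F (1, 1).
Proof.
move=> bF; rewrite -[RHS]ksum_kt // -(rmatVl H) tmul_sum //.
apply: eq_bigr => p _; rewrite rmat_invE //.
case: bF => F1 F2; split=> x /=.
  by apply: (lin_comp' (F2 _)); lin.
by apply: (lin_comp' (F1 _)); lin.
Qed.
End TriangularTheory.

Record braidedAlgebra (k : comUnitRingType) (H : triangularHopfAlgebra k) :=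
  BraidedAlgebra {
  br_alg :> algType k;
  hact : H -> br_alg -> br_alg;
  hact_linl : forall a, linear (fun h => hact h a);
  hact_linr : forall h, linear (hact h);
  hact1 : forall a, hact 1 a = a;
  hactM : forall g h a, hact (g * h) a = hact g (hact h a);
  hact_unit : forall h, hact h 1 = (counit h)%:A;
  hact_mul : forall h a b,
    hact h (a * b) = \sum_(p <- tseq (coprod h)) hact p.1 a * hact p.2 b;
  braided_comm : forall a b,
    a * b = \sum_(p <- tseq (rmat_inv H)) hact p.1 b * hact p.2 a
}.

Notation "h ▷ a" := (hact h a) (at level 38, right associativity).

Lemma lin_hactl k (H : triangularHopfAlgebra k) (A : braidedAlgebra H)
  (V : lmodType k) (f : V -> H) (a : A) :
  linear f -> linear (fun x => f x ▷ a).
Proof. by move=> lf; exact: (lin_comp' (@hact_linl _ _ A a) lf). Qed.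
Lemma lin_hactr k (H : triangularHopfAlgebra k) (A : braidedAlgebra H)
  (V : lmodType k) (f : V -> A) h :
  linear f -> linear (fun x => h ▷ f x).
Proof. by move=> lf; exact: (lin_comp' (@hact_linr _ _ A h) lf). Qed.

Ltac lin ::= first
  [ exact: lin_id
  | done
  | apply: lin_sum => ?; lin
  | apply: lin_mull; lin
  | apply: lin_mulr; lin
  | apply: lin_hactl; lin
  | apply: lin_hactr; lin
  | apply: lin_antipode_inv; lin
  | apply: lin_scale; lin
  | apply: lin_scalar
  | apply: lin_ktl; lin
  | apply: lin_ktr; lin
  | apply: lin_ksum; [lin | split=> ? /=; lin]
  | apply: lin_comp; lin
  | match goal with F : linear _ |- _ =>
      solve [apply: (lin_comp' F); lin] end
  | match goal with F : forall a b, linear _ |- _ =>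
      solve [apply: (lin_comp' (F _ _)); lin] end
  | match goal with F : forall a, linear _ |- _ =>
      solve [apply: (lin_comp' (F _)); lin] end ].

Section EndoAction.
Variables (k : comUnitRingType) (H : triangularHopfAlgebra k).
Variable A : braidedAlgebra H.
Implicit Types (u v : A -> A) (a b : A) (g h : H).
Local Notation "'Δ' h" := (tseq (coprod h)) (at level 10).
Local Notation S := (@antipode k H).
Local Notation R' := (tseq (rmat_inv H)).

(* (h |> u)(a) = h_(1) |> u (S (h_(2)) |> a) *)
Definition end_act h u a : A := \sum_(p <- Δ h) p.1 ▷ u (S p.2 ▷ a).

Definition is_derivation u : Prop :=
  linear u /\
  forall a b, u (a * b) = u a * b + \sum_(p <- R') (p.1 ▷ a) * end_act p.2 u b.

Lemma end_act_linl u a : linear u -> linear (fun h => end_act h u a).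
Proof. by move=> lu; apply: lin_ksum; [lin | bil]. Qed.

Lemma end_act_linr h u : linear u -> linear (end_act h u).
Proof. by move=> lu; rewrite /end_act; lin. Qed.

Lemma end_act_add h u v (c : k) a :
  end_act h (fun b => c *: u b + v b) a = c *: end_act h u a + end_act h v a.
Proof.
by rewrite scaler_sumr -big_split; apply: eq_bigr => p _; rewrite hact_linr.
Qed.

Lemma end_act_sum h (I : Type) (r : seq I) (u : I -> A -> A) a :
  end_act h (fun b => \sum_(i <- r) u i b) a = \sum_(i <- r) end_act h (u i) a.
Proof.
rewrite exchange_big; apply: eq_bigr => p _.
by rewrite (lin_sumE (@hact_linr _ _ A p.1)).
Qed.

Lemma eq_end_act h u v : u =1 v -> end_act h u =1 end_act h v.
Proof. by move=> uv a; apply: eq_bigr => p _; rewrite uv. Qed.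

Lemma end_act1 u a : linear u -> end_act 1 u a = u a.
Proof.
move=> lu; rewrite /end_act coprod1 (ksum_kt (F := fun p => p.1 ▷ u (S p.2 ▷ a))) /=.
  by rewrite antipode1 !hact1.
by bil.
Qed.

Lemma end_actM g h u a : linear u ->
  end_act (g * h) u a = end_act g (end_act h u) a.
Proof.
move=> lu; rewrite /end_act (coprod_mul (F := fun p => p.1 ▷ u (S p.2 ▷ a))) /=.
  apply: eq_bigr => p _; rewrite (lin_sumE (@hact_linr _ _ A p.1)).
  by apply: eq_bigr => q _; rewrite antipodeM !hactM.
by bil.
Qed.

Lemma hact_end h u a : linear u ->
  h ▷ u a = \sum_(p <- Δ h) end_act p.1 u (p.2 ▷ a).
Proof.
move=> lu; rewrite (coassoc (F := fun x y z => x ▷ u (S y ▷ z ▷ a))); last by tril.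
under eq_bigr => p _.
  under eq_bigr do rewrite -hactM.
  rewrite (antipl (f := fun x => p.1 ▷ u (x ▷ a))) ?hact1; last by lin.
  over.
by rewrite (counitr (f := fun x => x ▷ u a)); last by lin.
Qed.

Lemma end_act_comp h u v a : linear u -> linear v ->
  end_act h (fun b => u (v b)) a
  = \sum_(p <- Δ h) end_act p.1 u (end_act p.2 v a).
Proof.
move=> lu lv; rewrite /end_act.
have lw p1 p2 : linear (fun x => p1 ▷ u (S p2 ▷ x)) by lin.
under [RHS]eq_bigr => p _.
  under eq_bigr => q _.
    rewrite (lin_sumE (lw q.1 q.2)); under eq_bigr do rewrite -hactM.
  over.
over.
rewrite (antip4l (G := fun x m w => x ▷ u (m ▷ v (S w ▷ a)))); last by tril.
by under [RHS]eq_bigr do rewrite hact1.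
Qed.

Lemma end_act_mull h u a b : linear u ->
  end_act h (fun c => a * u c) b = \sum_(p <- Δ h) (p.1 ▷ a) * end_act p.2 u b.
Proof.
move=> lu; rewrite /end_act.
under eq_bigr do rewrite hact_mul.
rewrite (coassoc (F := fun x y z => (x ▷ a) * (y ▷ u (S z ▷ b)))); last by tril.
by apply: eq_bigr => p _; rewrite mulr_sumr.
Qed.

Lemma is_derivation_lin (c : k) u v : is_derivation u -> is_derivation v ->
  is_derivation (fun a => c *: u a + v a).
Proof.
case=> lu du [lv dv]; split=> [d a b|a b].
  by rewrite lu lv !scalerDr !scalerA mulrC addrACA.
rewrite du dv mulrDl -scalerAl.
under [X in _ = _ + X]eq_bigr do rewrite end_act_add mulrDr -scalerAr.
by rewrite big_split -scaler_sumr /= scalerDr addrACA.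
Qed.

Lemma is_derivation0 : is_derivation (fun=> 0).
Proof.
split=> [d a b|a b]; first by rewrite scaler0 addr0.
rewrite mul0r add0r big1 // => p _; rewrite /end_act big1 ?mulr0 // => q _.
by rewrite (lin0 (@hact_linr _ _ A q.1)).
Qed.

Lemma is_derivation_mull a u : is_derivation u ->
  is_derivation (fun b => a * u b).
Proof.
case=> lu du; split=> [|b c]; first by lin.
rewrite du mulrDr mulrA; congr (_ + _).
under [RHS]eq_bigr do rewrite end_act_mull // mulr_sumr.
have le := end_act_linl _ lu.
rewrite (hexr (F := fun x y z => (x ▷ b) * ((y ▷ a) * end_act z u c))); last by tril.
rewrite mulr_sumr exchange_big; apply: eq_bigr => q _ /=.
rewrite mulrA (braided_comm a) mulr_suml; apply: eq_bigr => p _.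
by rewrite hactM mulrA.
Qed.

Lemma is_derivation_act h u : is_derivation u -> is_derivation (end_act h u).
Proof.
case=> lu du; split=> [|a b]; first exact: end_act_linr.
have le := end_act_linl _ lu.
have lr x := end_act_linr x lu.
rewrite {1}/end_act.
under eq_bigr => p _.
  rewrite hact_mul.
  rewrite (coprod_antipode (F := fun q => (q.1 ▷ a) * (q.2 ▷ b))) /=; last by bil.
  rewrite (lin_sumE lu) (lin_sumE (@hact_linr _ _ A p.1)).
  under eq_bigr do rewrite du (linD (@hact_linr _ _ A _)).
  over.
under eq_bigr do rewrite big_split /=.
rewrite big_split /=; congr (_ + _).
  transitivity (\sum_(p <- Δ h) \sum_(s <- Δ p.1) \sum_(q <- Δ p.2)
      (s.1 ▷ u (S q.2 ▷ a)) * ((s.2 * S q.1) ▷ b)).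
    apply: eq_bigr => p _; rewrite exchange_big; apply: eq_bigr => q _ /=.
    by rewrite hact_mul; apply: eq_bigr => s _; rewrite hactM.
  rewrite (antip4r (G := fun x m w => (x ▷ u (S w ▷ a)) * (m ▷ b))); last by tril.
  by rewrite mulr_suml; apply: eq_bigr => p _; rewrite hact1.
transitivity (\sum_(r <- R') \sum_(p <- Δ h) \sum_(s <- Δ p.1) \sum_(q <- Δ p.2)
    (s.1 ▷ r.1 ▷ S q.2 ▷ a) * (s.2 ▷ end_act r.2 u (S q.1 ▷ b))).
  rewrite exchange_big; apply: eq_bigr => p _ /=.
  under [RHS]eq_bigr do rewrite exchange_big /=.
  rewrite [RHS]exchange_big; apply: eq_bigr => q _ /=.
  rewrite (lin_sumE (@hact_linr _ _ A p.1)); apply: eq_bigr => r _.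
  by rewrite hact_mul.
transitivity (\sum_(r <- R') \sum_(p <- Δ h) \sum_(q <- Δ p.1)
    ((q.1 * r.1) ▷ S p.2 ▷ a) * end_act (q.2 * r.2) u b).
  apply: eq_bigr => r _; have lru := lr r.2.
  rewrite (coassoc4 (F := fun x y z w => (x ▷ r.1 ▷ S w ▷ a) *
    (y ▷ end_act r.2 u (S z ▷ b)))); last by split=> * /=; lin.
  rewrite (coassoc (F := fun x y z => ((x * r.1) ▷ S z ▷ a) *
    end_act (y * r.2) u b)); last by tril.
  apply: eq_bigr => p _; apply: eq_bigr => q _.
  by rewrite hactM end_actM // mulr_sumr.
transitivity (\sum_(r <- R') \sum_(p <- Δ h) \sum_(q <- Δ p.1)
    ((r.1 * q.2) ▷ S p.2 ▷ a) * end_act (r.2 * q.1) u b).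
  rewrite exchange_big [RHS]exchange_big; apply: eq_bigr => p _ /=.
  rewrite exchange_big [RHS]exchange_big /=.
  by apply: (quasi_cocom (F := fun q => (q.1 ▷ S p.2 ▷ a) * end_act q.2 u b)); bil.
apply: eq_bigr => r _.
rewrite (coassoc (F := fun x y z => ((r.1 * y) ▷ S z ▷ a) *
    end_act (r.2 * x) u b)); last by tril.
under eq_bigr => p _.
  under eq_bigr do rewrite -hactM -mulrA.
  rewrite (antipr (f := fun x => ((r.1 * x) ▷ a) * end_act (r.2 * p.1) u b)).
    rewrite mulr1; over.
  by lin.
rewrite (counitr (f := fun x => (r.1 ▷ a) * end_act (r.2 * x) u b)); last by lin.
by rewrite end_actM.
Qed.

(* (u a)(b), where u a = (R^-1_1 |> a) (R^-1_2 |> u) *)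
Definition end_mulr u a b : A := \sum_(p <- R') (p.1 ▷ a) * end_act p.2 u b.

Lemma is_derivation_sum (I : Type) (r : seq I) (u : I -> A -> A) :
  (forall i, is_derivation (u i)) -> is_derivation (fun a => \sum_(i <- r) u i a).
Proof.
move=> du; elim: r => [|i r IH].
  have -> : (fun a => \sum_(i <- [::]) u i a) = fun=> 0.
    by apply: funext => a; rewrite big_nil.
  exact: is_derivation0.
have -> : (fun a => \sum_(j <- i :: r) u j a) =
    fun a => 1 *: u i a + \sum_(j <- r) u j a.
  by apply: funext => a; rewrite big_cons scale1r.
exact: is_derivation_lin.
Qed.

Lemma is_derivation_mulr u a : is_derivation u -> is_derivation (end_mulr u a).
Proof.
move=> du; apply: is_derivation_sum => p.
by apply: is_derivation_mull; exact: is_derivation_act.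
Qed.

Definition end_bracket u v a : A :=
  u (v a) - \sum_(p <- R') end_act p.1 v (end_act p.2 u a).

Lemma is_derivation_bracket u v :
  is_derivation u -> is_derivation v -> is_derivation (end_bracket u v).
Proof.
move=> du dv; have [lu Lu] := du; have [lv Lv] := dv.
have eu := end_act_linl _ lu; have eu' x := end_act_linr x lu.
have ev := end_act_linl _ lv; have ev' x := end_act_linr x lv.
split=> [|a b].
  have lw : linear (fun a => \sum_(p <- R') end_act p.1 v (end_act p.2 u a)).
    apply: lin_sum => p; exact: (lin_comp' (ev' _)).
  move=> c a b; rewrite /end_bracket lw lv lu scalerBr.
  by rewrite opprD addrACA.
have Lev x : is_derivation (end_act x v) by exact: is_derivation_act.
have Leu x : is_derivation (end_act x u) by exact: is_derivation_act.
have E u' v' : is_derivation u' -> is_derivation v' ->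
  u' (v' (a * b)) = u' (v' a) * b
    + \sum_(p <- R') (p.1 ▷ v' a) * end_act p.2 u' b
    + \sum_(p <- R') u' (p.1 ▷ a) * end_act p.2 v' b
    + \sum_(p <- R') (p.1 ▷ a) * end_act p.2 (fun c => u' (v' c)) b.
  move=> [lu1 Lu1] [lv1 Lv1]; rewrite Lv1 (linD lu1) Lu1 -!addrA; congr (_ + (_ + _)).
  rewrite (lin_sumE lu1).
  under eq_bigr do rewrite Lu1.
  rewrite big_split; congr (_ + _) => /=.
  have eu1 := end_act_linl _ lu1; have ev1 := end_act_linl _ lv1.
  have eu2 x := end_act_linr x lu1; have ev2 x := end_act_linr x lv1.
  under [RHS]eq_bigr do rewrite end_act_comp // mulr_sumr.
  rewrite (hexr (F := fun x y z => (x ▷ a) * end_act y u' (end_act z v' b))).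
    rewrite exchange_big /=; apply: eq_bigr => p _; apply: eq_bigr => q _.
    by rewrite hactM.
  by tril.
have E2 : \sum_(p <- R') end_act p.1 v (end_act p.2 u (a * b)) =
    \sum_(p <- R') end_act p.1 v (end_act p.2 u a) * b
    + \sum_(r <- R') \sum_(p <- R')
        (p.1 ▷ end_act r.2 u a) * end_act p.2 (end_act r.1 v) b
    + \sum_(r <- R') \sum_(p <- R')
        end_act r.1 v (p.1 ▷ a) * end_act p.2 (end_act r.2 u) b
    + \sum_(p <- R') (p.1 ▷ a) * end_act p.2
        (fun c => \sum_(r <- R') end_act r.1 v (end_act r.2 u c)) b.
  under eq_bigr => p _ do rewrite (E (end_act p.1 v) (end_act p.2 u)) //.
  rewrite !big_split /=; congr (_ + _ + _ + _).
  rewrite exchange_big; apply: eq_bigr => p _ /=.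
  by rewrite end_act_sum mulr_sumr.
have E3 : \sum_(r <- R') \sum_(p <- R')
        end_act r.1 v (p.1 ▷ a) * end_act p.2 (end_act r.2 u) b
    = \sum_(p <- R') (p.1 ▷ v a) * end_act p.2 u b.
  under [RHS]eq_bigr do rewrite hact_end // mulr_suml.
  rewrite (hexl (F := fun x y z => end_act x v (y ▷ a) * end_act z u b)).
    by apply: eq_bigr => r _; apply: eq_bigr => p _; rewrite end_actM.
  by tril.
have E4 : \sum_(r <- R') \sum_(p <- R')
        (p.1 ▷ end_act r.2 u a) * end_act p.2 (end_act r.1 v) b
    = \sum_(p <- R') u (p.1 ▷ a) * end_act p.2 v b.
  transitivity (\sum_(r <- R') \sum_(p <- R') \sum_(q <- R')
      end_act (p.1 * r.2) u (q.1 ▷ a) * end_act (q.2 * (p.2 * r.1)) v b).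
    apply: eq_bigr => r _.
    transitivity (\sum_(p <- R') \sum_(q <- Δ p.1)
       end_act q.1 (end_act r.2 u) (q.2 ▷ a) * end_act p.2 (end_act r.1 v) b).
      by apply: eq_bigr => p _; rewrite hact_end // mulr_suml.
    have e1 := end_act_linl _ (eu' r.2); have e2 x := end_act_linr x (eu' r.2).
    have e3 := end_act_linl _ (ev' r.1).
    rewrite (hexl (F := fun x y z =>
      end_act x (end_act r.2 u) (y ▷ a) * end_act z (end_act r.1 v) b)).
      apply: eq_bigr => p _; apply: eq_bigr => q _.
      by rewrite -!end_actM // mulrA.
    by tril.
  transitivity (\sum_(q <- R') \sum_(p <- R') \sum_(r <- R')
      end_act (p.1 * r.2) u (q.1 ▷ a) * end_act (q.2 * (p.2 * r.1)) v b).
    under eq_bigr do rewrite exchange_big /=.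
    rewrite exchange_big; apply: eq_bigr => q _ /=; exact: exchange_big.
  apply: eq_bigr => q _.
  rewrite (rmat_tri (F := fun p => end_act p.1 u (q.1 ▷ a) *
     end_act (q.2 * p.2) v b)) /=; last by bil.
  by rewrite mulr1 end_act1.
have E5 : \sum_(p <- R') (p.1 ▷ a) * end_act p.2 (end_bracket u v) b =
   \sum_(p <- R') (p.1 ▷ a) * end_act p.2 (fun c => u (v c)) b
   - \sum_(p <- R') (p.1 ▷ a) * end_act p.2
        (fun c => \sum_(r <- R') end_act r.1 v (end_act r.2 u c)) b.
  rewrite -sumrB; apply: eq_bigr => p _; rewrite -mulrBr; congr (_ * _).
  rewrite /end_bracket -sumrB; apply: eq_bigr => q _.
  by rewrite -(linB (@hact_linr _ _ A _)).
rewrite {1}/end_bracket (E u v) // E2 E3 E4 E5 {1}/end_bracket mulrBl mulr_suml.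
set x1 := u (v a) * b; set x2 := \sum_(p <- R') _ * b.
set y1 := \sum_(p <- R') (p.1 ▷ v a) * _; set y2 := \sum_(p <- R') u _ * _.
set z1 := \sum_(p <- R') _; set z2 := \sum_(p <- R') _.
rewrite !opprD !addrA.
congr (_ - _).
by rewrite (ACl (1 * 5 * 4 * (3 * 6) * (2 * 7)))%AC /= !subrr !addr0.
Qed.

End EndoAction.

Section VectorFields.
Variables (k : comUnitRingType) (H : triangularHopfAlgebra k).
Variable A : braidedAlgebra H.
Local Notation "'Δ' h" := (tseq (coprod h)) (at level 10).
Local Notation S := (@antipode k H).
Local Notation S' := (@antipode_inv k H).
Local Notation R' := (tseq (rmat_inv H)).

Lemma rmat_counit (V : lmodType k) (f : H -> V) : linear f ->
  \sum_(p <- R') counit p.1 *: f p.2 = f 1.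
Proof.
move=> lf; pose e := \sum_(p <- R') counit p.1 *: p.2.
pose e2 := \sum_(p <- R') counit p.2 *: p.1.
have ee : e * e = e.
  rewrite {3}/e.
  under [RHS]eq_bigr => p _.
    rewrite -[in counit _](counit_coprodl p.1) linear_sum scaler_suml.
    under eq_bigr do rewrite linearZ /= -scalerA.
    over.
  rewrite (hexl (F := fun x y z => counit x *: (counit y *: z))); last by tril.
  rewrite mulr_suml exchange_big /=; apply: eq_bigr => q _.
  rewrite /e mulr_sumr; apply: eq_bigr => p _.
  by rewrite -scalerAl -scalerAr !scalerA mulrC.
have ee2 : e * e2 = 1.
  have := rmat_tri (H := H) (F := fun p => counit p.1 *: p.2).
  rewrite /= counit1 scale1r => <-; last first.
    by bil.
  rewrite mulr_suml; apply: eq_bigr => p _; rewrite mulr_sumr.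
  apply: eq_bigr => q _.
  by rewrite counitM -scalerAl -scalerAr scalerA.
have e1 : e = 1 by rewrite -ee2 -{2}ee -mulrA ee2 mulr1.
rewrite -[in RHS]e1 (lin_sumE lf); apply: eq_bigr => p _.
by rewrite (linZ lf).
Qed.

Record vfield := VField { vf_val :> A -> A; _ : `[< is_derivation vf_val >] }.
HB.instance Definition _ := [isSub for vf_val].
HB.instance Definition _ := [Choice of vfield by <:].

Implicit Types (u v : vfield) (a b : A) (g h : H).

Lemma vfP u : is_derivation u.
Proof. by case: u => f /= /asboolP. Qed.
Lemma vf_lin u : linear u.
Proof. by case: (vfP u). Qed.
Lemma vf_eq u v : u =1 v -> u = v.
Proof. by move=> uv; apply: val_inj; apply: funext. Qed.

Definition vfield_of (f : A -> A) (df : is_derivation f) : vfield :=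
  VField (asboolT df).

Lemma vf_add_subproof u v : is_derivation (fun a => u a + v a).
Proof.
have -> : (fun a => u a + v a) = fun a => 1 *: u a + v a.
  by apply: funext => a; rewrite scale1r.
by apply: is_derivation_lin; exact: vfP.
Qed.
Lemma vf_opp_subproof u : is_derivation (fun a => - u a).
Proof.
have -> : (fun a => - u a) = fun a => - 1 *: u a + 0.
  by apply: funext => a; rewrite scaleN1r addr0.
by apply: is_derivation_lin; [exact: vfP | exact: is_derivation0].
Qed.
Definition vf_add u v := vfield_of (vf_add_subproof u v).
Definition vf_opp u := vfield_of (vf_opp_subproof u).
Definition vf_zero := vfield_of (@is_derivation0 k H A).
Definition vf_scale a u := vfield_of (is_derivation_mull a (vfP u)).

Lemma vf_addA : associative vf_add.
Proof. by move=> u v w; apply: vf_eq => a /=; rewrite addrA. Qed.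
Lemma vf_addC : commutative vf_add.
Proof. by move=> u v; apply: vf_eq => a /=; rewrite addrC. Qed.
Lemma vf_add0 : left_id vf_zero vf_add.
Proof. by move=> u; apply: vf_eq => a /=; rewrite add0r. Qed.
Lemma vf_addN : left_inverse vf_zero vf_opp vf_add.
Proof. by move=> u; apply: vf_eq => a /=; rewrite addNr. Qed.
HB.instance Definition _ :=
  GRing.isZmodule.Build vfield vf_addA vf_addC vf_add0 vf_addN.

Lemma vf_scaleA a b u : vf_scale a (vf_scale b u) = vf_scale (a * b) u.
Proof. by apply: vf_eq => c /=; rewrite mulrA. Qed.
Lemma vf_scale1 : left_id 1 vf_scale.
Proof. by move=> u; apply: vf_eq => c /=; rewrite mul1r. Qed.
Lemma vf_scaleDr : right_distributive vf_scale +%R.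
Proof. by move=> a u v; apply: vf_eq => c /=; rewrite mulrDr. Qed.
Lemma vf_scaleDl u : {morph vf_scale^~ u : a b / a + b}.
Proof. by move=> a b; apply: vf_eq => c /=; rewrite mulrDl. Qed.
HB.instance Definition _ := GRing.Zmodule_isLmodule.Build A vfield
  vf_scaleA vf_scale1 vf_scaleDr vf_scaleDl.

Definition vf_mulr u a := vfield_of (is_derivation_mulr a (vfP u)).
Definition vf_act h u := vfield_of (is_derivation_act h (vfP u)).
Definition bracket u v := vfield_of (is_derivation_bracket (vfP u) (vfP v)).

Lemma vf_addE u v a : (u + v) a = u a + v a. Proof. by []. Qed.
Lemma vf_scaleE b u a : (b *: u) a = b * u a. Proof. by []. Qed.
Lemma vf_sumE (I : Type) (r : seq I) (u : I -> vfield) a :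
  (\sum_(i <- r) u i) a = \sum_(i <- r) u i a.
Proof. by apply: (big_morph (fun v : vfield => v a)). Qed.

Lemma vf_mulrE u a : vf_mulr u a = \sum_(p <- R') (p.1 ▷ a) *: vf_act p.2 u.
Proof. by apply: vf_eq => b; rewrite vf_sumE. Qed.

Lemma vf_mulrDl u v a : vf_mulr (u + v) a = vf_mulr u a + vf_mulr v a.
Proof.
apply: vf_eq => b; rewrite vf_addE -big_split; apply: eq_bigr => p _ /=.
rewrite -mulrDr; congr (_ * _); have := end_act_add p.2 u v 1 b.
rewrite scale1r => <-; apply: eq_end_act => c; by rewrite scale1r.
Qed.
Lemma vf_mulrDr u a b : vf_mulr u (a + b) = vf_mulr u a + vf_mulr u b.
Proof.
apply: vf_eq => c; rewrite vf_addE -big_split; apply: eq_bigr => p _ /=.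
by rewrite (linD (@hact_linr _ _ A p.1)) mulrDl.
Qed.
Lemma vf_mulr_lin u c a b :
  vf_mulr u (c *: a + b) = c%:A *: vf_mulr u a + vf_mulr u b.
Proof.
rewrite vf_mulrDr; congr (_ + _); apply: vf_eq => x.
rewrite vf_scaleE /= /end_mulr mulr_sumr; apply: eq_bigr => p _.
by rewrite (linZ (@hact_linr _ _ A p.1)) -!scalerAl mul1r.
Qed.
Lemma vf_mulr1 u : vf_mulr u 1 = u.
Proof.
have eu a := end_act_linl a (vf_lin u).
apply: vf_eq => b /=; rewrite -[RHS](end_act1 _ (vf_lin u)).
rewrite -(rmat_counit (eu b)); apply: eq_bigr => p _.
by rewrite hact_unit -scalerAl mul1r.
Qed.
Lemma vf_mulrZ a u b : vf_mulr (a *: u) b = a *: vf_mulr u b.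
Proof.
have eu c := end_act_linl c (vf_lin u).
apply: vf_eq => c; rewrite vf_scaleE /= /end_mulr mulr_sumr.
under eq_bigr do rewrite (end_act_mull _ _ _ (vf_lin u)) mulr_sumr.
rewrite (hexr (F := fun x y z => (x ▷ b) * ((y ▷ a) * end_act z u c))); last by tril.
rewrite exchange_big; apply: eq_bigr => q _ /=.
rewrite mulrA (braided_comm a) mulr_suml; apply: eq_bigr => p _.
by rewrite hactM mulrA.
Qed.
Lemma vf_mulrA u a b : vf_mulr u (a * b) = vf_mulr (vf_mulr u a) b.
Proof.
have eu c := end_act_linl c (vf_lin u).
rewrite [in RHS](vf_mulrE u a); apply: vf_eq => c.
have -> : vf_mulr (\sum_(p <- R') (p.1 ▷ a) *: vf_act p.2 u) b
    = \sum_(p <- R') (p.1 ▷ a) *: vf_mulr (vf_act p.2 u) b.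
  rewrite (big_morph (vf_mulr^~ b) (fun u v => vf_mulrDl u v b) (id1 := 0)).
    by apply: eq_bigr => p _; rewrite vf_mulrZ.
  by apply: (addrI (vf_mulr 0 b)); rewrite -vf_mulrDl !addr0.
rewrite vf_sumE /= /end_mulr.
transitivity (\sum_(p <- R') \sum_(q <- Δ p.1)
    (q.1 ▷ a) * (q.2 ▷ b) * end_act p.2 u c).
  by apply: eq_bigr => p _; rewrite hact_mul mulr_suml.
rewrite (hexl (F := fun x y z => (x ▷ a) * (y ▷ b) * end_act z u c)); last by tril.
apply: eq_bigr => p _; rewrite mulr_sumr; apply: eq_bigr => q _.
by rewrite mulrA (end_actM _ _ _ (vf_lin u)).
Qed.

Lemma vf_act_scale h a u :
  vf_act h (a *: u) = \sum_(p <- Δ h) (p.1 ▷ a) *: vf_act p.2 u.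
Proof.
by apply: vf_eq => b; rewrite vf_sumE /= (end_act_mull _ _ _ (vf_lin u)).
Qed.
Lemma vf_act_add h u v : vf_act h (u + v) = vf_act h u + vf_act h v.
Proof.
apply: vf_eq => b; rewrite vf_addE /=; have := end_act_add h u v 1 b.
rewrite scale1r => <-; apply: eq_end_act => c; by rewrite scale1r.
Qed.
Lemma vf_act_linl c g h u :
  vf_act (c *: g + h) u = c%:A *: vf_act g u + vf_act h u.
Proof.
apply: vf_eq => b; rewrite vf_addE vf_scaleE /= -scalerAl mul1r.
exact: (end_act_linl b (vf_lin u)).
Qed.
Lemma vf_act1 u : vf_act 1 u = u.
Proof. by apply: vf_eq => b /=; rewrite (end_act1 _ (vf_lin u)). Qed.
Lemma vf_actM g h u : vf_act (g * h) u = vf_act g (vf_act h u).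
Proof. by apply: vf_eq => b /=; rewrite (end_actM _ _ _ (vf_lin u)). Qed.

Lemma vf_act_mulr h u a :
  vf_act h (vf_mulr u a) = \sum_(p <- Δ h) vf_mulr (vf_act p.1 u) (p.2 ▷ a).
Proof.
have eu c := end_act_linl c (vf_lin u).
apply: vf_eq => b; rewrite vf_sumE /= /end_mulr end_act_sum.
transitivity (\sum_(p <- Δ h) \sum_(r <- R')
   ((p.1 * r.1) ▷ a) * end_act (p.2 * r.2) u b).
  rewrite [RHS]exchange_big; apply: eq_bigr => r _ /=.
  rewrite (end_act_mull _ _ _ (end_act_linr _ (vf_lin u))).
  by apply: eq_bigr => p _; rewrite hactM (end_actM _ _ _ (vf_lin u)).
rewrite (quasi_cocom (F := fun q => (q.1 ▷ a) * end_act q.2 u b)); last by bil.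
apply: eq_bigr => p _; apply: eq_bigr => r _.
by rewrite hactM (end_actM _ _ _ (vf_lin u)).
Qed.

Record coform :=
  CoForm { cf_val :> vfield -> A; _ : `[< scalar cf_val >] }.
HB.instance Definition _ := [isSub for cf_val].
HB.instance Definition _ := [Choice of coform by <:].

Implicit Types w t : coform.

Lemma cfP w : scalar w.
Proof. by case: w => f /= /asboolP. Qed.
Lemma cf_eq w t : w =1 t -> w = t.
Proof. by move=> wt; apply: val_inj; apply: funext. Qed.
Lemma cfD w u v : w (u + v) = w u + w v.
Proof. by have := cfP w 1 u v; rewrite scale1r mul1r. Qed.
Lemma cf0 w : w 0 = 0.
Proof. by apply: (addrI (w 0)); rewrite -cfD !addr0. Qed.
Lemma cfZ w a u : w (a *: u) = a * w u.
Proof. by have := cfP w a u 0; rewrite cf0 !addr0. Qed.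
Lemma cf_sum w (I : Type) (r : seq I) (u : I -> vfield) :
  w (\sum_(i <- r) u i) = \sum_(i <- r) w (u i).
Proof. by apply: big_morph; [exact: cfD | exact: cf0]. Qed.

Definition coform_of (f : vfield -> A) (lf : scalar f) : coform :=
  CoForm (asboolT lf).

Lemma cf_add_subproof w t : scalar (fun u => w u + t u).
Proof. by move=> a u v; rewrite !cfP mulrDr addrACA. Qed.
Lemma cf_opp_subproof w : scalar (fun u => - w u).
Proof. by move=> a u v; rewrite !cfP opprD mulrN. Qed.
Lemma cf_zero_subproof : scalar (fun _ : vfield => 0 : A).
Proof. by move=> a u v; rewrite mulr0 addr0. Qed.
Lemma cf_scale_subproof a w : scalar (fun u => w (vf_mulr u a)).
Proof. by move=> b u v; rewrite vf_mulrDl vf_mulrZ cfP. Qed.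
Lemma cf_mulr_subproof w a : scalar (fun u => w u * a).
Proof. by move=> b u v; rewrite cfP mulrDl mulrA. Qed.
Lemma cf_act_linl w u : linear (fun h => w (vf_act h u)).
Proof. by move=> c g h; rewrite vf_act_linl cfP -scalerAl mul1r. Qed.
Lemma cf_act_subproof h w :
  scalar (fun u => \sum_(p <- Δ h) p.2 ▷ w (vf_act (S' p.1) u)).
Proof.
move=> a u v.
have -> : \sum_(p <- Δ h) p.2 ▷ w (vf_act (S' p.1) (a *: u + v))
    = \sum_(p <- Δ h) p.2 ▷ w (vf_act (S' p.1) (a *: u))
    + \sum_(p <- Δ h) p.2 ▷ w (vf_act (S' p.1) v).
  rewrite -big_split; apply: eq_bigr => p _ /=.
  by rewrite vf_act_add cfD (linD (@hact_linr _ _ A p.2)).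
congr (_ + _).
have lw := cf_act_linl w u.
transitivity (\sum_(p <- Δ h) \sum_(q <- Δ p.1) \sum_(r <- Δ p.2)
    (r.1 ▷ S' q.2 ▷ a) * (r.2 ▷ w (vf_act (S' q.1) u))).
  apply: eq_bigr => p _; rewrite vf_act_scale cf_sum.
  under eq_bigr do rewrite cfZ.
  rewrite (coprod_antipode_inv
    (F := fun q => (q.1 ▷ a) * w (vf_act q.2 u))); last by bil.
  rewrite (lin_sumE (@hact_linr _ _ A p.2)); apply: eq_bigr => q _ /=.
  by rewrite hact_mul.
rewrite (coassoc4 (F := fun x y z s =>
  (z ▷ S' y ▷ a) * (s ▷ w (vf_act (S' x) u)))); last by split=> * /=; lin.
rewrite mulr_sumr; apply: eq_bigr => p _.
transitivity (\sum_(q <- Δ p.2)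
   counit q.1 *: (a * (q.2 ▷ w (vf_act (S' p.1) u)))).
  apply: eq_bigr => q _; under eq_bigr do rewrite -hactM.
  rewrite (antipil (f := fun x => (x ▷ a) * (q.2 ▷ w (vf_act (S' p.1) u)))).
    by rewrite hact1.
  by lin.
by rewrite (counitl (f := fun x => a * (x ▷ w (vf_act (S' p.1) u)))) //; lin.
Qed.

(* The left and right A-actions and the H-action on forms are                 *)
(* (a w)(u) = w (u a), (w a)(u) = w(u) a and                                  *)
(* (h |> w)(u) = h_(2) |> w (S^-1 (h_(1)) |> u).                              *)
Definition cf_add w t := coform_of (cf_add_subproof w t).
Definition cf_opp w := coform_of (cf_opp_subproof w).
Definition cf_zero := coform_of cf_zero_subproof.
Definition cf_scale a w := coform_of (cf_scale_subproof a w).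

Lemma cf_addA : associative cf_add.
Proof. by move=> u v w; apply: cf_eq => a /=; rewrite addrA. Qed.
Lemma cf_addC : commutative cf_add.
Proof. by move=> u v; apply: cf_eq => a /=; rewrite addrC. Qed.
Lemma cf_add0 : left_id cf_zero cf_add.
Proof. by move=> u; apply: cf_eq => a /=; rewrite add0r. Qed.
Lemma cf_addN : left_inverse cf_zero cf_opp cf_add.
Proof. by move=> u; apply: cf_eq => a /=; rewrite addNr. Qed.
HB.instance Definition _ :=
  GRing.isZmodule.Build coform cf_addA cf_addC cf_add0 cf_addN.

Lemma cf_scaleA a b w : cf_scale a (cf_scale b w) = cf_scale (a * b) w.
Proof. by apply: cf_eq => c /=; rewrite vf_mulrA. Qed.
Lemma cf_scale1 : left_id 1 cf_scale.
Proof. by move=> u; apply: cf_eq => c /=; rewrite vf_mulr1. Qed.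
Lemma cf_scaleDr : right_distributive cf_scale +%R.
Proof. by move=> a w t; apply: cf_eq. Qed.
Lemma cf_scaleDl w : {morph cf_scale^~ w : a b / a + b}.
Proof. by move=> a b; apply: cf_eq => c /=; rewrite vf_mulrDr cfD. Qed.
HB.instance Definition _ := GRing.Zmodule_isLmodule.Build A coform
  cf_scaleA cf_scale1 cf_scaleDr cf_scaleDl.

Definition cf_mulr w a := coform_of (cf_mulr_subproof w a).
Definition cf_act h w := coform_of (cf_act_subproof h w).

Lemma differential_subproof a : scalar (fun u : vfield => u a).
Proof. by []. Qed.
Definition differential a := coform_of (differential_subproof a).

Lemma cf_scaleE a w u : (a *: w) u = w (vf_mulr u a). Proof. by []. Qed.
Lemma cf_addE w t u : (w + t) u = w u + t u. Proof. by []. Qed.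
Lemma cf_sumE (I : Type) (r : seq I) (w : I -> coform) u :
  (\sum_(i <- r) w i) u = \sum_(i <- r) w i u.
Proof. by apply: (big_morph (fun t : coform => t u)). Qed.

Lemma cf_act_add h w t : cf_act h (w + t) = cf_act h w + cf_act h t.
Proof.
apply: cf_eq => u; rewrite cf_addE /= -big_split; apply: eq_bigr => p _ /=.
by rewrite (linD (@hact_linr _ _ A p.2)).
Qed.

Lemma cf_act_scale h a w :
  cf_act h (a *: w) = \sum_(p <- Δ h) (p.1 ▷ a) *: cf_act p.2 w.
Proof.
apply: cf_eq => u; rewrite cf_sumE.
under [RHS]eq_bigr do rewrite cf_scaleE /=.
have lw x : linear (fun g => w (vf_mulr (vf_act g u) x)).
  by move=> c g g'; rewrite vf_act_linl vf_mulrDl vf_mulrZ cfP -scalerAl mul1r.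
have lw' v : linear (fun x => w (vf_mulr v x)).
  by move=> c x y; rewrite vf_mulr_lin cfP -scalerAl mul1r.
transitivity (\sum_(p <- Δ h) \sum_(r <- Δ p.1) \sum_(q <- Δ p.2)
   q.2 ▷ w (vf_mulr (vf_act (S' q.1) u) (S' r.2 ▷ r.1 ▷ a))); last first.
  rewrite (coassoc4 (F := fun x y z s =>
    s ▷ w (vf_mulr (vf_act (S' z) u) (S' y ▷ x ▷ a)))); last by split=> * /=; lin.
  apply: eq_bigr => p _; apply: eq_bigr => q _.
  rewrite vf_act_mulr cf_sum.
  rewrite (coprod_antipode_inv (F := fun r =>
    w (vf_mulr (vf_act r.1 u) (r.2 ▷ p.1 ▷ a)))); last by bil.
  by rewrite (lin_sumE (@hact_linr _ _ A q.2)).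
rewrite /= -[LHS](counitl (f := fun x =>
  \sum_(q <- Δ x) q.2 ▷ w (vf_mulr (vf_act (S' q.1) u) a))); last by lin.
apply: eq_bigr => p _; rewrite exchange_big scaler_sumr; apply: eq_bigr => q _ /=.
under [RHS]eq_bigr do rewrite -hactM.
rewrite (antipir (f := fun x =>
  q.2 ▷ w (vf_mulr (vf_act (S' q.1) u) (x ▷ a)))) ?hact1 //.
by lin.
Qed.

Lemma cf_act_differential h a :
  cf_act h (differential a) = differential (h ▷ a).
Proof.
have eu (u : vfield) c := end_act_linl c (vf_lin u).
apply: cf_eq => u /=.
under eq_bigr do rewrite (hact_end _ _ (end_act_linr _ (vf_lin u))).
rewrite -(coassoc (F := fun x y z => end_act y (end_act (S' x) u) (z ▷ a))).
  under eq_bigr => p _.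
    under eq_bigr do rewrite -(end_actM _ _ _ (vf_lin u)).
    rewrite (antipil (f := fun x => end_act x u (p.2 ▷ a))); last exact: eu.
    rewrite end_act1; last exact: vf_lin.
    over.
  by rewrite (counitl (f := fun x => u (x ▷ a))) //; have lu := vf_lin u; lin.
have e1 x := end_act_linr x (vf_lin u).
by tril.
Qed.


Definition in_AdA w : Prop :=
  exists s : seq (A * A), w = \sum_(p <- s) p.1 *: differential p.2.

Record oneform := OneForm { of_val :> coform; _ : `[< in_AdA of_val >] }.
HB.instance Definition _ := [isSub for of_val].
HB.instance Definition _ := [Choice of oneform by <:].

Lemma in_AdA_add w t : in_AdA w -> in_AdA t -> in_AdA (w + t).
Proof. by move=> [r ->] [s ->]; exists (r ++ s); rewrite big_cat. Qed.
Lemma in_AdA0 : in_AdA 0.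
Proof. by exists [::]; rewrite big_nil. Qed.
Lemma in_AdA_sum (I : Type) (r : seq I) (w : I -> coform) :
  (forall i, in_AdA (w i)) -> in_AdA (\sum_(i <- r) w i).
Proof.
move=> Aw; apply: big_ind => //; [exact: in_AdA0 | exact: in_AdA_add].
Qed.
Lemma in_AdA_scale a w : in_AdA w -> in_AdA (a *: w).
Proof.
move=> [s ->]; exists [seq (a * p.1, p.2) | p <- s].
by rewrite big_map scaler_sumr; apply: eq_bigr => p _; rewrite scalerA.
Qed.
Lemma in_AdA_opp w : in_AdA w -> in_AdA (- w).
Proof. by rewrite -scaleN1r; exact: in_AdA_scale. Qed.
Lemma in_AdA_d a : in_AdA (differential a).
Proof. by exists [:: (1, a)]; rewrite big_seq1 scale1r. Qed.

Lemma differential_mul a b :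
  cf_mulr (differential a) b = differential (a * b) - a *: differential b.
Proof.
apply: cf_eq => u; rewrite cf_addE /= (vfP u).2.
by rewrite addrK.
Qed.

Lemma in_AdA_mulr w a : in_AdA w -> in_AdA (cf_mulr w a).
Proof.
move=> [s ->].
have -> : cf_mulr (\sum_(p <- s) p.1 *: differential p.2) a
    = \sum_(p <- s) p.1 *: cf_mulr (differential p.2) a.
  by apply: cf_eq => u; rewrite /= !cf_sumE mulr_suml.
apply: in_AdA_sum => p; apply: in_AdA_scale; rewrite differential_mul.
apply: in_AdA_add; first exact: in_AdA_d.
by apply: in_AdA_opp; apply: in_AdA_scale; exact: in_AdA_d.
Qed.

Lemma in_AdA_act h w : in_AdA w -> in_AdA (cf_act h w).
Proof.
move=> [s ->].
have -> : cf_act h (\sum_(p <- s) p.1 *: differential p.2)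
    = \sum_(p <- s) cf_act h (p.1 *: differential p.2).
  apply: (big_morph (cf_act h) (cf_act_add h)).
  by apply: (addrI (cf_act h 0)); rewrite -cf_act_add !addr0.
apply: in_AdA_sum => p; rewrite cf_act_scale; apply: in_AdA_sum => q.
by apply: in_AdA_scale; rewrite cf_act_differential; exact: in_AdA_d.
Qed.

Implicit Types om th : oneform.
Lemma ofP om : in_AdA om.
Proof. by case: om => w /= /asboolP. Qed.
Definition oneform_of w (Aw : in_AdA w) : oneform := OneForm (asboolT Aw).

Definition of_add om th := oneform_of (in_AdA_add (ofP om) (ofP th)).
Definition of_opp om := oneform_of (in_AdA_opp (ofP om)).
Definition of_zero := oneform_of in_AdA0.
Definition of_scale a om := oneform_of (in_AdA_scale a (ofP om)).
Definition of_mulr om a := oneform_of (in_AdA_mulr a (ofP om)).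
Definition of_act h om := oneform_of (in_AdA_act h (ofP om)).
Definition of_d a := oneform_of (in_AdA_d a).

Lemma of_addA : associative of_add.
Proof. by move=> u v w; apply: val_inj; rewrite /= addrA. Qed.
Lemma of_addC : commutative of_add.
Proof. by move=> u v; apply: val_inj; rewrite /= addrC. Qed.
Lemma of_add0 : left_id of_zero of_add.
Proof. by move=> u; apply: val_inj; rewrite /= add0r. Qed.
Lemma of_addN : left_inverse of_zero of_opp of_add.
Proof. by move=> u; apply: val_inj; rewrite /= addNr. Qed.
HB.instance Definition _ :=
  GRing.isZmodule.Build oneform of_addA of_addC of_add0 of_addN.

Lemma of_scaleA a b om : of_scale a (of_scale b om) = of_scale (a * b) om.
Proof. by apply: val_inj; rewrite /= scalerA. Qed.
Lemma of_scale1 : left_id 1 of_scale.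
Proof. by move=> u; apply: val_inj; rewrite /= scale1r. Qed.
Lemma of_scaleDr : right_distributive of_scale +%R.
Proof. by move=> a u v; apply: val_inj; rewrite /= scalerDr. Qed.
Lemma of_scaleDl om : {morph of_scale^~ om : a b / a + b}.
Proof. by move=> a b; apply: val_inj; rewrite /= scalerDl. Qed.
HB.instance Definition _ := GRing.Zmodule_isLmodule.Build A oneform
  of_scaleA of_scale1 of_scaleDr of_scaleDl.

End VectorFields.

Section AdjacentWords.
Variable r : nat.
Implicit Type s : 'S_r.

Definition adjacent (p : 'I_r * 'I_r) : bool := p.2 == p.1.+1 :> nat.

Definition adjacent_word s (l : seq ('I_r * 'I_r)) : bool :=
  all adjacent l && (s == \prod_(p <- l) tperm p.1 p.2)%g.

Lemma adjacent_wordM s t l m : adjacent_word s l -> adjacent_word t m ->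
  adjacent_word (s * t)%g (l ++ m).
Proof.
move=> /andP[al /eqP->] /andP[am /eqP->].
by rewrite /adjacent_word all_cat al am big_cat eqxx.
Qed.

Lemma adjacent_word_tperm (i j : 'I_r) : exists l, adjacent_word (tperm i j) l.
Proof.
wlog: i j / (i <= j)%N => [W|].
  by case/orP: (leq_total i j) => /W //; rewrite tpermC.
move: {2}(j - i)%N (erefl (j - i)%N) => n.
elim: n i j => [|n IH] i j E le_ij.
  have -> : i = j by apply/val_inj/eqP; rewrite eqn_leq le_ij -subn_eq0 E /=.
  by exists [::]; rewrite /adjacent_word big_nil tperm1 eqxx.
have lt_ij : (i < j)%N by rewrite -subn_gt0 E.
have i1r : (i.+1 < r)%N by apply: leq_ltn_trans lt_ij _.
pose i1 := Ordinal i1r.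
have [l l1] : exists l, adjacent_word (tperm i1 j) l.
  by apply: IH => //=; rewrite subnS E.
have w1 : adjacent_word (tperm i i1) [:: (i, i1)].
  by rewrite /adjacent_word /= /adjacent eqxx big_seq1 eqxx.
have [e|ne] := eqVneq i1 j; first by exists [:: (i, i1)]; rewrite -e.
exists ([:: (i, i1)] ++ (l ++ [:: (i, i1)])).
have -> : tperm i j = (tperm i i1 * (tperm i1 j * tperm i i1))%g.
  rewrite -{1}(tpermV i i1) -[RHS]/(conjg _ _) tpermJ tpermR tpermD //.
  by apply: contraTneq lt_ij => ->; rewrite ltnn.
by apply: adjacent_wordM => //; apply: adjacent_wordM.
Qed.

Lemma adjacent_word_ex s : exists l, adjacent_word s l.
Proof.
have [ts -> _] := prod_tpermP s; elim: ts => [|p ts [l IH]].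
  by exists [::]; rewrite /adjacent_word !big_nil eqxx.
have [m Hm] := adjacent_word_tperm p.1 p.2.
by exists (m ++ l); rewrite big_cons; apply: adjacent_wordM.
Qed.

Definition adj_word s : seq ('I_r * 'I_r) := xchoose (adjacent_word_ex s).
End AdjacentWords.

Section Calculus.
Variables (k : comUnitRingType) (H : triangularHopfAlgebra k).
Variable A : braidedAlgebra H.
Local Notation "'Δ' h" := (tseq (coprod h)) (at level 10).
Local Notation R' := (tseq (rmat_inv H)).

(* The operations on tensor products below are evaluated on the chosen        *)
(* expression of a tensor; they respect the defining relations because the    *)
(* modules involved are H-equivariant A-bimodules on which                    *)
(* m a = (R^-1_1 |> a) (R^-1_2 |> m). These laws are not recorded here.       *)
Record actmod := ActMod {
  am_sort :> zmodType;
  lact : A -> am_sort -> am_sort;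
  ract : am_sort -> A -> am_sort;
  bact : H -> am_sort -> am_sort
}.

Definition amod_alg : actmod := @ActMod A *%R *%R (@hact k H A).
Definition amod_vf : actmod :=
  @ActMod (vfield A) *:%R (@vf_mulr k H A) (@vf_act k H A).
Definition amod_form : actmod :=
  @ActMod (oneform A) *:%R (@of_mulr k H A) (@of_act k H A).

Definition atens (M N : actmod) : zmodType := tens (@ract M) (@lact N).

Definition at_mk (M N : actmod) (m : M) (n : N) : atens M N := tmk _ _ m n.

Definition amod_tens (M N : actmod) : actmod := @ActMod (atens M N)
  (fun a t => \sum_(p <- tseq t) at_mk (lact a p.1) p.2)
  (fun t a => \sum_(p <- tseq t) at_mk p.1 (ract p.2 a))
  (fun h t => \sum_(p <- tseq t) \sum_(q <- Δ h)
     at_mk (bact q.1 p.1) (bact q.2 p.2)).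

(* [tpow 0] is A, [tpow 1] is the module of one-forms and [tpow r.+2] its     *)
(* tensor product over A with [tpow r.+1].                                    *)
Fixpoint tpow (r : nat) : actmod :=
  if r is s.+1 then
    if s is _.+1 then amod_tens amod_form (tpow s) else amod_form
  else amod_alg.

Definition kact (M : actmod) (c : k) (m : M) : M := lact (c%:A : A) m.

Fixpoint tcat (r s : nat) : tpow r -> tpow s -> tpow (r + s) :=
  match r return tpow r -> tpow s -> tpow (r + s) with
  | 0 => fun a x => lact a x
  | r1.+1 =>
    match r1 return (tpow r1 -> tpow s -> tpow (r1 + s)) ->
      tpow r1.+1 -> tpow s -> tpow (r1.+1 + s) with
    | 0 => fun _ w =>
      match s return tpow s -> tpow (1 + s) with
      | 0 => fun a => ract w a
      | s1.+1 => fun x => @at_mk amod_form (tpow s1.+1) w x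
      end
    | r2.+1 => fun rec t x =>
      \sum_(p <- tseq t) @at_mk amod_form (tpow (r2.+1 + s)) p.1 (rec p.2 x)
    end (@tcat r1 s)
  end.

Definition braid (M N : actmod) (t : atens M N) : atens N M :=
  \sum_(p <- tseq t) \sum_(q <- R') at_mk (bact q.1 p.2) (bact q.2 p.1).

Definition braid_head (r : nat) : tpow r.+2 -> tpow r.+2 :=
  match r return tpow r.+2 -> tpow r.+2 with
  | 0 => @braid amod_form amod_form
  | s.+1 => fun t =>
    \sum_(p <- tseq t) \sum_(p' <- tseq p.2) \sum_(q <- R')
      @at_mk amod_form (tpow s.+2) (bact q.1 p'.1)
        (@at_mk amod_form (tpow s.+1) (bact q.2 p.1) p'.2)
  end.

(* The braiding of the factors i and i + 1, counted from 0. *)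
Fixpoint braid_at (r i : nat) : tpow r -> tpow r :=
  match r return tpow r -> tpow r with
  | 0 => id
  | r1.+1 =>
    match r1 return (nat -> tpow r1 -> tpow r1) -> tpow r1.+1 -> tpow r1.+1 with
    | 0 => fun _ => id
    | r2.+1 => fun rec t =>
      if i is j.+1 then
        \sum_(p <- tseq t) @at_mk amod_form (tpow r2.+1) p.1 (rec j p.2)
      else braid_head t
    end (@braid_at r1)
  end.

(* The word chosen for s in the adjacent transpositions does not matter: the  *)
(* operators [braid_at] satisfy the Coxeter relations, as R is triangular.    *)
Definition perm_act (r : nat) (s : 'S_r) (t : tpow r) : tpow r :=
  foldr (fun p => braid_at (p.1 : 'I_r)) t (adj_word s).

Definition antisym (r : nat) (t : tpow r) : tpow r :=
  kact (r`!%:R)^-1 (\sum_(s : 'S_r) kact ((-1) ^+ s) (perm_act s t)).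

Definition is_form (r : nat) (t : tpow r) : Prop := exists x, t = antisym x.

Definition wedge (r s : nat) (x : tpow r) (y : tpow s) : tpow (r + s) :=
  kact ((r + s)`!%:R / (r`!%:R * s`!%:R)) (antisym (tcat x y)).

(* d_r is only meaningful on the r-forms of the r-th tensor power. *)
Record exterior_derivative (d : forall r, tpow r -> tpow r.+1) : Prop := {
  ext_der0 : forall a : A, d 0%N a = of_d a;
  ext_der_form : forall r (x : tpow r), is_form x -> is_form (d r x);
  ext_der_linear : forall r (c : k) (x y : tpow r), is_form x -> is_form y ->
    d r (kact c x + y) = kact c (d r x) + d r y;
  ext_der_equiv : forall r h (x : tpow r), is_form x ->
    d r (bact h x) = bact h (d r x);
  ext_der_sq : forall r (x : tpow r), is_form x -> d r.+1 (d r x) = 0;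
  ext_der_leibniz : forall r s (x : tpow r) (y : tpow s),
    is_form x -> is_form y ->
    d (r + s)%N (wedge x y) = wedge (d r x) y +
      ecast n (tpow n) (addnS r s) (kact ((-1) ^+ r) (wedge x (d s y)))
}.

(* A retract of a free left module of finite rank. *)
Definition fg_projective (M : lmodType A) : Prop :=
  exists n (p : {linear 'rV[A]_n -> M}) (i : {linear M -> 'rV[A]_n}),
    cancel i p.

Definition dual_bases n (e : 'I_n -> vfield A) (om : 'I_n -> oneform A) : Prop :=
  forall u : vfield A, u = \sum_i om i u *: e i.

Record left_connection (nabla : vfield A -> atens amod_form amod_vf) : Prop := {
  left_connection_linear : forall (c : k) (u v : vfield A),
    nabla (@kact amod_vf c u + v)
    = @kact (amod_tens amod_form amod_vf) c (nabla u) + nabla v;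
  left_connection_leibniz : forall (a : A) (v : vfield A),
    nabla (a *: v) = @at_mk amod_form amod_vf (of_d a) v
      + @lact (amod_tens amod_form amod_vf) a (nabla v)
}.

(* <v, th (x) eta> = <v, th> eta *)
Definition contract (v : vfield A) (t : tpow 2) : oneform A :=
  \sum_(p <- tseq t) (p.1 : oneform A) v *: (p.2 : oneform A).

(* d <v, th> = <nabla v, th> + <v, *nabla th>, where                          *)
(* <eta (x) z, th> = eta <z, th>.                                             *)
Definition dual_connection (nabla : vfield A -> atens amod_form amod_vf)
    (nablas : oneform A -> tpow 2) : Prop :=
  forall (v : vfield A) (th : oneform A),
    of_d (th v) = \sum_(p <- tseq (nabla v)) of_mulr p.1 (th p.2)
      + contract v (nablas th).

Section Connection.
Variable nabla : vfield A -> atens amod_form amod_vf.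

(* nabla_u v = i_u (nabla v), where i_u (th (x) z) = <u, th> z *)
Definition cov (u v : vfield A) : vfield A :=
  \sum_(p <- tseq (nabla v)) (p.1 : oneform A) u *: (p.2 : vfield A).

Definition curvature (u v z : vfield A) : vfield A :=
  cov u (cov v z)
  - \sum_(q <- R') cov (vf_act q.1 v) (cov (vf_act q.2 u) z)
  - cov (bracket u v) z.

Definition torsion (u v : vfield A) : vfield A :=
  cov u v - \sum_(q <- R') cov (vf_act q.1 v) (vf_act q.2 u) - bracket u v.

Variables (n : nat) (e : 'I_n -> vfield A) (om : 'I_n -> oneform A).

Definition curv_coef (i j m l : 'I_n) : A := om l (curvature (e i) (e j) (e m)).
Definition tors_coef (i j l : 'I_n) : A := om l (torsion (e i) (e j)).

Definition wedge_om (j i : 'I_n) : tpow 2 := @wedge 1 1 (om j) (om i).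

Definition curv_form (m l : 'I_n) : tpow 2 :=
  kact (- 2^-1) (\sum_i \sum_j ract (wedge_om j i) (curv_coef i j m l)).

Definition tors_form (l : 'I_n) : tpow 2 :=
  kact (- 2^-1) (\sum_i \sum_j ract (wedge_om j i) (tors_coef i j l)).

Definition conn_form (nablas : oneform A -> tpow 2) (m l : 'I_n) : tpow 1 :=
  contract (e m) (nablas (om l)).
End Connection.
End Calculus.

Definition char0_field (k : comUnitRingType) : Prop :=
  [pchar k] =i pred0 /\ forall x : k, x != 0 -> x \is a GRing.unit.

(* k is isomorphic to K[[t]]; coef x n is the coefficient of t^n in x. *)
Definition power_series_ring (K : fieldType) (k : comUnitRingType) : Prop :=
  exists coef : k -> nat -> K,
    [/\ bijective coef,
        forall x y n, coef (x + y) n = coef x n + coef y n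
      & forall x y n,
          coef (x * y) n = \sum_(i < n.+1) coef x i * coef y (n - i)%N].

Definition ground_ring (k : comUnitRingType) : Prop :=
  char0_field k \/
  exists K : fieldType, [pchar K] =i pred0 /\ power_series_ring K k.

(* Main.v *)
Require Import Defs.
From HB Require Import structures.
From mathcomp Require Import all_boot all_order all_algebra.
From mathcomp Require Import fingroup perm.
From mathcomp Require boolp.

Set Implicit Arguments.
Unset Strict Implicit.
Unset Printing Implicit Defensive.

Import GRing.Theory.
Local Open Scope ring_scope.

(** The exterior algebra takes values in tensor powers of the module of forms,
    whose elements are awkward to compute with: operations are given on chosen
    sums of elementary tensors. The dual bases remove this difficulty. A tensor is
    determined by its contractions with vector fields (lemma [ctr_inj]), hence a
    tensor of degree two or three is determined by its values on as many vector
    fields ([ev2], [ev3]). On functions, the braiding of two factors permutes two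
    arguments through the R-matrix, and its properties become identities for the
    R-matrix: involutivity is triangularity, left linearity is the hexagon
    relation, and the Yang-Baxter equation follows from quasi-cocommutativity.
    The braidings therefore define an action of the symmetric group on three
    letters, the antisymmetrizer changes sign under them, and the wedge product of
    three one-forms is associative ([wedge_assoc]).

    The structure equations also are identities between functions. The exterior
    derivative of a one-form satisfies the Cartan formula ([cartan_formula]); with
    the definition of the dual connection it gives, for the torsion and the
    curvature forms,
      [T^l = d om^l + om^j w_j^l],  [R_i^l = - d w_i^l + G_i^j w_j^l],
    products being wedge products. Here [G_i^j] is the pairing of [nabla e_i] with
    [om^j]. If [a_i^j] denotes the pairing of [e_i] with [om^j], the matrix [a] is
    idempotent and
      [om a = om],  [a w = w],  [G a = G],  [d a = G + w],
    the last equation being the definition of the dual connection. For a free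
    module with a basis [a] is the identity and [G = - w], which gives the usual
    formulas. In general the four relations suffice. The torsion identity follows
    from [om da w = 0]. For the curvature, the tensor product with [om] amounts to a
    multiplication on the left by [a], and after that multiplication the
    differential Bianchi identity follows from [a da = w - w a]
    ([torsion_bianchi], [curvature_bianchi]). *)

(* Simplification would unfold the value of [h ▷ th] into a Sweedler sum. *)
Arguments of_val : simpl never.
Arguments cf_val : simpl never.
Arguments vf_val : simpl never.

(** * Evaluation of one-forms on vector fields *)

Section Additive.
Variables (U V : zmodType) (h : U -> V).
Hypothesis hD : {morph h : x y / x + y}.

Lemma additive0 : h 0 = 0.
Proof. by apply: (addrI (h 0)); rewrite -hD !addr0. Qed.
Lemma additiveN x : h (- x) = - h x.
Proof. by apply: (addrI (h x)); rewrite -hD !subrr additive0. Qed.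
Lemma additive_sum (I : Type) (r : seq I) (x : I -> U) :
  h (\sum_(i <- r) x i) = \sum_(i <- r) h (x i).
Proof. by apply: big_morph => //; exact: additive0. Qed.
End Additive.

Section OneForms.
Variables (k : comUnitRingType) (H : triangularHopfAlgebra k).
Variable A : braidedAlgebra H.
Local Notation "'Δ' h" := (tseq (coprod h)) (at level 10).
Local Notation R' := (tseq (rmat_inv H)).
Implicit Types (u v : vfield A) (th eta : oneform A) (a b : A).

Lemma of_eq th eta : (forall u, th u = eta u) -> th = eta.
Proof. by move=> E; apply: val_inj; apply: cf_eq. Qed.

Lemma of_addE th eta u : (th + eta) u = th u + eta u.
Proof. by []. Qed.
Lemma of_sumE (I : Type) (r : seq I) (th : I -> oneform A) u :
  (\sum_(i <- r) th i) u = \sum_(i <- r) th i u.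
Proof. exact: (additive_sum (h := fun t : oneform A => t u)). Qed.
Lemma of_scaleE a th u : (a *: th) u = th (vf_mulr u a).
Proof. by []. Qed.
Lemma of_mulrE a th u : of_mulr th a u = th u * a.
Proof. by []. Qed.
Lemma of_dE a u : of_d a u = u a.
Proof. by []. Qed.

Lemma of_act_lin th u : linear (fun h => of_act h th u).
Proof. by rewrite /cf_val /=; have lw := cf_act_linl th; lin. Qed.

(** Evaluation is equivariant: the inverse antipode in the action on forms
    cancels the action on the argument. *)
Lemma hact_form h th u : h ▷ th u = \sum_(p <- Δ h) of_act p.2 th (vf_act p.1 u).
Proof.
have lw := cf_act_linl th.
transitivity (\sum_(p <- Δ h) \sum_(q <- Δ p.2)
    q.2 ▷ th (vf_act (antipode_inv q.1 * p.1) u)); last first.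
  apply: eq_bigr => p _; apply: eq_bigr => q _.
  by rewrite vf_actM.
rewrite -(coassoc (F := fun x y z =>
    z ▷ th (vf_act (antipode_inv y * x) u))); last by tril.
under eq_bigr => p _.
  rewrite (antipir (f := fun x => p.2 ▷ th (vf_act x u))); last by lin.
  rewrite vf_act1; over.
by rewrite (counitl (f := fun x => x ▷ th u)) //; lin.
Qed.

Lemma of_actM g h th : of_act (g * h) th = of_act g (of_act h th).
Proof.
apply: of_eq => u; have lw := cf_act_linl th.
rewrite {1}/cf_val /= (coprod_mul (F := fun p => p.2 ▷ th (vf_act (antipode_inv p.1) u))).
  apply: eq_bigr => p _; rewrite (lin_sumE (@hact_linr _ _ A p.2)).
  by apply: eq_bigr => q _; rewrite /= antipode_invM hactM vf_actM.
by bil.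
Qed.

Lemma form_vf_mulr th u a :
  th (vf_mulr u a) = \sum_(p <- R') (p.1 ▷ a) * th (vf_act p.2 u).
Proof. by rewrite vf_mulrE cf_sum; apply: eq_bigr => p _; rewrite cfZ. Qed.

(** Moving an R-matrix through the evaluation of a form produces a second one,
    which triangularity cancels against the first. *)
Lemma eval_braid (V : lmodType k) (G : A * H -> V) th u : bilin G ->
  \sum_(q <- R') \sum_(p <- R') G (p.1 ▷ th (vf_act q.2 u), p.2 * q.1)
  = \sum_(x <- R') G (of_act x.1 th u, x.2).
Proof.
case=> lG1 lG2.
have lt y : linear (fun h => of_act h th y) := of_act_lin th _.
have lt' x y : linear (fun h => of_act x th (vf_act h y)) by exact: cf_act_linl.
transitivity (\sum_(q <- R') \sum_(p <- R') \sum_(x <- R')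
    G (of_act x.1 th (vf_act (p.1 * q.2) u), x.2 * (p.2 * q.1))).
  apply: eq_bigr => q _.
  transitivity (\sum_(p <- R') \sum_(x <- Δ p.1)
      G (of_act x.2 th (vf_act (x.1 * q.2) u), p.2 * q.1)).
    apply: eq_bigr => p _; rewrite hact_form.
    rewrite (lin_sumE (f := fun a => G (a, _)) (lG1 _)).
    by apply: eq_bigr => x _; rewrite vf_actM.
  rewrite (hexl (F := fun x y z =>
    G (of_act y th (vf_act (x * q.2) u), z * q.1))).
    by apply: eq_bigr => p _; apply: eq_bigr => x _; rewrite mulrA.
  by split=> ? ? /=; [ apply: (lin_comp' (lG1 _)); lin
    | apply: (lin_comp' (lG1 _)); lin | apply: (lin_comp' (lG2 _)); lin].
under eq_bigr do rewrite exchange_big /=.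
rewrite exchange_big /=; apply: eq_bigr => x _.
rewrite exchange_big /=.
rewrite (rmat_tri (F := fun p =>
   G (of_act x.1 th (vf_act p.1 u), x.2 * p.2))) /= ?vf_act1 ?mulr1 //.
split=> ? /=; first by apply: (lin_comp' (lG1 _)); lin.
by apply: (lin_comp' (lG2 _)); lin.
Qed.

(** Both sides equal the sum of [(q.1 ▷ th) u * eta (q.2 ▷ v)] over [q]. *)
Lemma pair_braid th eta u v :
  \sum_(q <- R') of_act q.2 th (vf_mulr u (of_act q.1 eta v))
  = \sum_(q <- R') eta (vf_mulr (vf_act q.1 v) (th (vf_act q.2 u))).
Proof.
have lt x y : linear (fun h => of_act x th (vf_act h y)) by exact: cf_act_linl.
have lt0 y : linear (fun h => of_act h th y) := of_act_lin th _.
have le y : linear (fun h => eta (vf_act h y)) by exact: cf_act_linl.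
transitivity (\sum_(r <- R') of_act r.1 th u * eta (vf_act r.2 v)); last first.
  rewrite -(eval_braid (G := fun p => p.1 * eta (vf_act p.2 v))); last by bil.
  apply: eq_bigr => q _; rewrite form_vf_mulr; apply: eq_bigr => p _.
  by rewrite /= vf_actM.
under [RHS]eq_bigr do rewrite braided_comm.
transitivity (\sum_(r <- R') \sum_(s <- R') \sum_(t <- R')
    (s.1 ▷ t.1 ▷ eta (vf_act r.2 v)) * of_act (t.2 * r.1) th (vf_act s.2 u)).
  rewrite [RHS]exchange_big /=.
  transitivity (\sum_(s <- R') \sum_(x <- R')
      (s.1 ▷ of_act x.1 eta v) * of_act x.2 th (vf_act s.2 u)).
    rewrite [RHS]exchange_big /=; apply: eq_bigr => x _; exact: form_vf_mulr.
  apply: eq_bigr => s _.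
  by rewrite -(eval_braid (G := fun p =>
    (s.1 ▷ p.1) * of_act p.2 th (vf_act s.2 u))) //; bil.
apply: eq_bigr => r _.
transitivity (\sum_(s <- R') \sum_(x <- Δ s.2) (s.1 ▷ eta (vf_act r.2 v)) *
    of_act (x.2 * r.1) th (vf_act x.1 u)); last first.
  apply: eq_bigr => s _; rewrite (hact_form s.2) mulr_sumr.
  by apply: eq_bigr => x _; rewrite of_actM.
rewrite (hexr (F := fun x y z => (x ▷ eta (vf_act r.2 v)) *
    of_act (z * r.1) th (vf_act y u))); last by tril.
by apply: eq_bigr => s _; apply: eq_bigr => t _; rewrite hactM.
Qed.
End OneForms.

(** * Contraction of tensors *)

Section Contraction.
Variables (k : comUnitRingType) (H : triangularHopfAlgebra k).
Variable A : braidedAlgebra H.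
Implicit Types (u v : vfield A) (th : oneform A) (a b : A) (c : k).
Local Notation F1 := (amod_form A).

(** The laws of a left [A]-module, which the structure [actmod] leaves out. *)
Record lmod_laws (M : actmod A) : Prop := LmodLaws {
  lactDl : forall a b (m : M), lact (a + b) m = lact a m + lact b m;
  lactDr : forall a (m m' : M), lact a (m + m') = lact a m + lact a m';
  lactA : forall a b (m : M), lact a (lact b m) = lact (a * b) m;
  lact1 : forall m : M, lact 1 m = m
}.

Lemma lmod_laws_form : lmod_laws F1.
Proof.
split=> * /=; [exact: scalerDl | exact: scalerDr | exact: scalerA | exact: scale1r].
Qed.

Lemma lmod_laws_alg : lmod_laws (amod_alg A).
Proof.
split=> * /=; [exact: mulrDl | exact: mulrDr | exact: mulrA | exact: mul1r].
Qed.

Section Laws.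
Variables (M : actmod A) (lM : lmod_laws M).
Implicit Types (m : M) (s t : atens F1 M).

Lemma lactN a m : lact a (- m) = - lact a m.
Proof. exact: (additiveN (lactDr lM a)). Qed.
Lemma lactNl a m : lact (- a) m = - lact a m.
Proof. by apply: (additiveN (h := fun a : A => lact a m)) => ? ?; exact: lactDl. Qed.
Lemma lact_sum (I : Type) (r : seq I) a (m : I -> M) :
  lact a (\sum_(i <- r) m i) = \sum_(i <- r) lact a (m i).
Proof. exact: (additive_sum (lactDr lM a)). Qed.
Lemma kactD c m m' : kact c (m + m') = kact c m + kact c m'.
Proof. exact: lactDr. Qed.
Lemma kactDl c c' m : kact (c + c') m = kact c m + kact c' m.
Proof. by rewrite /kact scalerDl lactDl. Qed.
Lemma kactA c c' m : kact c (kact c' m) = kact (c * c') m.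
Proof. by rewrite /kact lactA // -scalerAl mul1r scalerA. Qed.
Lemma kact1 m : kact 1 m = m.
Proof. by rewrite /kact scale1r lact1. Qed.
Lemma kactN c m : kact c (- m) = - kact c m.
Proof. exact: lactN. Qed.
Lemma kactNl c m : kact (- c) m = - kact c m.
Proof. by rewrite /kact scaleNr lactNl. Qed.
Lemma kact_lact c a m : kact c (lact a m) = lact a (kact c m).
Proof. by rewrite /kact !lactA // -scalerAl mul1r -scalerAr mulr1. Qed.

Lemma at_mkE t : t = \sum_(p <- tseq t) @at_mk _ _ _ F1 M p.1 p.2.
Proof. exact: tmkE. Qed.

(** The pairing [<u, t>] of a vector field with the first factor of a tensor. *)
Definition ctr u t : M := \sum_(p <- tseq t) lact ((p.1 : oneform A) u) p.2.

Lemma ctr_bal u :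
  balanced (@ract _ _ _ F1) (@lact _ _ _ M) (fun th m => lact ((th : oneform A) u) m).
Proof.
split=> [th th' m|th m m'|th a m]; first by rewrite of_addE lactDl.
  exact: lactDr.
by rewrite lactA.
Qed.

Lemma ctrD u s t : ctr u (s + t) = ctr u s + ctr u t.
Proof. exact: (tseqD _ _ (ctr_bal u)). Qed.
Lemma ctrN u t : ctr u (- t) = - ctr u t.
Proof. exact: (additiveN (ctrD u)). Qed.
Lemma ctr_sum (I : Type) (r : seq I) u (t : I -> atens F1 M) :
  ctr u (\sum_(i <- r) t i) = \sum_(i <- r) ctr u (t i).
Proof. exact: (additive_sum (ctrD u)). Qed.
Lemma ctr_mk u th m : ctr u (@at_mk _ _ _ F1 M th m) = lact (th u) m.
Proof.
have := tseq_sum [:: tt] (fun=> th) (fun=> m) (ctr_bal u).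
by rewrite !big_seq1.
Qed.
Lemma ctr_vfD u v t : ctr (u + v) t = ctr u t + ctr v t.
Proof.
rewrite -big_split; apply: eq_bigr => p _ /=.
by rewrite (cfD (p.1 : oneform A)) lactDl.
Qed.
Lemma ctr_vfZ a u t : ctr (a *: u) t = lact a (ctr u t).
Proof.
rewrite lact_sum; apply: eq_bigr => p _ /=.
by rewrite (cfZ (p.1 : oneform A)) lactA.
Qed.

Lemma lact_bal a :
  balanced (@ract _ _ _ F1) (@lact _ _ _ M)
    (fun th m => @at_mk _ _ _ F1 M (a *: (th : oneform A)) m).
Proof.
split=> [th th' m|th m m'|th b m]; first by rewrite scalerDr /at_mk tmkDl.
  by rewrite /at_mk tmkDr.
by rewrite /at_mk -tmk_bal; congr tmk; apply: of_eq.
Qed.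
Lemma lact_mk a th m :
  lact a (@at_mk _ _ _ F1 M th m : amod_tens F1 M) = at_mk (a *: th : F1) m.
Proof.
have := tseq_sum [:: tt] (fun=> th) (fun=> m) (lact_bal a).
by rewrite !big_seq1.
Qed.
Lemma lmod_laws_tens : lmod_laws (amod_tens F1 M).
Proof.
have D a (s t : amod_tens F1 M) : lact a (s + t) = lact a s + lact a t.
  exact: (tseqD _ _ (lact_bal a)).
have S (I : Type) (r : seq I) a (t : I -> amod_tens F1 M) :
    lact a (\sum_(i <- r) t i) = \sum_(i <- r) lact a (t i).
  exact: (additive_sum (D a)).
split=> [a b t|//|a b t|t].
- rewrite [t]at_mkE !S -big_split; apply: eq_bigr => p _.
  by rewrite !lact_mk scalerDl /at_mk tmkDl.
- rewrite [t]at_mkE (S _ _ b) (S _ _ a) (S _ _ (a * b)); apply: eq_bigr => p _.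
  by rewrite !lact_mk scalerA.
rewrite [in LHS](at_mkE t) S [RHS]at_mkE; apply: eq_bigr => p _.
by rewrite lact_mk scale1r.
Qed.

Lemma ctr_lact u a (t : amod_tens F1 M) : ctr u (lact a t) = ctr (vf_mulr u a) t.
Proof.
by rewrite /= ctr_sum; apply: eq_bigr => p _; rewrite ctr_mk.
Qed.

Lemma at_mkDl th th' m :
  @at_mk _ _ _ F1 M (th + th') m = at_mk (th : F1) m + at_mk (th' : F1) m.
Proof. exact: tmkDl. Qed.
Lemma at_mkDr th m m' :
  @at_mk _ _ _ F1 M th (m + m') = at_mk (th : F1) m + at_mk (th : F1) m'.
Proof. exact: tmkDr. Qed.
Lemma at_mk_bal th a m :
  @at_mk _ _ _ F1 M (of_mulr th a) m = at_mk (th : F1) (lact a m).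
Proof. exact: (@tmk_bal _ _ _ (@ract _ _ _ F1)). Qed.
Lemma at_mk0 th : @at_mk _ _ _ F1 M th 0 = 0.
Proof. exact: (additive0 (at_mkDr th)). Qed.
Lemma at_mk_sum (I : Type) (r : seq I) th (m : I -> M) :
  @at_mk _ _ _ F1 M th (\sum_(i <- r) m i) = \sum_(i <- r) at_mk (th : F1) (m i).
Proof. exact: (additive_sum (at_mkDr th)). Qed.
Lemma at_mk_suml (I : Type) (r : seq I) (th : I -> oneform A) m :
  @at_mk _ _ _ F1 M (\sum_(i <- r) th i) m = \sum_(i <- r) at_mk (th i : F1) m.
Proof.
by apply: (additive_sum (h := fun th => @at_mk _ _ _ F1 M th m)) => x y;
  exact: at_mkDl.
Qed.

Variables (n : nat) (e : 'I_n -> vfield A) (om : 'I_n -> oneform A).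
Hypothesis dual : dual_bases e om.

Lemma form_expand th : th = \sum_i of_mulr (om i) (th (e i)).
Proof.
apply: of_eq => u; rewrite of_sumE {1}(dual u) cf_sum.
by apply: eq_bigr => i _; rewrite cfZ.
Qed.

Lemma tens_expand t : t = \sum_i at_mk (om i : F1) (ctr (e i) t).
Proof.
under eq_bigr do rewrite at_mk_sum.
rewrite exchange_big [LHS]at_mkE; apply: eq_bigr => p _ /=.
rewrite {1}(form_expand p.1) at_mk_suml.
by apply: eq_bigr => i _; rewrite at_mk_bal.
Qed.

(** By the dual bases, [t] is the sum of the [om i (x) <e i, t>], so that its
    contractions determine it. Identities between tensors, and the independence
    of an operation from the chosen expression of a tensor, thus reduce to
    identities between functions of vector fields. *)
Lemma ctr_inj s t : (forall u, ctr u s = ctr u t) -> s = t.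
Proof.
move=> E; rewrite [s]tens_expand [t]tens_expand.
by apply: eq_bigr => i _; rewrite E.
Qed.

End Laws.
End Contraction.

(** * Tensors as multilinear functions, and their braidings *)

Section Evaluation.
Variables (k : comUnitRingType) (H : triangularHopfAlgebra k).
Variable A : braidedAlgebra H.
Local Notation "'Δ' h" := (tseq (coprod h)) (at level 10).
Local Notation R' := (tseq (rmat_inv H)).
Implicit Types (u v z : vfield A) (th eta : oneform A) (a b : A) (c : k).
Local Notation F1 := (amod_form A).
Local Notation lF1 := (@lmod_laws_form k H A).
Implicit Types (s t : tpow A 2) (x y : tpow A 3).

Lemma lmod_laws_tpow r : lmod_laws (tpow A r).
Proof.
case: r => [|r]; first exact: lmod_laws_alg.
elim: r => [|r IH]; first exact: lmod_laws_form.
exact: lmod_laws_tens.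
Qed.

Lemma vf_mulr_scalar c u : vf_mulr u (c%:A) = (c%:A : A) *: u.
Proof.
by rewrite -[c *: 1]addr0 vf_mulr_lin vf_mulr1 (additive0 (vf_mulrDr u)) !addr0.
Qed.

Lemma vf_mulr_sum (I : Type) (r : seq I) u (a : I -> A) :
  vf_mulr u (\sum_(i <- r) a i) = \sum_(i <- r) vf_mulr u (a i).
Proof. exact: (additive_sum (vf_mulrDr u)). Qed.

(** [<u, <v, t>>], which is the value of [t] on [u] tensor [v]. *)
Definition ev2 t u v : A := (@ctr _ _ _ F1 v t : oneform A) u.

Lemma ev2D s t u v : ev2 (s + t) u v = ev2 s u v + ev2 t u v.
Proof. by rewrite /ev2 (ctrD lF1). Qed.
Lemma ev2_sum (I : Type) (r : seq I) (t : I -> tpow A 2) u v :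
  ev2 (\sum_(i <- r) t i) u v = \sum_(i <- r) ev2 (t i) u v.
Proof. by rewrite /ev2 (ctr_sum lF1) of_sumE. Qed.
Lemma ev2N t u v : ev2 (- t) u v = - ev2 t u v.
Proof. by rewrite /ev2 (ctrN lF1). Qed.
Lemma ev2_mk th eta u v :
  ev2 (@at_mk _ _ _ F1 F1 th eta) u v = eta (vf_mulr u (th v)).
Proof. by rewrite /ev2 (ctr_mk lF1). Qed.
Lemma ev2_lact a t u v : ev2 (lact a t) u v = ev2 t u (vf_mulr v a).
Proof. by rewrite /ev2 (ctr_lact lF1). Qed.
Lemma ev2_ract a t u v : ev2 (ract t a) u v = ev2 t u v * a.
Proof.
have -> : ract t a = \sum_(p <- tseq t) @at_mk _ _ _ F1 F1 p.1 (of_mulr p.2 a).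
  by [].
rewrite ev2_sum [in RHS](at_mkE t) ev2_sum mulr_suml.
by apply: eq_bigr => p _; rewrite !ev2_mk.
Qed.
Lemma ev2_vfD1 t u u' v : ev2 t (u + u') v = ev2 t u v + ev2 t u' v.
Proof. exact: cfD. Qed.
Lemma ev2_vfD2 t u v v' : ev2 t u (v + v') = ev2 t u v + ev2 t u v'.
Proof. by rewrite /ev2 (ctr_vfD lF1). Qed.
Lemma ev2_vfZ a t u v : ev2 t (a *: u) v = a * ev2 t u v.
Proof. exact: cfZ. Qed.
Lemma ev2_mid a t u v : ev2 t u (a *: v) = ev2 t (vf_mulr u a) v.
Proof. by rewrite /ev2 (ctr_vfZ lF1). Qed.
Lemma ev2_lin1 t u v : linear (fun h => ev2 t (vf_act h u) v).
Proof. exact: cf_act_linl. Qed.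
Lemma ev2_lin2 t u v : linear (fun h => ev2 t u (vf_act h v)).
Proof.
move=> c g h; rewrite vf_act_linl ev2_vfD2 ev2_mid vf_mulr_scalar ev2_vfZ.
by rewrite -scalerAl mul1r.
Qed.

(** [<u, <v, <z, x>>>], the value of [x] on [u] tensor [v] tensor [z]. *)
Definition ev3 x u v z : A := ev2 (@ctr _ _ _ (tpow A 2) z x) u v.
Local Notation lF2 := (lmod_laws_tpow 2).

Lemma ev3D x y u v z : ev3 (x + y) u v z = ev3 x u v z + ev3 y u v z.
Proof. by rewrite /ev3 (ctrD lF2) ev2D. Qed.
Lemma ev3_sum (I : Type) (r : seq I) (x : I -> tpow A 3) u v z :
  ev3 (\sum_(i <- r) x i) u v z = \sum_(i <- r) ev3 (x i) u v z.
Proof. by rewrite /ev3 (ctr_sum lF2) ev2_sum. Qed.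
Lemma ev3_mk th t u v z :
  ev3 (@at_mk _ _ _ F1 (tpow A 2) th t) u v z = ev2 t u (vf_mulr v (th z)).
Proof. by rewrite /ev3 (ctr_mk lF2) ev2_lact. Qed.
Lemma ev3_lact a x u v z : ev3 (lact a x) u v z = ev3 x u v (vf_mulr z a).
Proof. by rewrite /ev3 (ctr_lact lF2). Qed.
Lemma ev3_vfZ a x u v z : ev3 x (a *: u) v z = a * ev3 x u v z.
Proof. exact: ev2_vfZ. Qed.
Lemma ev3_mid12 a x u v z : ev3 x u (a *: v) z = ev3 x (vf_mulr u a) v z.
Proof. exact: ev2_mid. Qed.
Lemma ev3_mid23 a x u v z : ev3 x u v (a *: z) = ev3 x u (vf_mulr v a) z.
Proof. by rewrite /ev3 (ctr_vfZ lF2) ev2_lact. Qed.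
Lemma ev3_vfD2 x u v v' z : ev3 x u (v + v') z = ev3 x u v z + ev3 x u v' z.
Proof. exact: ev2_vfD2. Qed.
Lemma ev3_vfD3 x u v z z' : ev3 x u v (z + z') = ev3 x u v z + ev3 x u v z'.
Proof. by rewrite /ev3 (ctr_vfD lF2) ev2D. Qed.
Lemma ev3_lin1 x u v z : linear (fun h => ev3 x (vf_act h u) v z).
Proof. exact: ev2_lin1. Qed.
Lemma ev3_lin2 x u v z : linear (fun h => ev3 x u (vf_act h v) z).
Proof. exact: ev2_lin2. Qed.
Lemma ev3_lin3 x u v z : linear (fun h => ev3 x u v (vf_act h z)).
Proof.
move=> c g h; rewrite vf_act_linl ev3_vfD3 ev3_mid23 vf_mulr_scalar ev3_mid12.
by rewrite vf_mulr_scalar ev3_vfZ -scalerAl mul1r.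
Qed.

(** The hexagon relation for the first leg of the R-matrix produces the second
    R-matrix that defines the right multiplication by [a]. This makes the
    braiding of tensors left [A]-linear. *)
Lemma braid_slide (G : vfield A -> vfield A -> A) u v a :
    (forall w m, linear (fun h => G (vf_act h w) m)) ->
    (forall w m, linear (fun h => G w (vf_act h m))) ->
    (forall w m, linear (fun b => G w (b *: m))) ->
    (forall w m m', G w (m + m') = G w m + G w m') ->
    (forall w w' m, G (w + w') m = G w m + G w' m) ->
    (forall b w m, G w (b *: m) = G (vf_mulr w b) m) ->
  \sum_(q <- R') G (vf_act q.1 (vf_mulr v a)) (vf_act q.2 u)
  = \sum_(q <- R') G (vf_act q.1 v) (vf_mulr (vf_act q.2 u) a).
Proof.
move=> l1 l2 l3 D2 D1 mid.
have S2 w (r : seq (H * H)) f :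
    G w (\sum_(q <- r) f q) = \sum_(q <- r) G w (f q).
  exact: (additive_sum (D2 w)).
have S1 m (r : seq (H * H)) f :
    G (\sum_(q <- r) f q) m = \sum_(q <- r) G (f q) m.
  by apply: (additive_sum (h := G^~ m)) => w w'; exact: D1.
under [RHS]eq_bigr do rewrite vf_mulrE S2.
transitivity (\sum_(q <- R') \sum_(p <- Δ q.1)
    G (vf_act p.1 v) ((p.2 ▷ a) *: vf_act q.2 u)).
  apply: eq_bigr => q _; rewrite vf_act_mulr S1; apply: eq_bigr => p _.
  by rewrite mid.
rewrite (hexl (F := fun f g h => G (vf_act f v) ((g ▷ a) *: vf_act h u))).
  by apply: eq_bigr => p _; apply: eq_bigr => q _; rewrite vf_actM.
split=> [g h|f h|f g] //; first exact: (lin_comp' (l3 _ _) (@hact_linl _ _ A a)).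
by move=> c h h'; rewrite !mid; exact: l2.
Qed.

Local Notation bd := (@braid_at _ _ A 2 0).

Lemma braidE (t : tpow A 2) : bd t
  = \sum_(p <- tseq t) \sum_(q <- R')
      @at_mk _ _ _ F1 F1 (of_act q.1 p.2) (of_act q.2 p.1).
Proof. by []. Qed.

(** On functions the braiding permutes arguments, so that it does not depend on
    the expression of [t] as a sum of elementary tensors. *)
Lemma ev2_braid (t : tpow A 2) u v :
  ev2 (bd t) u v
  = \sum_(q <- R') ev2 t (vf_act q.1 v) (vf_act q.2 u).
Proof.
rewrite braidE ev2_sum [in RHS](at_mkE t).
under [RHS]eq_bigr do rewrite ev2_sum.
rewrite [RHS]exchange_big; apply: eq_bigr => p _.
rewrite ev2_sum; transitivity (\sum_(q <- R') of_act q.2 p.1 (vf_mulr u (of_act q.1 p.2 v))).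
  by apply: eq_bigr => q _; rewrite ev2_mk.
by rewrite pair_braid; apply: eq_bigr => q _; rewrite ev2_mk.
Qed.

Lemma ev2_braid_mulr t u v a :
  ev2 (bd t) u (vf_mulr v a)
  = \sum_(q <- R') ev2 t (vf_act q.1 v) (vf_mulr (vf_act q.2 u) a).
Proof.
rewrite ev2_braid; apply: braid_slide => [w m|w m|w m|w m m'|w w' m|b w m].
- exact: ev2_lin1.
- exact: ev2_lin2.
- by move=> c b b'; rewrite !ev2_mid vf_mulr_lin ev2_vfD1 ev2_vfZ -scalerAl mul1r.
- exact: ev2_vfD2.
- exact: ev2_vfD1.
- exact: ev2_mid.
Qed.

Lemma braid_at_1E x : @braid_at _ _ A 3 1 x
  = \sum_(p <- tseq x) @at_mk _ _ _ F1 (tpow A 2) p.1 (bd p.2).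
Proof. by []. Qed.

Lemma braid_at_0E x : @braid_at _ _ A 3 0 x
  = \sum_(p <- tseq x) \sum_(p' <- tseq (p.2 : tpow A 2)) \sum_(q <- R')
      @at_mk _ _ _ F1 (tpow A 2) (of_act q.1 p'.1)
        (@at_mk _ _ _ F1 F1 (of_act q.2 p.1) p'.2).
Proof. by []. Qed.

Lemma ev3_braid_1 x u v z :
  ev3 (braid_at 1 x) u v z
  = \sum_(q <- R') ev3 x (vf_act q.1 v) (vf_act q.2 u) z.
Proof.
rewrite braid_at_1E ev3_sum [in RHS](at_mkE x).
under [RHS]eq_bigr do rewrite ev3_sum.
rewrite [RHS]exchange_big; apply: eq_bigr => p _.
rewrite ev3_mk ev2_braid_mulr.
by apply: eq_bigr => q _; rewrite ev3_mk.
Qed.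

Lemma at_mk2_sum th t : @at_mk _ _ _ F1 (tpow A 2) th t
  = \sum_(p <- tseq t) @at_mk _ _ _ F1 (tpow A 2) th (@at_mk _ _ _ F1 F1 p.1 p.2).
Proof. by rewrite [in LHS](at_mkE t) at_mk_sum. Qed.

Lemma ev3_braid_0 x u v z :
  ev3 (braid_at 0 x) u v z
  = \sum_(q <- R') ev3 x u (vf_act q.1 z) (vf_act q.2 v).
Proof.
rewrite braid_at_0E ev3_sum [in RHS](at_mkE x).
under [RHS]eq_bigr do rewrite ev3_sum.
rewrite [RHS]exchange_big; apply: eq_bigr => p _.
under [RHS]eq_bigr do rewrite at_mk2_sum ev3_sum.
rewrite ev3_sum [RHS]exchange_big; apply: eq_bigr => p' _.
rewrite ev3_sum; transitivity (of_val p'.2 (vf_mulr u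
    (\sum_(q <- R') of_act q.2 p.1 (vf_mulr v (of_act q.1 p'.1 z))))).
  rewrite vf_mulr_sum cf_sum; apply: eq_bigr => q _.
  by rewrite ev3_mk ev2_mk.
rewrite pair_braid vf_mulr_sum cf_sum; apply: eq_bigr => q _.
by rewrite ev3_mk ev2_mk.
Qed.

Lemma ev3_slide x u v z a :
  \sum_(q <- R') ev3 x u (vf_act q.1 (vf_mulr z a)) (vf_act q.2 v)
  = \sum_(q <- R') ev3 x u (vf_act q.1 z) (vf_mulr (vf_act q.2 v) a).
Proof.
apply: (braid_slide (G := ev3 x u)) => [w m|w m|w m|w m m'|w w' m|b w m].
- exact: ev3_lin2.
- exact: ev3_lin3.
- move=> c b b'; rewrite !ev3_mid23 vf_mulr_lin ev3_vfD2 ev3_mid12.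
  by rewrite vf_mulr_scalar ev3_vfZ -scalerAl mul1r.
- exact: ev3_vfD3.
- exact: ev3_vfD2.
- exact: ev3_mid23.
Qed.

Section Braidings.
Variables (n : nat) (e : 'I_n -> vfield A) (om : 'I_n -> oneform A).
Hypothesis dual : dual_bases e om.

Lemma ev2_inj s t : (forall u v, ev2 s u v = ev2 t u v) -> s = t.
Proof.
by move=> E; apply: (ctr_inj (M := F1) dual) => v; apply: of_eq => u; exact: E.
Qed.
Lemma ev3_inj x y : (forall u v z, ev3 x u v z = ev3 y u v z) -> x = y.
Proof.
by move=> E; apply: (ctr_inj (M := tpow A 2) dual) => z; apply: ev2_inj => u v; exact: E.
Qed.

Lemma braidD s t : bd (s + t) = bd s + bd t.
Proof.
apply: ev2_inj => u v; rewrite ev2D !ev2_braid -big_split.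
by apply: eq_bigr => q _; rewrite ev2D.
Qed.
Lemma braid_lact a t : bd (lact a t) = lact a (bd t).
Proof.
apply: ev2_inj => u v; rewrite ev2_lact ev2_braid_mulr ev2_braid.
by apply: eq_bigr => q _; rewrite ev2_lact.
Qed.
Lemma braid_ract a t : bd (ract t a) = ract (bd t) a.
Proof.
apply: ev2_inj => u v; rewrite ev2_ract !ev2_braid mulr_suml.
by apply: eq_bigr => q _; rewrite ev2_ract.
Qed.
Lemma braidK t : bd (bd t) = t.
Proof.
have l1 := ev2_lin1 t; have l2 := ev2_lin2 t.
apply: ev2_inj => u v; rewrite ev2_braid.
under eq_bigr do rewrite ev2_braid.
transitivity (\sum_(q <- R') \sum_(p <- R')
   ev2 t (vf_act (q.1 * p.2) u) (vf_act (q.2 * p.1) v)).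
  rewrite exchange_big; apply: eq_bigr => q _; apply: eq_bigr => p _.
  by rewrite !vf_actM.
rewrite (rmat_tri (F := fun p => ev2 t (vf_act p.1 u) (vf_act p.2 v))) /=.
  by rewrite !vf_act1.
by split=> w /=; [exact: l1 | exact: l2].
Qed.

Local Notation b0 := (@braid_at _ _ A 3 0).
Local Notation b1 := (@braid_at _ _ A 3 1).
Lemma braid_at0D x y : b0 (x + y) = b0 x + b0 y.
Proof.
apply: ev3_inj => u v z; rewrite ev3D !ev3_braid_0 -big_split.
by apply: eq_bigr => q _; rewrite ev3D.
Qed.
Lemma braid_at1D x y : b1 (x + y) = b1 x + b1 y.
Proof.
apply: ev3_inj => u v z; rewrite ev3D !ev3_braid_1 -big_split.
by apply: eq_bigr => q _; rewrite ev3D.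
Qed.
Lemma braid_at0_lact a x : b0 (lact a x) = lact a (b0 x).
Proof.
apply: ev3_inj => u v z; rewrite ev3_lact !ev3_braid_0 ev3_slide.
by apply: eq_bigr => q _; rewrite ev3_lact.
Qed.
Lemma braid_at1_lact a x : b1 (lact a x) = lact a (b1 x).
Proof.
apply: ev3_inj => u v z; rewrite ev3_lact !ev3_braid_1.
by apply: eq_bigr => q _; rewrite ev3_lact.
Qed.
Lemma braid_at0K x : b0 (b0 x) = x.
Proof.
have l2 := ev3_lin2 x; have l3 := ev3_lin3 x.
apply: ev3_inj => u v z; rewrite ev3_braid_0.
under eq_bigr do rewrite ev3_braid_0.
transitivity (\sum_(q <- R') \sum_(p <- R')
   ev3 x u (vf_act (q.1 * p.2) v) (vf_act (q.2 * p.1) z)).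
  rewrite exchange_big; apply: eq_bigr => q _; apply: eq_bigr => p _.
  by rewrite !vf_actM.
rewrite (rmat_tri (F := fun p => ev3 x u (vf_act p.1 v) (vf_act p.2 z))) /=.
  by rewrite !vf_act1.
by split=> w /=; [exact: l2 | exact: l3].
Qed.
Lemma braid_at1K x : b1 (b1 x) = x.
Proof.
have l2 := ev3_lin2 x; have l1 := ev3_lin1 x.
apply: ev3_inj => u v z; rewrite ev3_braid_1.
under eq_bigr do rewrite ev3_braid_1.
transitivity (\sum_(q <- R') \sum_(p <- R')
   ev3 x (vf_act (q.1 * p.2) u) (vf_act (q.2 * p.1) v) z).
  rewrite exchange_big; apply: eq_bigr => q _; apply: eq_bigr => p _.
  by rewrite !vf_actM.
rewrite (rmat_tri (F := fun p => ev3 x (vf_act p.1 u) (vf_act p.2 v) z)) /=.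
  by rewrite !vf_act1.
by split=> w /=; [exact: l1 | exact: l2].
Qed.
End Braidings.
End Evaluation.

(** * Yang-Baxter equation and permutations *)

Section YangBaxter.
Variables (k : comUnitRingType) (H : triangularHopfAlgebra k).
Variable A : braidedAlgebra H.
Local Notation R' := (tseq (rmat_inv H)).

(** Both sides come from the coproduct of the second leg of one R-matrix, and
    quasi-cocommutativity exchanges the two orders of this coproduct. *)
Lemma rmat_yang_baxter (V : lmodType k) (F : H -> H -> H -> V) : trilin F ->
  \sum_(p <- R') \sum_(q <- R') \sum_(r <- R')
    F (p.1 * q.1) (r.1 * q.2) (r.2 * p.2)
  = \sum_(p <- R') \sum_(q <- R') \sum_(r <- R')
    F (p.1 * q.1) (p.2 * r.1) (q.2 * r.2).
Proof.
case=> l1 l2 l3.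
rewrite -(hexr (F := fun x y z => \sum_(r <- R') F x (r.1 * z) (r.2 * y))).
  rewrite -(hexr (F := fun x y z => \sum_(r <- R') F x (y * r.1) (z * r.2))).
    apply: eq_bigr => p _.
    by rewrite (quasi_cocom (F := fun h => F p.1 h.1 h.2)) //; split=> ? /=.
  by split=> ? ? /=; lin.
by split=> ? ? /=; lin.
Qed.

Variables (n : nat) (e : 'I_n -> vfield A) (om : 'I_n -> oneform A).
Hypothesis dual : dual_bases e om.
Local Notation b0 := (@braid_at _ _ A 3 0).
Local Notation b1 := (@braid_at _ _ A 3 1).

Lemma braid_yang_baxter x : b0 (b1 (b0 x)) = b1 (b0 (b1 x)).
Proof.
apply: (ev3_inj dual) => u v z.
pose F f g h := ev3 x (vf_act f z) (vf_act g v) (vf_act h u).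
have lF : trilin F.
  by split=> ? ?; [exact: ev3_lin1 | exact: ev3_lin2 | exact: ev3_lin3].
transitivity (\sum_(p <- R') \sum_(q <- R') \sum_(r <- R')
    F (p.1 * q.1) (r.1 * q.2) (r.2 * p.2)).
  rewrite exchange_big ev3_braid_0; apply: eq_bigr => q _.
  rewrite ev3_braid_1; apply: eq_bigr => p _.
  by rewrite ev3_braid_0; apply: eq_bigr => r _; rewrite /F !vf_actM.
rewrite rmat_yang_baxter //.
transitivity (\sum_(r <- R') \sum_(q <- R') \sum_(p <- R')
    F (p.1 * q.1) (p.2 * r.1) (q.2 * r.2)).
  rewrite [RHS]exchange_big /= exchange_big; apply: eq_bigr => q _ /=.
  by rewrite exchange_big.
rewrite ev3_braid_1; apply: eq_bigr => q _.
rewrite ev3_braid_0; apply: eq_bigr => p _.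
by rewrite ev3_braid_1; apply: eq_bigr => r _; rewrite /F !vf_actM.
Qed.
End YangBaxter.

Section Antisymmetrizer.
Variables (k : comUnitRingType) (H : triangularHopfAlgebra k).
Variable A : braidedAlgebra H.

Definition word_act r (l : seq ('I_r * 'I_r)) (t : tpow A r) : tpow A r :=
  foldr (fun p => braid_at (p.1 : 'I_r)) t l.
Definition word_perm r (l : seq ('I_r * 'I_r)) : 'S_r :=
  (\prod_(p <- l) tperm p.1 p.2)%g.

(** The braidings of adjacent factors satisfy every relation between the adjacent
    transpositions, so that the word chosen in [perm_act] does not matter. *)
Definition coherent r : Prop := forall l m : seq ('I_r * 'I_r),
  all (@adjacent r) l -> all (@adjacent r) m -> word_perm l = word_perm m ->
  word_act l =1 word_act m.

Lemma word_act_cat r (l m : seq ('I_r * 'I_r)) t :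
  word_act (l ++ m) t = word_act l (word_act m t).
Proof. exact: foldr_cat. Qed.

Lemma word_perm_cat r (l m : seq ('I_r * 'I_r)) :
  word_perm (l ++ m) = (word_perm l * word_perm m)%g.
Proof. exact: big_cat. Qed.

Lemma adj_wordP r (s : 'S_r) :
  all (@adjacent r) (adj_word s) /\ word_perm (adj_word s) = s.
Proof.
by have /andP[al /eqP E] := xchooseP (adjacent_word_ex s); split; last exact/esym.
Qed.

Lemma perm_act_word r (l : seq ('I_r * 'I_r)) : coherent r ->
  all (@adjacent r) l -> perm_act (word_perm l) =1 @word_act r l.
Proof.
move=> C al t; have [al' E] := adj_wordP (word_perm l).
exact: C.
Qed.

(** If a family of [r`!] words is stable, up to the relations between the
    operators, under adjoining a letter on the left, then it represents every
    permutation, hence each of them exactly once. Two words for the same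
    permutation then reduce to the same member of the family. *)
Lemma coherent_normal_forms r (nf : seq (seq ('I_r * 'I_r))) :
  size nf = r`! -> [::] \in nf ->
  (forall p l, adjacent p -> l \in nf -> exists2 m, m \in nf &
     word_perm (p :: l) = word_perm m /\ @word_act r (p :: l) =1 word_act m) ->
  coherent r.
Proof.
move=> sz nf0 step.
have red l : all (@adjacent r) l -> exists2 m, m \in nf &
     word_perm l = word_perm m /\ @word_act r l =1 word_act m.
  elim: l => [_|p l IH /= /andP[ap /IH[m mnf [E1 E2]]]].
    by exists [::].
  have [m' mnf' [E1' E2']] := step p m ap mnf; exists m' => //; split.
    by rewrite -E1' /word_perm !big_cons -/(word_perm l) E1.
  by move=> t; rewrite -E2' /= E2.
have U : uniq (map (@word_perm r) nf).
  apply: (@leq_size_uniq _ (enum 'S_r)); first exact: enum_uniq.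
    move=> s _; have [al E] := adj_wordP s; have [m mnf [Em _]] := red _ al.
    by rewrite -E Em; exact: map_f.
  by rewrite size_map sz -cardE card_Sn.
have inj : {in nf &, injective (@word_perm r)}.
  move=> l m lnf mnf E; rewrite -(nth_index [::] lnf) -(nth_index [::] mnf).
  congr nth; apply/eqP.
  rewrite -(nth_uniq 1%g _ _ U) ?size_map ?index_mem //.
  by rewrite !(nth_map [::]) ?index_mem // !nth_index // E.
move=> l m /red[l' l'nf [El Wl]] /red[m' m'nf [Em Wm]] E t.
by rewrite Wl Wm; congr (word_act _ t); apply: inj => //; rewrite -El -Em.
Qed.

Lemma perm_act1 r (t : tpow A r) : coherent r -> perm_act 1 t = t.
Proof.
move=> C; have -> : 1%g = word_perm (r := r) [::] by rewrite /word_perm big_nil.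
by rewrite perm_act_word.
Qed.

Lemma perm_act_braid r (s : 'S_r) (i j : 'I_r) (t : tpow A r) : coherent r ->
  adjacent (i, j) -> perm_act s (braid_at i t) = perm_act (s * tperm i j)%g t.
Proof.
move=> C aij; have [al E] := adj_wordP s.
have -> : (s * tperm i j)%g = word_perm (adj_word s ++ [:: (i, j)]).
  by rewrite word_perm_cat E /word_perm big_seq1.
rewrite perm_act_word //; last by rewrite all_cat al /= aij.
by rewrite word_act_cat.
Qed.

Lemma antisym_braid r (i j : 'I_r) (t : tpow A r) : coherent r ->
  adjacent (i, j) -> antisym (braid_at i t) = - antisym t.
Proof.
move=> C aij; have lM := lmod_laws_tpow A r.
rewrite /antisym -(kactN lM) -sumrN; congr kact.
have ne : i != j by apply: contraTneq aij => ->; rewrite /adjacent /= ltn_eqF.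
have sg s : (s * tperm i j)%g = ~~ odd_perm s :> bool.
  by rewrite odd_permM odd_tperm ne addbT.
rewrite [RHS](reindex_inj (mulIg (tperm i j))) /=; apply: eq_bigr => s _.
rewrite (perm_act_braid _ _ C aij) -(kactNl lM) sg.
by case: (odd_perm s); rewrite /= ?expr0 ?expr1 ?opprK.
Qed.
End Antisymmetrizer.

(** * Coxeter relations in degrees two and three *)

Section LowDegrees.
Variables (k : comUnitRingType) (H : triangularHopfAlgebra k).
Variable A : braidedAlgebra H.
Variables (n : nat) (e : 'I_n -> vfield A) (om : 'I_n -> oneform A).
Hypothesis dual : dual_bases e om.

Lemma coherent2 : coherent A 2.
Proof.
pose a : 'I_2 * 'I_2 := (ord0, ord_max).
apply: (@coherent_normal_forms _ _ _ _ [:: [::]; [:: a]]) => //.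
move=> [[[|[|//]] i] [[|[|//]] j]] l //= _; rewrite !inE.
have -> : (Ordinal i, Ordinal j) = a by congr (_, _); apply: val_inj.
case/orP=> /eqP->; first by exists [:: a] => //; rewrite !inE eqxx.
exists [::] => //; split; last by move=> t; exact: (braidK dual).
by rewrite /word_perm !big_cons !big_nil mulg1 tperm2.
Qed.

Lemma coherent3 : coherent A 3.
Proof.
pose i1 : 'I_3 := Ordinal (isT : (1 < 3)%N).
pose a : 'I_3 * 'I_3 := (ord0, i1); pose b : 'I_3 * 'I_3 := (i1, ord_max).
apply: (@coherent_normal_forms _ _ _ _
  [:: [::]; [:: a]; [:: b]; [:: a; b]; [:: b; a]; [:: a; b; a]]) => //.
move=> p l adj_p lnf.
have {adj_p} : (p == a) || (p == b).
  by move: p adj_p => [[[|[|[|//]]] i] [[|[|[|//]]] j]].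
set ta := tperm ord0 i1; set tb := tperm i1 ord_max.
have aa : (ta * ta = 1)%g by exact: tperm2.
have bb : (tb * tb = 1)%g by exact: tperm2.
have bab : (tb * (ta * tb) = ta * (tb * ta))%g.
  apply/permP => -[[|[|[|//]]] i]; rewrite !permM !permE /=; exact: val_inj.
have aaK x : (ta * (ta * x) = x)%g by rewrite mulgA aa mul1g.
have bbK x : (tb * (tb * x) = x)%g by rewrite mulgA bb mul1g.
have Wa t : @word_act _ _ A 3 [:: a; a] t = t by exact: (braid_at0K dual).
have Wb t : @word_act _ _ A 3 [:: b; b] t = t by exact: (braid_at1K dual).
have Wbab t : @word_act _ _ A 3 [:: b; a; b] t = word_act [:: a; b; a] t.
  exact/esym/(braid_yang_baxter dual).
have pa l' : word_perm (a :: l') = (ta * word_perm l')%g by exact: big_cons.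
have pb l' : word_perm (b :: l') = (tb * word_perm l')%g by exact: big_cons.
have p0 : word_perm (r := 3) [::] = 1%g by exact: big_nil.
have wp := (pa, pb, p0).
rewrite !inE in lnf; case/orP => /eqP->; case/or4P: lnf => [| | |/or3P[| |]] /eqP->.
- by exists [:: a]; rewrite // !inE eqxx ?orbT.
- by exists [::]; rewrite // !wp ?mulg1 aa.
- by exists [:: a; b]; rewrite // !inE eqxx ?orbT.
- exists [:: b]; rewrite ?inE ?eqxx ?orbT // !wp ?mulg1 aaK; split=> // t.
  exact: Wa.
- by exists [:: a; b; a]; rewrite // !inE eqxx ?orbT.
- exists [:: b; a]; rewrite ?inE ?eqxx ?orbT // !wp ?mulg1 aaK; split=> // t.
  exact: Wa.
- by exists [:: b]; rewrite // !inE eqxx ?orbT.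
- by exists [:: b; a]; rewrite // !inE eqxx ?orbT.
- by exists [::]; rewrite // !wp ?mulg1 bb.
- exists [:: a; b; a]; rewrite ?inE ?eqxx ?orbT // !wp ?mulg1 bab.
  by split.
- exists [:: a]; rewrite ?inE ?eqxx ?orbT // !wp ?mulg1 bbK; split=> // t.
  exact: Wb.
exists [:: a; b]; rewrite ?inE ?eqxx ?orbT // !wp ?mulg1.
have -> : (tb * (ta * (tb * ta)) = ta * tb)%g.
  by rewrite -bab bbK.
by split=> // t; rewrite -[LHS]/(word_act [:: b; a; b] (word_act [:: a] t)) Wbab
  -[LHS]/(word_act [:: a; b] (word_act [:: a; a] t)) Wa.
Qed.

Local Notation F1 := (amod_form A).
Local Notation bd := (@braid_at _ _ A 2 0).
Implicit Types (th eta zeta : oneform A) (s t b : tpow A 2) (x y : tpow A 3).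
Implicit Types (a : A) (c : k).

Lemma antisym2E t : antisym t = kact 2%:R^-1 (t - bd t).
Proof.
pose i1 : 'I_2 := ord_max.
(* The two permutations are told apart by the image of [ord0]. *)
have S2 (s : 'S_2) : (s != 1%g) = (s == tperm ord0 i1).
  have [E|ne] := eqVneq (s ord0) ord0.
    have -> : s = 1%g.
      apply/permP => -[[|[|//]] i]; rewrite perm1.
        have -> : Ordinal i = ord0 by exact: val_inj.
        exact: E.
      have -> : Ordinal i = i1 by exact: val_inj.
      have : s i1 != ord0 by rewrite -[X in _ != X]E (inj_eq perm_inj).
      by case: (s i1) => -[|[|//]] j // _; exact: val_inj.
    rewrite eqxx; apply/esym/eqP => /permP/(_ ord0); rewrite perm1 tpermL.
    by move/(congr1 val).
  have E0 : s ord0 = i1.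
    by move: ne; case: (s ord0) => -[|[|//]] j // _; exact: val_inj.
  have E1 : s i1 = ord0.
    have : s i1 != i1 by rewrite -[X in _ != X]E0 (inj_eq perm_inj).
    by case: (s i1) => -[|[|//]] j // _; exact: val_inj.
  have -> : s = tperm ord0 i1.
    apply/permP => -[[|[|//]] i].
      have -> : Ordinal i = ord0 by exact: val_inj.
      by rewrite E0 tpermL.
    have -> : Ordinal i = i1 by exact: val_inj.
    by rewrite E1 tpermR.
  rewrite eqxx; apply/eqP => /permP/(_ ord0); rewrite perm1 tpermL.
  by move/(congr1 val).
have lM := lmod_laws_tpow A 2.
rewrite /antisym (bigD1 1%g) // (eq_bigl (pred1 (tperm ord0 i1))); last first.
  by move=> s; exact: S2.
rewrite big_pred1_eq odd_perm1 expr0 (kact1 lM) (perm_act1 _ coherent2).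
rewrite odd_tperm (_ : ord0 != i1 = true) // expr1 (kactNl lM) (kact1 lM).
have <- : perm_act 1 (bd t) = perm_act (tperm ord0 i1) t.
  by rewrite (@perm_act_braid _ _ _ 2 1%g ord0 i1) ?mul1g //; exact: coherent2.
by rewrite (perm_act1 _ coherent2).
Qed.
End LowDegrees.

(** * Wedge products up to degree two *)

Section Wedge.
Variables (k : comUnitRingType) (H : triangularHopfAlgebra k).
Variable A : braidedAlgebra H.
Hypothesis unit2 : 2%:R \is a @GRing.unit k.
Variables (n : nat) (e : 'I_n -> vfield A) (om : 'I_n -> oneform A).
Hypothesis dual : dual_bases e om.
Local Notation F1 := (amod_form A).
Local Notation bd := (@braid_at _ _ A 2 0).
Local Notation R' := (tseq (rmat_inv H)).
Local Notation lM := (lmod_laws_tpow A).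
Implicit Types (th eta zeta : oneform A) (s t : tpow A 2) (x y : tpow A 3).
Implicit Types (a : A) (c : k).

Lemma antisym0E (a : tpow A 0) : antisym a = a.
Proof.
rewrite /antisym invr1 (kact1 (lM 0)).
rewrite (eq_bigl (pred1 1%g)) => [|s]; last by apply/esym/eqP/permP => -[].
rewrite big_pred1_eq odd_perm1 expr0 (kact1 (lM 0)) /perm_act.
by elim: (adj_word _) => //= p l ->.
Qed.

Lemma antisym1E (th : tpow A 1) : antisym th = th.
Proof.
rewrite /antisym invr1 (kact1 (lM 1)).
rewrite (eq_bigl (pred1 1%g)) => [|s]; last first.
  by apply/esym/eqP/permP => i; rewrite !ord1.
rewrite big_pred1_eq odd_perm1 expr0 (kact1 (lM 1)) /perm_act.
by elim: (adj_word _) => //= p l ->.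
Qed.

Lemma is_form0 (a : tpow A 0) : is_form a.
Proof. by exists a; rewrite antisym0E. Qed.
Lemma is_form1 (th : tpow A 1) : is_form th.
Proof. by exists th; rewrite antisym1E. Qed.

(** Restricted to adjacent pairs, because these are the letters of the words in
    [perm_act]. *)
Definition braid_linear r : Prop := forall i j : 'I_r, adjacent (i, j) ->
  (forall t t' : tpow A r, braid_at i (t + t') = braid_at i t + braid_at i t') /\
  (forall a (t : tpow A r), braid_at i (lact a t) = lact a (braid_at i t)).

Lemma braid_linear2 : braid_linear 2.
Proof.
move=> [[|[|//]] i] [[|[|//]] j] // _; split=> *.
  exact: (braidD dual).
exact: (braid_lact dual).
Qed.

Lemma braid_linear3 : braid_linear 3.
Proof.
move=> [[|[|[|//]]] i] [[|[|[|//]]] j] // _; split=> *.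
- exact: (braid_at0D dual).
- exact: (braid_at0_lact dual).
- exact: (braid_at1D dual).
- exact: (braid_at1_lact dual).
Qed.

Section AntisymLinear.
Variables (r : nat) (lr : braid_linear r).

Lemma perm_actD (s : 'S_r) (t t' : tpow A r) :
  perm_act s (t + t') = perm_act s t + perm_act s t'.
Proof.
have [al _] := adj_wordP s; rewrite /perm_act.
elim: (adj_word s) al => //= -[i j] l IH /andP[/lr[D _] /IH->].
exact: D.
Qed.
Lemma perm_act_lact (s : 'S_r) a (t : tpow A r) :
  perm_act s (lact a t) = lact a (perm_act s t).
Proof.
have [al _] := adj_wordP s; rewrite /perm_act.
elim: (adj_word s) al => //= -[i j] l IH /andP[/lr[_ L] /IH->].
exact: L.
Qed.

Lemma antisymD (t t' : tpow A r) : antisym (t + t') = antisym t + antisym t'.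
Proof.
rewrite /antisym -(kactD (lM r)) -big_split; congr kact; apply: eq_bigr => s _.
by rewrite perm_actD (kactD (lM r)).
Qed.
Lemma antisym_lact a (t : tpow A r) : antisym (lact a t) = lact a (antisym t).
Proof.
rewrite /antisym -(kact_lact (lM r)) (lact_sum (lM r)); congr kact.
by apply: eq_bigr => s _; rewrite perm_act_lact (kact_lact (lM r)).
Qed.
Lemma antisymN (t : tpow A r) : antisym (- t) = - antisym t.
Proof. exact: (additiveN antisymD). Qed.
End AntisymLinear.

Lemma kact_half_double r (t : tpow A r) : kact 2%:R^-1 (t + t) = t.
Proof.
rewrite -{1 2}(kact1 (lM r) t) -(kactDl (lM r)) (kactA (lM r)).
by rewrite -mulr2n mulVr // (kact1 (lM r)).
Qed.

Lemma braidN t : bd (- t) = - bd t.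
Proof. exact: (additiveN (braidD dual)). Qed.

Lemma is_form2P t : is_form t <-> bd t = - t.
Proof.
split=> [[s ->]|E].
  rewrite (antisym2E dual) (braid_lact dual) (braidD dual) braidN.
  by rewrite (braidK dual) -(kactN (lM 2)) opprB addrC.
exists t; rewrite (antisym2E dual) E opprK; exact/esym/kact_half_double.
Qed.

Lemma antisym_form2 t : is_form t -> antisym t = t.
Proof.
by move/is_form2P => E; rewrite (antisym2E dual) E opprK kact_half_double.
Qed.

Lemma wedge01 a th : @wedge _ _ A 0 1 a th = a *: th.
Proof. by rewrite /wedge !fact0 mulr1 divr1 (kact1 (lM 1)) antisym1E. Qed.
Lemma wedge10 a th : @wedge _ _ A 1 0 th a = of_mulr th a.
Proof. by rewrite /wedge !fact0 mulr1 divr1 (kact1 (lM 1)) antisym1E. Qed.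
Lemma wedge02 a t : is_form t -> @wedge _ _ A 0 2 a t = lact a t.
Proof.
move=> ft; rewrite /wedge mul1r divrr // (kact1 (lM 2)).
by rewrite (antisym_lact braid_linear2) antisym_form2.
Qed.
Lemma wedge20 a t : is_form t -> @wedge _ _ A 2 0 t a = ract t a.
Proof.
move=> ft; rewrite /wedge mulr1 divrr // (kact1 (lM 2)).
apply: antisym_form2; apply/is_form2P; rewrite (braid_ract dual).
move/is_form2P: ft => ->; apply: (ev2_inj dual) => u v.
by rewrite ev2_ract !ev2N ev2_ract mulNr.
Qed.

Lemma wedge11E th eta :
  @wedge _ _ A 1 1 th eta =
  (at_mk (th : F1) (eta : F1) : tpow A 2) - bd (at_mk (th : F1) (eta : F1)).
Proof.
rewrite /wedge (antisym2E dual) (kactA (lM 2)) mulr1 divr1 divrr //.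
exact: (kact1 (lM 2)).
Qed.

Lemma ev2_wedge11 th eta u v : ev2 (@wedge _ _ A 1 1 th eta) u v
  = eta (vf_mulr u (th v))
  - \sum_(q <- R') eta (vf_mulr (vf_act q.1 v) (th (vf_act q.2 u))).
Proof.
rewrite wedge11E ev2D ev2N ev2_mk ev2_braid; congr (_ - _).
by apply: eq_bigr => q _; rewrite ev2_mk.
Qed.

Lemma is_form_wedge11 th eta : is_form (@wedge _ _ A 1 1 th eta).
Proof.
apply/is_form2P; rewrite wedge11E (braidD dual) braidN (braidK dual).
by rewrite opprB addrC.
Qed.
End Wedge.

(** * Wedge products in degree three *)

Section WedgeThree.
Variables (k : comUnitRingType) (H : triangularHopfAlgebra k).
Variable A : braidedAlgebra H.
Hypothesis unit2 : 2%:R \is a @GRing.unit k.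
Variables (n : nat) (e : 'I_n -> vfield A) (om : 'I_n -> oneform A).
Hypothesis dual : dual_bases e om.
Local Notation F1 := (amod_form A).
Local Notation bd := (@braid_at _ _ A 2 0).
Local Notation lM := (lmod_laws_tpow A).
Local Notation "th ∧11 eta" := (@wedge _ _ A 1 1 th eta) (at level 40).
Local Notation "th ∧12 t" := (@wedge _ _ A 1 2 th t) (at level 40).
Local Notation "t ∧21 th" := (@wedge _ _ A 2 1 t th) (at level 40).
Implicit Types (th eta zeta : oneform A) (s t : tpow A 2) (x y : tpow A 3).
Implicit Types (a : A) (c : k).

Lemma tcat11E th eta : @tcat _ _ A 1 1 th eta = at_mk (th : F1) (eta : F1).
Proof. by []. Qed.
Lemma tcat12E th t : @tcat _ _ A 1 2 th t = @at_mk _ _ _ F1 (tpow A 2) th t.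
Proof. by []. Qed.

Lemma form_vf_mulrN th u a : th (vf_mulr u (- a)) = - th (vf_mulr u a).
Proof.
by apply: (additiveN (h := fun b => th (vf_mulr u b))) => b b'; rewrite vf_mulrDr cfD.
Qed.

Lemma ev3_tcat21 t th u v z :
  ev3 (@tcat _ _ A 2 1 t th) u v z = th (vf_mulr u (ev2 t v z)).
Proof.
have -> : @tcat _ _ A 2 1 t th = \sum_(p <- tseq t)
    @at_mk _ _ _ F1 (tpow A 2) p.1 (@at_mk _ _ _ F1 F1 p.2 th) by [].
rewrite ev3_sum [in RHS](at_mkE t) ev2_sum vf_mulr_sum cf_sum.
by apply: eq_bigr => p _; rewrite ev3_mk !ev2_mk.
Qed.

Lemma ev3N x u v z : ev3 (- x) u v z = - ev3 x u v z.
Proof. by apply: (additiveN (h := fun x => ev3 x u v z)) => y y'; exact: ev3D. Qed.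

Lemma wedge11Dl th th' eta : (th + th') ∧11 eta = th ∧11 eta + th' ∧11 eta.
Proof.
rewrite /wedge -(kactD (lM 2)) -(antisymD (braid_linear2 dual)).
by rewrite !tcat11E at_mkDl.
Qed.
Lemma wedge11Dr th eta eta' : th ∧11 (eta + eta') = th ∧11 eta + th ∧11 eta'.
Proof.
rewrite /wedge -(kactD (lM 2)) -(antisymD (braid_linear2 dual)).
by rewrite !tcat11E at_mkDr.
Qed.
Lemma wedge11_bal th a eta : of_mulr th a ∧11 eta = th ∧11 (a *: eta).
Proof. by rewrite /wedge !tcat11E (at_mk_bal (M := F1)). Qed.
Lemma wedge11_lact a th eta : (a *: th) ∧11 eta = lact a (th ∧11 eta).
Proof.
rewrite /wedge -(kact_lact (lM 2)) -(antisym_lact (braid_linear2 dual)).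
by rewrite !tcat11E (lact_mk (M := F1)).
Qed.

Lemma wedge12Dl th th' t : (th + th') ∧12 t = th ∧12 t + th' ∧12 t.
Proof.
rewrite /wedge -(kactD (lM 3)) -(antisymD (braid_linear3 dual)).
by rewrite !tcat12E at_mkDl.
Qed.
Lemma wedge12Dr th t t' : th ∧12 (t + t') = th ∧12 t + th ∧12 t'.
Proof.
rewrite /wedge -(kactD (lM 3)) -(antisymD (braid_linear3 dual)).
by rewrite !tcat12E at_mkDr.
Qed.
Lemma wedge12_bal th a t : of_mulr th a ∧12 t = th ∧12 (lact a t).
Proof. by rewrite /wedge !tcat12E (at_mk_bal (M := tpow A 2)). Qed.
Lemma wedge12_lact a th t : (a *: th) ∧12 t = lact a (th ∧12 t).
Proof.
rewrite /wedge -(kact_lact (lM 3)) -(antisym_lact (braid_linear3 dual)).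
by rewrite !tcat12E (lact_mk (M := tpow A 2)).
Qed.

Lemma wedge21Dl t t' th : (t + t') ∧21 th = t ∧21 th + t' ∧21 th.
Proof.
rewrite /wedge -(kactD (lM 3)) -(antisymD (braid_linear3 dual)).
congr (kact _ (antisym _)); apply: (ev3_inj dual) => u v z.
by rewrite ev3D !ev3_tcat21 ev2D vf_mulrDr cfD.
Qed.
Lemma wedge21Dr t th th' : t ∧21 (th + th') = t ∧21 th + t ∧21 th'.
Proof.
rewrite /wedge -(kactD (lM 3)) -(antisymD (braid_linear3 dual)).
congr (kact _ (antisym _)); apply: (ev3_inj dual) => u v z.
by rewrite ev3D !ev3_tcat21.
Qed.
Lemma wedge21_bal t a th : ract t a ∧21 th = t ∧21 (a *: th).
Proof.
rewrite /wedge; congr (kact _ (antisym _)); apply: (ev3_inj dual) => u v z.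
by rewrite !ev3_tcat21 ev2_ract vf_mulrA of_scaleE.
Qed.
(** Both products are a multiple of the antisymmetrization of the triple tensor
    product, because the antisymmetrizer changes sign under each braiding. *)
Lemma wedge_assoc th eta zeta :
  (th ∧11 eta) ∧21 zeta = th ∧12 (eta ∧11 zeta).
Proof.
pose x : tpow A 3 :=
  @at_mk _ _ _ F1 (tpow A 2) th (@at_mk _ _ _ F1 F1 eta zeta).
pose i1 : 'I_3 := Ordinal (isT : (1 < 3)%N).
rewrite !(wedge11E unit2 dual) /wedge [2`!%:R * _]mulrC; congr kact.
have -> : @tcat _ _ A 2 1 ((at_mk (th : F1) (eta : F1) : tpow A 2)
    - bd (at_mk (th : F1) (eta : F1))) zeta = x - braid_at 0 x.
  apply: (ev3_inj dual) => u v z.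
  rewrite ev3D ev3N ev3_tcat21 ev2D ev2N ev2_braid ev3_braid_0.
  rewrite vf_mulrDr cfD form_vf_mulrN vf_mulr_sum cf_sum; congr (_ - _).
    by rewrite ev3_mk !ev2_mk.
  by apply: eq_bigr => q _; rewrite ev3_mk !ev2_mk.
have -> : @tcat _ _ A 1 2 th ((at_mk (eta : F1) (zeta : F1) : tpow A 2)
    - bd (at_mk (eta : F1) (zeta : F1))) = x - braid_at 1 x.
  apply: (ev3_inj dual) => u v z.
  rewrite tcat12E ev3D ev3N ev3_braid_1 ev3_mk ev2D ev2N ev2_braid_mulr.
  rewrite -ev3_mk; congr (_ - _).
  by apply: eq_bigr => q _; rewrite ev3_mk.
have b3 := braid_linear3 dual; have c3 := coherent3 dual.
rewrite !(antisymD b3) !(antisymN b3).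
by rewrite (@antisym_braid _ _ _ 3 ord0 i1) // (@antisym_braid _ _ _ 3 i1 ord_max).
Qed.

Lemma wedge11_suml (I : Type) (r : seq I) (th : I -> oneform A) eta :
  (\sum_(i <- r) th i) ∧11 eta = \sum_(i <- r) th i ∧11 eta.
Proof.
by apply: (additive_sum (h := fun th => th ∧11 eta)) => ? ?; exact: wedge11Dl.
Qed.
Lemma wedge11_sumr (I : Type) (r : seq I) th (eta : I -> oneform A) :
  th ∧11 (\sum_(i <- r) eta i) = \sum_(i <- r) th ∧11 eta i.
Proof. exact: (additive_sum (wedge11Dr th)). Qed.
End WedgeThree.

(** * Exterior derivative and the Cartan formula *)

Section Derivative.
Variables (k : comUnitRingType) (H : triangularHopfAlgebra k).
Variable A : braidedAlgebra H.
Hypothesis unit2 : 2%:R \is a @GRing.unit k.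
Variables (n : nat) (e : 'I_n -> vfield A) (om : 'I_n -> oneform A).
Hypothesis dual : dual_bases e om.
Variable d : forall r, tpow A r -> tpow A r.+1.
Arguments d : clear implicits.
Hypothesis d_ext : exterior_derivative d.
Local Notation F1 := (amod_form A).
Local Notation bd := (@braid_at _ _ A 2 0).
Local Notation lM := (lmod_laws_tpow A).
Local Notation R' := (tseq (rmat_inv H)).
Local Notation "th ∧11 eta" := (@wedge _ _ A 1 1 th eta) (at level 40).
Local Notation "th ∧12 t" := (@wedge _ _ A 1 2 th t) (at level 40).
Local Notation "t ∧21 th" := (@wedge _ _ A 2 1 t th) (at level 40).
Implicit Types (th eta zeta : oneform A) (s t : tpow A 2) (x y : tpow A 3).
Implicit Types (a : A) (c : k) (u v : vfield A).

Lemma ext_derD r (x y : tpow A r) : is_form x -> is_form y ->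
  d r (x + y) = d r x + d r y.
Proof.
by move=> fx fy; rewrite -{1}(kact1 (lM r) x) (ext_der_linear d_ext) // (kact1 (lM _)).
Qed.

Lemma d1D th eta : d 1 (th + eta) = d 1 th + d 1 eta.
Proof. by apply: ext_derD; exact: is_form1. Qed.
Lemma d1_form th : is_form (d 1 th).
Proof. by apply: (ext_der_form d_ext); exact: is_form1. Qed.
Lemma d1_exact a : d 1 (of_d a) = 0.
Proof. by rewrite -(ext_der0 d_ext) (ext_der_sq d_ext) //; exact: is_form0. Qed.
Lemma d2_exact th : d 2 (d 1 th) = 0.
Proof. by rewrite (ext_der_sq d_ext) //; exact: is_form1. Qed.

Lemma d1_mulr th a : d 1 (of_mulr th a) = ract (d 1 th) a - th ∧11 of_d a.
Proof.
rewrite -wedge10.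
have -> : d 1 (@wedge _ _ A 1 0 th a) = @wedge _ _ A 2 0 (d 1 th) a
    + @kact _ _ _ (tpow A 2) ((-1) ^+ 1) (th ∧11 d 0 a).
  have := ext_der_leibniz d_ext (r := 1) (s := 0) (x := th) (y := a)
    (is_form1 th) (is_form0 (a : tpow A 0)).
  by have -> : addnS 1 0 = erefl 2 by exact: eq_irrelevance.
rewrite (ext_der0 d_ext) (wedge20 unit2 dual); last exact: d1_form.
by rewrite expr1 (kactNl (lM 2)) (kact1 (lM 2)).
Qed.

Lemma d1_scale a th : d 1 (a *: th) = of_d a ∧11 th + lact a (d 1 th).
Proof.
rewrite -wedge01.
have -> : d 1 (@wedge _ _ A 0 1 a th) = d 0 a ∧11 th
    + @kact _ _ _ (tpow A 2) ((-1) ^+ 0) (@wedge _ _ A 0 2 a (d 1 th)).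
  have := ext_der_leibniz d_ext (r := 0) (s := 1) (x := a) (y := th)
    (is_form0 (a : tpow A 0)) (is_form1 th).
  by have -> : addnS 0 1 = erefl 2 by exact: eq_irrelevance.
rewrite (ext_der0 d_ext) (wedge02 unit2 dual); last exact: d1_form.
by rewrite expr0 (kact1 (lM 2)).
Qed.

Lemma d2_wedge th eta : d 2 (th ∧11 eta) = d 1 th ∧21 eta - th ∧12 d 1 eta.
Proof.
have -> : d 2 (th ∧11 eta) = d 1 th ∧21 eta
    + @kact _ _ _ (tpow A 3) ((-1) ^+ 1) (th ∧12 d 1 eta).
  have := ext_der_leibniz d_ext (r := 1) (s := 1) (x := th) (y := eta)
    (is_form1 th) (is_form1 eta).
  by have -> : addnS 1 1 = erefl 3 by exact: eq_irrelevance.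
by rewrite expr1 (kactNl (lM 3)) (kact1 (lM 3)).
Qed.

Lemma is_formD2 s t : is_form s -> is_form t -> is_form (s + t).
Proof.
move=> /(is_form2P unit2 dual) Es /(is_form2P unit2 dual) Et.
by apply/(is_form2P unit2 dual); rewrite (braidD dual) Es Et opprD.
Qed.
Lemma is_formN2 t : is_form t -> is_form (- t).
Proof.
move=> /(is_form2P unit2 dual) Et.
by apply/(is_form2P unit2 dual); rewrite (braidN dual) Et.
Qed.
Lemma is_form2_0 : is_form (0 : tpow A 2).
Proof. by rewrite -(d1_exact 0); exact: d1_form. Qed.
Lemma is_form_sum2 (I : Type) (r : seq I) (t : I -> tpow A 2) :
  (forall i, is_form (t i)) -> is_form (\sum_(i <- r) t i).
Proof.
move=> ft; apply: big_ind => // [|s s']; [exact: is_form2_0 | exact: is_formD2].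
Qed.

(** For an exact form this is the definition of the bracket, and both sides
    change in the same way when the form is multiplied by a function on the
    right. *)
Lemma cartan_formula th u v :
  ev2 (d 1 th) u v
  = - (u (th v) - \sum_(q <- R') vf_act q.1 v (th (vf_act q.2 u))
       - th (bracket u v)).
Proof.
pose C eta := u (eta v) - \sum_(q <- R') vf_act q.1 v (eta (vf_act q.2 u))
       - eta (bracket u v).
suff: ev2 (d 1 th) u v + C th = 0 by move/eqP; rewrite addr_eq0 => /eqP.
have vD (w : vfield A) : {morph w : a b / a + b} := linD (vf_lin w).
have CD eta zeta : C (eta + zeta) = C eta + C zeta.
  rewrite /C of_addE vD; under eq_bigr do rewrite of_addE vD.
  rewrite big_split /= of_addE !opprD !addrA.
  by rewrite (ACl (1 * 3 * 5 * 2 * 4 * 6))%AC.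
pose D eta := ev2 (d 1 eta) u v + C eta.
have DD eta zeta : D (eta + zeta) = D eta + D zeta.
  by rewrite /D d1D ev2D CD addrACA.
have D0 : D 0 = 0 := additive0 DD.
have DN eta : D (- eta) = - D eta := additiveN DD eta.
have brE a : bracket u v a
    = u (v a) - \sum_(q <- R') vf_act q.1 v (vf_act q.2 u a) by [].
have Dd a : D (of_d a) = 0.
  rewrite /D d1_exact; have -> : ev2 (0 : tpow A 2) u v = 0.
    by apply: (additive0 (h := fun t => ev2 t u v)) => s t; exact: ev2D.
  by rewrite add0r /C !of_dE brE subrr.
have Ddm a b : D (of_mulr (of_d a) b) = 0.
  rewrite /D d1_mulr d1_exact.
  have -> : ract (0 : tpow A 2) b = 0.
    apply: (ev2_inj dual) => u' v'; rewrite ev2_ract -[0](subrr (d 1 th)).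
    by rewrite ev2D ev2N subrr mul0r.
  rewrite sub0r ev2N (ev2_wedge11 unit2 dual).
  have L (w : vfield A) f g : w (f * g) = w f * g + vf_mulr w f g := (vfP w).2 f g.
  rewrite /C !of_mulrE !of_dE L.
  under [X in _ + (_ - X - _)]eq_bigr do rewrite of_mulrE of_dE L.
  rewrite big_split /= -mulr_suml brE mulrBl.
  rewrite !opprD !opprK !addrA.
  by rewrite (ACl (3 * 7 * (5 * 8) * (1 * 4) * (2 * 6)))%AC /= subrr addNr addNr subrr !addr0.
have Dad a b : D (a *: of_d b) = 0.
  have -> : a *: of_d b = of_d (a * b) - of_mulr (of_d a) b.
    apply: of_eq => w.
    have L : w (a * b) = w a * b + vf_mulr w a b := (vfP w).2 a b.
    by rewrite -[RHS]/(w (a * b) - w a * b) L addrC addKr.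
  by rewrite DD DN Dd Ddm subrr.
have [s Es] := ofP th.
have -> : th = \sum_(p <- s) p.1 *: of_d p.2.
  apply: of_eq => w; rewrite Es cf_sumE of_sumE.
  by apply: eq_bigr.
rewrite -/(D _); elim: s {Es} => [|p s IH]; first by rewrite big_nil D0.
by rewrite big_cons DD Dad add0r.
Qed.
End Derivative.

(** * Bianchi identities in a truncated differential calculus *)

Lemma cancel_torsion (V : zmodType) (p q s t : V) :
  t + s = 0 -> p - q - (p + s) = t - q.
Proof.
by move/eqP; rewrite addr_eq0 => /eqP->; rewrite opprD addrACA subrr add0r addrC.
Qed.
Lemma cancel_curvature (V : zmodType) (p q r s g : V) :
  p + g + (q - r) - (p - s) = g + q - r + s.
Proof. by rewrite opprB [s - p]addrC !addrA (ACl (1 * 5 * 2 * 3 * 4 * 6))%AC /= subrr add0r. Qed.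


Section MatrixBianchi.
Variables (A : pzRingType) (F1 : lmodType A) (F2 F3 : zmodType).
Variables (r1 : F1 -> A -> F1) (l2 : A -> F2 -> F2) (r2 : F2 -> A -> F2).
Variable l3 : A -> F3 -> F3.
Variables (w11 : F1 -> F1 -> F2) (w12 : F1 -> F2 -> F3) (w21 : F2 -> F1 -> F3).
Variables (d0 : A -> F1) (d1 : F1 -> F2) (d2 : F2 -> F3) (form : F2 -> Prop).
Implicit Types (a : A) (x y z : F1) (s t : F2) (f g : F3).

(** A differential calculus cut off above degree three. [F2] may be larger than
    the module of 2-forms, which [form] singles out. *)
Record calculus_laws : Prop := CalculusLaws {
  calc_r1Dl : forall x y a, r1 (x + y) a = r1 x a + r1 y a;
  calc_l3D : forall a f g, l3 a (f + g) = l3 a f + l3 a g;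
  calc_w11Dl : forall x y z, w11 (x + y) z = w11 x z + w11 y z;
  calc_w11_lact : forall a x y, w11 (a *: x) y = l2 a (w11 x y);
  calc_w12Dl : forall x y t, w12 (x + y) t = w12 x t + w12 y t;
  calc_w12Dr : forall x s t, w12 x (s + t) = w12 x s + w12 x t;
  calc_w12_bal : forall x a t, w12 (r1 x a) t = w12 x (l2 a t);
  calc_w12_lact : forall a x t, w12 (a *: x) t = l3 a (w12 x t);
  calc_w21Dl : forall s t x, w21 (s + t) x = w21 s x + w21 t x;
  calc_w21Dr : forall t x y, w21 t (x + y) = w21 t x + w21 t y;
  calc_w21_bal : forall t a x, w21 (r2 t a) x = w21 t (a *: x);
  calc_w_assoc : forall x y z, w21 (w11 x y) z = w12 x (w11 y z);
  calc_d0D : forall a b, d0 (a + b) = d0 a + d0 b;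
  calc_d0M : forall a b, d0 (a * b) = r1 (d0 a) b + a *: d0 b;
  calc_d1D : forall x y, d1 (x + y) = d1 x + d1 y;
  calc_d1_exact : forall a, d1 (d0 a) = 0;
  calc_d1_mulr : forall x a, d1 (r1 x a) = r2 (d1 x) a - w11 x (d0 a);
  calc_d1_scale : forall a x, d1 (a *: x) = w11 (d0 a) x + l2 a (d1 x);
  calc_form0 : form 0;
  calc_formD : forall s t, form s -> form t -> form (s + t);
  calc_formN : forall t, form t -> form (- t);
  calc_form_d1 : forall x, form (d1 x);
  calc_form_w11 : forall x y, form (w11 x y);
  calc_d2D : forall s t, form s -> form t -> d2 (s + t) = d2 s + d2 t;
  calc_d2_exact : forall x, d2 (d1 x) = 0;
  calc_d2_w11 : forall x y, d2 (w11 x y) = w21 (d1 x) y - w12 x (d1 y)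
}.
Hypothesis laws : calculus_laws.
Local Notation r1Dl := (calc_r1Dl laws).
Local Notation l3D := (calc_l3D laws).
Local Notation w11Dl := (calc_w11Dl laws).
Local Notation w11_lact := (calc_w11_lact laws).
Local Notation w12Dl := (calc_w12Dl laws).
Local Notation w12Dr := (calc_w12Dr laws).
Local Notation w12_bal := (calc_w12_bal laws).
Local Notation w12_lact := (calc_w12_lact laws).
Local Notation w21Dl := (calc_w21Dl laws).
Local Notation w21Dr := (calc_w21Dr laws).
Local Notation w21_bal := (calc_w21_bal laws).
Local Notation w_assoc := (calc_w_assoc laws).
Local Notation d0D := (calc_d0D laws).
Local Notation d0M := (calc_d0M laws).
Local Notation d1D := (calc_d1D laws).
Local Notation d1_exact := (calc_d1_exact laws).
Local Notation d1_mulr := (calc_d1_mulr laws).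
Local Notation d1_scale := (calc_d1_scale laws).
Local Notation form0 := (calc_form0 laws).
Local Notation formD := (calc_formD laws).
Local Notation formN := (calc_formN laws).
Local Notation form_d1 := (calc_form_d1 laws).
Local Notation form_w11 := (calc_form_w11 laws).
Local Notation d2D := (calc_d2D laws).
Local Notation d2_exact := (calc_d2_exact laws).
Local Notation d2_w11 := (calc_d2_w11 laws).

Let w11_suml I (r : seq I) (x : I -> F1) y :
  w11 (\sum_(i <- r) x i) y = \sum_(i <- r) w11 (x i) y.
Proof. by apply: (additive_sum (h := w11^~ y)) => ? ?; exact: w11Dl. Qed.
Let w12_suml I (r : seq I) (x : I -> F1) t :
  w12 (\sum_(i <- r) x i) t = \sum_(i <- r) w12 (x i) t.
Proof. by apply: (additive_sum (h := w12^~ t)) => ? ?; exact: w12Dl. Qed.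
Let w12_sumr I (r : seq I) x (t : I -> F2) :
  w12 x (\sum_(i <- r) t i) = \sum_(i <- r) w12 x (t i).
Proof. by apply: additive_sum => ? ?; exact: w12Dr. Qed.
Let w21_suml I (r : seq I) x (t : I -> F2) :
  w21 (\sum_(i <- r) t i) x = \sum_(i <- r) w21 (t i) x.
Proof. by apply: (additive_sum (h := w21^~ x)) => ? ?; exact: w21Dl. Qed.
Let w21_sumr I (r : seq I) (x : I -> F1) t :
  w21 t (\sum_(i <- r) x i) = \sum_(i <- r) w21 t (x i).
Proof. by apply: additive_sum => ? ?; exact: w21Dr. Qed.
Let w12N x t : w12 x (- t) = - w12 x t.
Proof. by apply: additiveN => ? ?; exact: w12Dr. Qed.
Let w12Nl x t : w12 (- x) t = - w12 x t.
Proof. by apply: (additiveN (h := w12^~ t)) => ? ?; exact: w12Dl. Qed.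
Let w21N t x : w21 (- t) x = - w21 t x.
Proof. by apply: (additiveN (h := w21^~ x)) => ? ?; exact: w21Dl. Qed.
Let d0_sum I (r : seq I) (a : I -> A) : d0 (\sum_(i <- r) a i) = \sum_(i <- r) d0 (a i).
Proof. by apply: additive_sum => ? ?; exact: d0D. Qed.
Let d1_sum I (r : seq I) (x : I -> F1) : d1 (\sum_(i <- r) x i) = \sum_(i <- r) d1 (x i).
Proof. by apply: additive_sum => ? ?; exact: d1D. Qed.
Let l3_sum a I (r : seq I) (f : I -> F3) : l3 a (\sum_(i <- r) f i) = \sum_(i <- r) l3 a (f i).
Proof. by apply: additive_sum => ? ?; exact: l3D. Qed.
Let l3N a f : l3 a (- f) = - l3 a f.
Proof. by apply: additiveN => ? ?; exact: l3D. Qed.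
Let form_sum I (r : seq I) (t : I -> F2) : (forall i, form (t i)) -> form (\sum_(i <- r) t i).
Proof. by move=> ft; apply: big_ind => //; [exact: form0 | exact: formD]. Qed.
Let d2_0 : d2 0 = 0.
Proof. by apply: (addrI (d2 0)); rewrite -d2D ?addr0 //; exact: form0. Qed.
Let d2N t : form t -> d2 (- t) = - d2 t.
Proof.
move=> ft; apply: (addrI (d2 t)); rewrite -d2D ?subrr ?d2_0 //; exact: formN.
Qed.
Let d2_sum I (r : seq I) (t : I -> F2) : (forall i, form (t i)) ->
  d2 (\sum_(i <- r) t i) = \sum_(i <- r) d2 (t i).
Proof.
move=> ft; elim: r => [|i r IH]; first by rewrite !big_nil d2_0.
by rewrite !big_cons d2D ?IH //; exact: form_sum.
Qed.

Local Notation "x ∧11 y" := (w11 x y) (at level 40).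
Local Notation "x ∧12 t" := (w12 x t) (at level 40).
Local Notation "t ∧21 x" := (w21 t x) (at level 40).

(** [a] stands for the matrix of pairings of a pair of dual bases: it is
    idempotent, and it is the identity matrix only for a basis of a free
    module. [w] stands for the connection forms. *)
Variables (n : nat) (om : 'I_n -> F1).
Variables (a : 'I_n -> 'I_n -> A) (w G : 'I_n -> 'I_n -> F1).
Hypothesis om_a : forall j, \sum_i r1 (om i) (a i j) = om j.
Hypothesis aa : forall i l, \sum_j a i j * a j l = a i l.
Hypothesis aw : forall i l, \sum_j a i j *: w j l = w i l.
Hypothesis Ga : forall i l, \sum_j r1 (G i j) (a j l) = G i l.
Hypothesis da : forall i j, d0 (a i j) = G i j + w i j.

(** Minus the matrix of curvature forms. *)
Definition mx_curvature i l : F2 := d1 (w i l) - \sum_j G i j ∧11 w j l.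
Definition mx_torsion l : F2 := d1 (om l) + \sum_j om j ∧11 w j l.

(** Differentiating [om a = om] gives [om da = (d om) a - d om], which the relation
    [a w = w] annihilates. *)
Lemma om_d_pairing l : \sum_i \sum_j om i ∧12 (d0 (a i j) ∧11 w j l) = 0.
Proof.
have E j : \sum_i om i ∧11 d0 (a i j)
    = \sum_i r2 (d1 (om i)) (a i j) - d1 (om j).
  rewrite -(om_a j) d1_sum -sumrB; apply: eq_bigr => i _.
  by rewrite d1_mulr opprB addrC subrK.
transitivity (\sum_j (\sum_i om i ∧11 d0 (a i j)) ∧21 w j l).
  rewrite exchange_big; apply: eq_bigr => j _; rewrite w21_suml.
  by apply: eq_bigr => i _; rewrite w_assoc.
under eq_bigr do rewrite E w21Dl w21N w21_suml.
rewrite big_split sumrN; apply/eqP; rewrite subr_eq0; apply/eqP.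
rewrite exchange_big; apply: eq_bigr => i _.
rewrite -[in RHS](aw i l) w21_sumr; apply: eq_bigr => j _.
exact: w21_bal.
Qed.

Lemma torsion_bianchi l :
  d2 (mx_torsion l) - \sum_j mx_torsion j ∧21 w j l = \sum_j om j ∧12 (- mx_curvature j l).
Proof.
have f1 j : form (om j ∧11 w j l) by exact: form_w11.
rewrite /mx_torsion d2D; first last.
- exact: form_sum.
- exact: form_d1.
rewrite d2_exact add0r d2_sum //.
under eq_bigr do rewrite d2_w11.
under [X in _ - X]eq_bigr do rewrite w21Dl w21_suml.
under [RHS]eq_bigr do rewrite /mx_curvature opprB w12Dr w12N w12_sumr.
rewrite sumrB !big_split sumrN /=.
apply: cancel_torsion; rewrite [X in _ + X]exchange_big -big_split /=.
rewrite -[RHS](om_d_pairing l).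
apply: eq_bigr => i _; rewrite -big_split; apply: eq_bigr => j _ /=.
by rewrite w_assoc -w12Dr -w11Dl da.
Qed.

(** Differentiate [a a = a]. *)
Lemma pairing_d_pairing i l :
  \sum_j a i j *: d0 (a j l) = w i l - \sum_j r1 (w i j) (a j l).
Proof.
have E : d0 (a i l) = G i l + \sum_j r1 (w i j) (a j l)
    + \sum_j a i j *: d0 (a j l).
  rewrite -{1}aa -(Ga i l) -!big_split /=.
  rewrite d0_sum; apply: eq_bigr => j _; rewrite d0M da; congr (_ + _).
  exact: r1Dl.
move: E; rewrite da -addrA => /addrI ->.
by rewrite [RHS]addrC addKr.
Qed.

(** For a basis of a free module [a] is constant, and the right side reduces to
    zero by [G = - w]. *)
Lemma curvature_identity i l :
  d2 (mx_curvature i l) + \sum_j w i j ∧12 mx_curvature j l - \sum_j mx_curvature i j ∧21 w j l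
  = \sum_j d0 (a i j) ∧12 d1 (w j l)
    - \sum_j \sum_m w i j ∧12 (G j m ∧11 w m l)
    + \sum_j \sum_m G i j ∧12 (w j m ∧11 w m l).
Proof.
have fw x y : form (x ∧11 y) by exact: form_w11.
have dG j : d1 (G i j) = - d1 (w i j).
  apply/eqP; rewrite -addr_eq0 -d1D -da; apply/eqP.
  exact: d1_exact.
have -> : d2 (mx_curvature i l) = \sum_j d1 (w i j) ∧21 w j l
    + \sum_j G i j ∧12 d1 (w j l).
  have fs : form (\sum_j G i j ∧11 w j l).
    exact: form_sum.
  rewrite /mx_curvature d2D; first last.
  - exact: formN.
  - exact: form_d1.
  rewrite d2_exact add0r d2N //.
  rewrite d2_sum // -sumrN -big_split.
  apply: eq_bigr => j _ /=.
  by rewrite d2_w11 dG w21N opprB opprK addrC.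
have -> : \sum_j w i j ∧12 mx_curvature j l = \sum_j w i j ∧12 d1 (w j l)
    - \sum_j \sum_m w i j ∧12 (G j m ∧11 w m l).
  rewrite -sumrB; apply: eq_bigr => j _.
  by rewrite w12Dr w12N w12_sumr.
have -> : \sum_j mx_curvature i j ∧21 w j l = \sum_j d1 (w i j) ∧21 w j l
    - \sum_j \sum_m G i j ∧12 (w j m ∧11 w m l).
  rewrite [X in _ - X]exchange_big -sumrB; apply: eq_bigr => j _.
  rewrite w21Dl w21N w21_suml; congr (_ - _).
  by apply: eq_bigr => m _; rewrite w_assoc.
under [in RHS]eq_bigr do rewrite da w12Dl.
rewrite big_split; exact: cancel_curvature.
Qed.

(** Multiplying by [a] turns [a da] into [w - w a], and [w - w a] annihilates [w]
    as [a w = w]; the remaining terms cancel by [da = G + w]. *)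
Lemma pairing_curvature i l :
  \sum_m l3 (a i m) (d2 (mx_curvature m l) + \sum_j w m j ∧12 mx_curvature j l
                       - \sum_j mx_curvature m j ∧21 w j l) = 0.
Proof.
pose U i j := w i j - \sum_m r1 (w i m) (a m j).
have aG j : \sum_m a i m *: G m j = U i j - w i j.
  rewrite /U -(pairing_d_pairing i j) -(aw i j) -sumrB; apply: eq_bigr => m _.
  by rewrite da -scalerBr addrK.
have UE (t : 'I_n -> F2) : \sum_j U i j ∧12 t j
    = \sum_j w i j ∧12 (t j - \sum_m l2 (a j m) (t m)).
  under eq_bigr do rewrite w12Dl w12Nl w12_suml.
  rewrite sumrB exchange_big -sumrB; apply: eq_bigr => j _.
  rewrite w12Dr w12N w12_sumr; congr (_ - _).
  by apply: eq_bigr => m _; rewrite (w12_bal).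
have dw j : d1 (w j l) - \sum_m l2 (a j m) (d1 (w m l))
    = \sum_m d0 (a j m) ∧11 w m l.
  rewrite -{1}(aw j l) d1_sum -sumrB; apply: eq_bigr => m _.
  by rewrite d1_scale addrK.
have ww j m : w j m ∧11 w m l - \sum_p l2 (a j p) (w p m ∧11 w m l) = 0.
  rewrite -{1}(aw j m) w11_suml -sumrB big1 // => p _.
  by rewrite w11_lact subrr.
under eq_bigr do rewrite curvature_identity l3D l3D l3N !l3_sum.
rewrite !big_split sumrN /=.
have -> : \sum_m \sum_j l3 (a i m) (d0 (a m j) ∧12 d1 (w j l))
    = \sum_j \sum_m w i j ∧12 (d0 (a j m) ∧11 w m l).
  transitivity (\sum_j U i j ∧12 d1 (w j l)).
    rewrite exchange_big; apply: eq_bigr => j _; rewrite /U -pairing_d_pairing.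
    rewrite w12_suml; apply: eq_bigr => m _.
    by rewrite w12_lact.
  rewrite UE; apply: eq_bigr => j _; by rewrite dw w12_sumr.
have -> : \sum_m \sum_j l3 (a i m) (\sum_p w m j ∧12 (G j p ∧11 w p l))
    = \sum_j \sum_m w i j ∧12 (G j m ∧11 w m l).
  rewrite exchange_big; apply: eq_bigr => j _; rewrite -w12_sumr -(aw i j).
  rewrite w12_suml; apply: eq_bigr => m _.
  by rewrite -w12_sumr w12_lact.
have -> : \sum_m \sum_j l3 (a i m) (\sum_p G m j ∧12 (w j p ∧11 w p l))
    = - \sum_j \sum_m w i j ∧12 (w j m ∧11 w m l).
  transitivity (\sum_j \sum_m (U i j - w i j) ∧12 (w j m ∧11 w m l)).
    rewrite exchange_big; apply: eq_bigr => j _; rewrite -w12_sumr -aG.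
    rewrite w12_suml; apply: eq_bigr => m _.
    by rewrite -w12_sumr w12_lact.
  rewrite exchange_big [in RHS]exchange_big -sumrN; apply: eq_bigr => m _.
  under eq_bigr do rewrite w12Dl w12Nl.
  rewrite sumrB UE big1 ?sub0r // => j _.
  by rewrite ww (additive0 (w12Dr (w i j))).
rewrite -!sumrB big1 // => j _; rewrite -!sumrB big1 // => m _.
rewrite -w12N -w12Dr da w11Dl addrAC subrr add0r.
by rewrite subrr.
Qed.

Let form_curvature i l : form (mx_curvature i l).
Proof.
apply: formD; first exact: form_d1.
by apply: formN; apply: form_sum => j; exact: form_w11.
Qed.

Lemma curvature_bianchi i l :
  \sum_m l3 (a i m) (d2 (- mx_curvature m l) + \sum_j w m j ∧12 (- mx_curvature j l)
                     - \sum_j (- mx_curvature m j) ∧21 w j l) = 0.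
Proof.
transitivity (- \sum_m l3 (a i m) (d2 (mx_curvature m l) + \sum_j w m j ∧12 mx_curvature j l
                                   - \sum_j mx_curvature m j ∧21 w j l)).
  rewrite -sumrN; apply: eq_bigr => m _.
  rewrite -l3N d2N; last exact: form_curvature.
  congr (l3 _ _).
  under eq_bigr do rewrite w12N.
  under [X in _ - X]eq_bigr do rewrite w21N.
  by rewrite !sumrN -!opprD.
by rewrite pairing_curvature oppr0.
Qed.
End MatrixBianchi.

(** * Structure equations and Bianchi identities *)

Lemma cancel_cartan_curvature (V : zmodType) (p q r s c r' s' : V) :
  - (p - r - (q - s) - (p - q - c)) - (r - r' - (s - s')) = r' - s' - c.
Proof.
rewrite !opprD !opprK !addrA.
rewrite (ACl (9 * 11 * 7 * (1 * 5) * (2 * 8) * (3 * 6) * (4 * 10)))%AC /=.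
by rewrite !addNr !subrr !addr0.
Qed.
Lemma cancel_cartan_torsion (V : zmodType) (p q b r s : V) :
  - (p - q - b) + (p - r - (q - s)) = - (r - s - b).
Proof.
rewrite !opprD !opprK !addrA.
by rewrite (ACl (1 * 4 * (2 * 6) * 5 * 7 * 3))%AC /= addNr subrr !add0r.
Qed.

Section Structure.
Variables (k : comUnitRingType) (H : triangularHopfAlgebra k).
Variable A : braidedAlgebra H.
Hypothesis unit2 : 2%:R \is a @GRing.unit k.
Variables (n : nat) (e : 'I_n -> vfield A) (om : 'I_n -> oneform A).
Hypothesis dual : dual_bases e om.
Variable d : forall r, tpow A r -> tpow A r.+1.
Arguments d : clear implicits.
Hypothesis d_ext : exterior_derivative d.
Variables (nabla : vfield A -> atens (amod_form A) (amod_vf A)).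
Variable (nablas : oneform A -> tpow A 2).
Hypothesis nablas_dual : dual_connection nabla nablas.
Local Notation F1 := (amod_form A).
Local Notation bd := (@braid_at _ _ A 2 0).
Local Notation lM := (lmod_laws_tpow A).
Local Notation R' := (tseq (rmat_inv H)).
Local Notation "x ∧11 y" := (@wedge _ _ A 1 1 x y) (at level 40).
Implicit Types (th eta : oneform A) (t : tpow A 2) (u v z : vfield A).

Lemma calculus_forms :
  calculus_laws (F1 := oneform A) (@of_mulr k H A) (@lact _ _ _ (tpow A 2))
    (@ract _ _ _ (tpow A 2)) (@lact _ _ _ (tpow A 3)) (@wedge _ _ A 1 1)
    (@wedge _ _ A 1 2) (@wedge _ _ A 2 1) (@of_d k H A) (d 1) (d 2)
    (@is_form _ _ A 2).
Proof.
split.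
- by move=> th eta a; apply: of_eq => u; rewrite of_mulrE !of_addE mulrDl.
- by move=> a x y; exact: (lactDr (lM 3)).
- exact: (wedge11Dl dual).
- exact: (wedge11_lact dual).
- exact: (wedge12Dl dual).
- exact: (wedge12Dr dual).
- exact: wedge12_bal.
- exact: (wedge12_lact dual).
- exact: (wedge21Dl dual).
- exact: (wedge21Dr dual).
- exact: (wedge21_bal dual).
- exact: (wedge_assoc unit2 dual).
- by move=> a b; apply: of_eq => u; exact: (linD (vf_lin u)).
- by move=> a b; apply: of_eq => u; exact: (vfP u).2.
- exact: (d1D d_ext).
- exact: (d1_exact d_ext).
- exact: (d1_mulr unit2 dual d_ext).
- exact: (d1_scale unit2 dual d_ext).
- exact: (is_form2_0 d_ext).
- exact: (is_formD2 unit2 dual).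
- exact: (is_formN2 unit2 dual).
- exact: (d1_form d_ext).
- exact: (is_form_wedge11 unit2 dual).
- exact: (ext_derD d_ext).
- exact: (d2_exact d_ext).
- exact: (d2_wedge d_ext).
Qed.

(** As [om j] wedge [om i] is [om j (x) om i] minus its braiding, the double sum
    is [t] minus the braiding of [t], that is twice [t]. *)
Lemma two_form_expand t (f : 'I_n -> 'I_n -> A) : is_form t ->
  (forall i j, f i j = ev2 t (e i) (e j)) ->
  kact (- 2^-1) (\sum_i \sum_j ract (wedge_om om j i) (f i j)) = - t.
Proof.
move=> ft Ef; pose X i j : tpow A 2 := ract (at_mk (om j : F1) (om i : F1) : tpow A 2) (f i j).
have XE : \sum_i \sum_j X i j = t.
  rewrite exchange_big [RHS](tens_expand dual); apply: eq_bigr => j _.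
  rewrite (form_expand dual (ctr (e j) t)) at_mk_sum; apply: eq_bigr => i _.
  apply: (ev2_inj dual) => u v; rewrite ev2_ract !ev2_mk.
  by rewrite of_mulrE Ef.
have bD := braidD dual.
have bS (I : Type) (r : seq I) (s : I -> tpow A 2) :
    bd (\sum_(i <- r) s i) = \sum_(i <- r) bd (s i).
  exact: (additive_sum bD).
have -> : \sum_i \sum_j ract (wedge_om om j i) (f i j) = t + t.
  rewrite -[X in _ = _ + X]opprK -(proj1 (is_form2P unit2 dual t) ft) -{1 2}XE bS.
  rewrite -sumrB; apply: eq_bigr => i _; rewrite bS -sumrB; apply: eq_bigr => j _.
  rewrite /X (braid_ract dual) /wedge_om (wedge11E unit2 dual).
  apply: (ev2_inj dual) => u v; rewrite ev2D ev2N !ev2_ract.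
  by rewrite ev2D ev2N mulrDl mulNr.
by rewrite (kactNl (lM 2)) (kact_half_double unit2).
Qed.

Definition dual_conn th z : oneform A := contract z (nablas th).

Lemma dual_conn_val th u v : dual_conn th v u = u (th v) - th (cov nabla u v).
Proof.
have := congr1 (fun eta : oneform A => eta u) (nablas_dual v th).
rewrite of_dE of_addE of_sumE => ->.
rewrite [X in X + _ - _](_ : _ = th (cov nabla u v)); first by rewrite addrC addKr.
by rewrite cf_sum; apply: eq_bigr => p _; rewrite cfZ.
Qed.

Lemma ev2_nablas th u v : ev2 (nablas th) u v = dual_conn th v u.
Proof. by []. Qed.

(** First structure equation: the Cartan formula gives the derivatives and the
    bracket, the two tensors give the covariant derivatives. *)
Lemma ev2_torsion th u v :
  ev2 (d 1 th + (nablas th - bd (nablas th))) u v = - th (torsion nabla u v).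
Proof.
have E : \sum_(q <- R') ev2 (nablas th) (vf_act q.1 v) (vf_act q.2 u)
    = \sum_(q <- R') vf_act q.1 v (th (vf_act q.2 u))
      - th (\sum_(q <- R') cov nabla (vf_act q.1 v) (vf_act q.2 u)).
  by rewrite cf_sum -sumrB; apply: eq_bigr => q _; rewrite ev2_nablas dual_conn_val.
have thN : {morph th : z / - z} := additiveN (cfD th).
rewrite !ev2D ev2N (cartan_formula unit2 dual d_ext) ev2_braid E.
rewrite ev2_nablas dual_conn_val /torsion !cfD !thN.
exact: cancel_cartan_torsion.
Qed.

Lemma dual_connD th : {morph dual_conn th : z z' / z + z'}.
Proof. by move=> z z'; exact: (ctr_vfD (lmod_laws_form A)). Qed.
Lemma dual_connZ th a z : dual_conn th (a *: z) = a *: dual_conn th z.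
Proof. exact: (ctr_vfZ (lmod_laws_form A)). Qed.
Lemma dual_conn_sum th (I : Type) (r : seq I) (z : I -> vfield A) :
  dual_conn th (\sum_(i <- r) z i) = \sum_(i <- r) dual_conn th (z i).
Proof. exact: (additive_sum (dual_connD th)). Qed.

Lemma dual_conn_cov th u v z :
  dual_conn th (cov nabla v z) u
  = \sum_(p <- tseq (nabla z)) dual_conn th p.2 (vf_mulr u ((p.1 : oneform A) v)).
Proof.
rewrite /cov dual_conn_sum of_sumE; apply: eq_bigr => p _.
by rewrite dual_connZ of_scaleE.
Qed.

(** Minus the curvature form: the dual connection, extended to forms with values
    in one-forms and applied twice to [th], paired with [z]. *)
Definition curv_2form th z : tpow A 2 := d 1 (dual_conn th z)
  - \sum_(p <- tseq (nabla z)) (p.1 : oneform A) ∧11 dual_conn th p.2.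

(** Second structure equation. As the left side comes from a form, it also shows
    that the curvature paired with [th] is left [A]-linear in [u (x) v] and
    braided antisymmetric. *)
Lemma ev2_curv_2form th u v z : ev2 (curv_2form th z) u v = th (curvature nabla u v z).
Proof.
have thN : {morph th : x / - x} := additiveN (cfD th).
have -> : ev2 (curv_2form th z) u v = ev2 (d 1 (dual_conn th z)) u v
    - (dual_conn th (cov nabla v z) u
       - \sum_(q <- R') dual_conn th (cov nabla (vf_act q.2 u) z) (vf_act q.1 v)).
  rewrite ev2D ev2N ev2_sum; congr (_ - _); rewrite dual_conn_cov.
  under [X in _ = _ - X]eq_bigr do rewrite dual_conn_cov.
  rewrite exchange_big -sumrB; apply: eq_bigr => p _.
  by rewrite (ev2_wedge11 unit2 dual).
rewrite (cartan_formula unit2 dual d_ext) !dual_conn_val.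
have vB (w : vfield A) : {morph w : a b / a - b} := linB (vf_lin w).
have E1 : \sum_(q <- R') vf_act q.1 v (dual_conn th z (vf_act q.2 u))
   = \sum_(q <- R') vf_act q.1 v (vf_act q.2 u (th z))
     - \sum_(q <- R') vf_act q.1 v (th (cov nabla (vf_act q.2 u) z)).
  by rewrite -sumrB; apply: eq_bigr => q _; rewrite dual_conn_val vB.
have E2 : \sum_(q <- R') dual_conn th (cov nabla (vf_act q.2 u) z) (vf_act q.1 v)
   = \sum_(q <- R') vf_act q.1 v (th (cov nabla (vf_act q.2 u) z))
     - th (\sum_(q <- R') cov nabla (vf_act q.1 v) (cov nabla (vf_act q.2 u) z)).
  by rewrite cf_sum -sumrB; apply: eq_bigr => q _; rewrite dual_conn_val.
have -> : bracket u v (th z) = u (v (th z))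
    - \sum_(q <- R') vf_act q.1 v (vf_act q.2 u (th z)) by [].
rewrite E1 E2 vB /curvature !cfD !thN.
exact: cancel_cartan_curvature.
Qed.

Lemma is_form_curv_2form th z : is_form (curv_2form th z).
Proof.
apply: (is_formD2 unit2 dual); first exact: (d1_form d_ext).
apply: (is_formN2 unit2 dual); apply: (is_form_sum2 unit2 dual d_ext) => p.
exact: (is_form_wedge11 unit2 dual).
Qed.

(** The matrices [a], [w] and [G] of the truncated calculus. *)
Definition pairing i j : A := om j (e i).
Definition conn_mx i j : oneform A := dual_conn (om j) (e i).
Definition nabla_mx i j : oneform A :=
  \sum_(p <- tseq (nabla (e i))) of_mulr p.1 (om j p.2).

Lemma om_pairing j : \sum_i of_mulr (om i) (pairing i j) = om j.
Proof. exact/esym/(form_expand dual). Qed.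
Lemma pairing_idem i l : \sum_j pairing i j * pairing j l = pairing i l.
Proof.
rewrite /pairing [in RHS](dual (e i)) cf_sum.
by apply: eq_bigr => j _; rewrite cfZ.
Qed.
Lemma pairing_conn i l : \sum_j pairing i j *: conn_mx j l = conn_mx i l.
Proof.
rewrite /conn_mx [in RHS](dual (e i)) dual_conn_sum.
by apply: eq_bigr => j _; rewrite dual_connZ.
Qed.
Lemma nabla_pairing i l : \sum_j of_mulr (nabla_mx i j) (pairing j l) = nabla_mx i l.
Proof.
apply: of_eq => u; rewrite !of_sumE.
under eq_bigr do rewrite of_mulrE of_sumE mulr_suml.
rewrite exchange_big; apply: eq_bigr => p _ /=.
rewrite [in RHS]of_mulrE -[in RHS](om_pairing l) of_sumE mulr_sumr.
by apply: eq_bigr => j _; rewrite !of_mulrE mulrA.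
Qed.
Lemma d_pairing i j : of_d (pairing i j) = nabla_mx i j + conn_mx i j.
Proof. exact: nablas_dual. Qed.

Local Notation rhof := (mx_curvature (@wedge _ _ A 1 1) (d 1) conn_mx nabla_mx).
Local Notation tauf := (mx_torsion (@wedge _ _ A 1 1) (d 1) om conn_mx).

Lemma curv_2formE m l : curv_2form (om l) (e m) = rhof m l.
Proof.
congr (_ - _); under [RHS]eq_bigr do rewrite (wedge11_suml dual).
rewrite exchange_big; apply: eq_bigr => p _ /=.
rewrite {1}(dual p.2) dual_conn_sum (wedge11_sumr dual); apply: eq_bigr => j _.
by rewrite dual_connZ (wedge11_bal).
Qed.

Lemma curv_formE m l : curv_form nabla e om m l = - rhof m l.
Proof.
rewrite -curv_2formE; apply: two_form_expand; first exact: is_form_curv_2form.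
by move=> i j; rewrite ev2_curv_2form.
Qed.

Lemma tors_formE l : tors_form nabla e om l = tauf l.
Proof.
have tauE : d 1 (om l) + (nablas (om l) - bd (nablas (om l))) = tauf l.
  congr (_ + _); rewrite [in LHS](tens_expand dual (nablas (om l))).
  have bS (s : 'I_n -> tpow A 2) : bd (\sum_i s i) = \sum_i bd (s i).
    exact: (additive_sum (braidD dual)).
  by rewrite bS -sumrB; apply: eq_bigr => j _; rewrite (wedge11E unit2 dual).
rewrite -[RHS]opprK; apply: two_form_expand.
  apply: (is_formN2 unit2 dual); apply: (is_formD2 unit2 dual).
    exact: (d1_form d_ext).
  apply: (is_form_sum2 unit2 dual d_ext) => j.
  exact: (is_form_wedge11 unit2 dual).
by move=> i j; rewrite -tauE ev2N ev2_torsion opprK.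
Qed.

Lemma bianchi_torsion l :
  d 2 (tors_form nabla e om l)
    - \sum_j @wedge _ _ A 2 1 (tors_form nabla e om j) (conn_mx j l)
  = \sum_j @wedge _ _ A 1 2 (om j) (curv_form nabla e om j l).
Proof.
rewrite tors_formE; under eq_bigr do rewrite tors_formE.
under [RHS]eq_bigr do rewrite curv_formE.
exact: (torsion_bianchi calculus_forms om_pairing pairing_conn d_pairing).
Qed.

(** Since [om m] is the sum of the [om i] times [pairing i m], the tensor product
    with [om] sees the bracket only after multiplication by the idempotent. *)
Lemma bianchi_curvature l :
  \sum_m @at_mk _ _ _ F1 (tpow A 3) (om m)
    (d 2 (curv_form nabla e om m l)
     + \sum_j @wedge _ _ A 1 2 (conn_mx m j) (curv_form nabla e om j l)
     - \sum_j @wedge _ _ A 2 1 (curv_form nabla e om m j) (conn_mx j l)) = 0.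
Proof.
pose X m : tpow A 3 := d 2 (- rhof m l)
    + \sum_j @wedge _ _ A 1 2 (conn_mx m j) (- rhof j l)
    - \sum_j @wedge _ _ A 2 1 (- rhof m j) (conn_mx j l).
transitivity (\sum_m \sum_i
    @at_mk _ _ _ F1 (tpow A 3) (om i) (lact (pairing i m) (X m))).
  apply: eq_bigr => m _; rewrite -{1}(om_pairing m) at_mk_suml.
  apply: eq_bigr => i _; rewrite at_mk_bal /X -curv_formE.
  congr (at_mk _ (lact _ (_ + _ - _))); apply: eq_bigr => j _.
    by rewrite -curv_formE.
  by rewrite -curv_formE.
rewrite exchange_big big1 // => i _; rewrite -at_mk_sum /X.
rewrite (curvature_bianchi calculus_forms pairing_idem pairing_conn nabla_pairing
  d_pairing).
exact: at_mk0.
Qed.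
End Structure.

(** * Ground ring and conclusion *)

Lemma ground_unit2 (k : comUnitRingType) :
  ground_ring k -> 2%:R \is a @GRing.unit k.
Proof.
case=> [[ch0 unit_k]|[K [ch0 [coef [coef_bij coefD coefM]]]]].
  apply: unit_k; apply/negP => k2; have := ch0 2%N.
  by rewrite inE /= k2.
have K2 : 2%:R != 0 :> K.
  by apply/negP => k2; have := ch0 2%N; rewrite inE /= k2.
have [g gK coefK] := coef_bij.
(* the constant power series *)
pose const (c : K) : k := g (fun n => if n is 0 then c else 0).
have constE c n : coef (const c) n = if n is 0 then c else 0 by rewrite coefK.
have const1 : const 1 = 1.
  rewrite -[const 1]mulr1; apply: (can_inj gK); apply: boolp.funext => n.
  rewrite coefM big_ord_recl constE mul1r subn0 big1 ?addr0 // => i _.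
  by rewrite constE mul0r.
have E : const 2%:R^-1 * 2%:R = 1.
  rewrite mulr_natr mulr2n -const1; apply: (can_inj gK).
  apply: boolp.funext => n; rewrite coefD !constE.
  case: n => [|n]; last by rewrite addr0.
  by rewrite -mulr2n -[_ *+ 2]mulr_natr mulVf.
by apply/unitrPr; exists (const 2%:R^-1); rewrite mulrC.
Qed.

Theorem mainTheorem6 (k : comUnitRingType) (k_ground : ground_ring k)
  (H : triangularHopfAlgebra k) (A : braidedAlgebra H)
  (fgp_vf : fg_projective (vfield A)) (fgp_form : fg_projective (oneform A))
  (n : nat) (e : 'I_n -> vfield A) (om : 'I_n -> oneform A)
  (dual_e_om : dual_bases e om)
  (nabla : vfield A -> atens (amod_form A) (amod_vf A))
  (nabla_conn : left_connection nabla)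
  (nablas : oneform A -> tpow A 2)
  (nablas_dual : dual_connection nabla nablas)
  (d : forall r, tpow A r -> tpow A r.+1)
  (d_ext : exterior_derivative d) :
  let w := conn_form e om nablas in
  let R := curv_form nabla e om in
  let T := tors_form nabla e om in
  forall l : 'I_n,
    \sum_m at_mk (om m : amod_form A)
        (d 2%N (R m l) + \sum_j @wedge _ _ A 1 2 (w m j) (R j l)
         - \sum_j @wedge _ _ A 2 1 (R m j) (w j l) : tpow A 3) = 0
    /\ d 2%N (T l) - \sum_j @wedge _ _ A 2 1 (T j) (w j l)
       = \sum_j @wedge _ _ A 1 2 (om j) (R j l).
Proof.
have unit2 := ground_unit2 k_ground.
move=> w R T l; split.
  exact: (bianchi_curvature unit2 dual_e_om d_ext nablas_dual l).
exact: (bianchi_torsion unit2 dual_e_om d_ext nablas_dual l).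
Qed.
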